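(* Let $(M^7,\varphi_i,\xi_i,\eta_i,g)$, $i=1,2,3$, be a $7$-dimensional $3$-$(\alpha,\delta)$-Sasaki manifold. The $3$-form $$\omega:=\sum_{i=1}^3\eta_i\wedge\Phi_i^{\mathcal H}+\eta_{123}=-\eta_{145}-\eta_{167}-\eta_{246}+\eta_{257}-\eta_{347}-\eta_{356}+\eta_{123}$$ (the second expression in terms of an adapted frame) defines a cocalibrated $G_2$-structure, i.e. one of Fernández–Gray type $W_1\oplus W_3$. Its characteristic connection coincides with the canonical connection of the $3$-$(\alpha,\delta)$-Sasaki manifold.
   Context: An almost contact metric structure $(\varphi,\xi,\eta,g)$ consists of a $(1,1)$-tensor field $\varphi$, a vector field $\xi$, a $1$-form $\eta$ and a Riemannian metric $g$ with $\varphi^2=-I+\eta\otimes\xi$, $\eta(\xi)=1$, $g(\varphi X,\varphi Y)=g(X,Y)-\eta(X)\eta(Y)$. Its fundamental form is $\Phi(X,Y)=g(X,\varphi Y)$. An almost $3$-contact metric manifold $(M,\varphi_i,\xi_i,\eta_i,g)$, $i=1,2,3$, is a manifold of dimension $4n+3$ with three almost contact metric structures with the same $g$ such that, for every even permutation $(i,j,k)$ of $(1,2,3)$, $\varphi_k=\varphi_i\varphi_j-\eta_j\otimes\xi_i=-\varphi_j\varphi_i+\eta_i\otimes\xi_j$, $\xi_k=\varphi_i\xi_j=-\varphi_j\xi_i$, $\eta_k=\eta_i\circ\varphi_j=-\eta_j\circ\varphi_i$. It is $3$-$(\alpha,\delta)$-Sasaki if $d\eta_i=2\alpha\Phi_i+2(\alpha-\delta)\eta_j\wedge\eta_k$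 for every even permutation $(i,j,k)$ of $(1,2,3)$, with real constants $\alpha\neq0$, $\delta$. Notation: $\mathcal V=\langle\xi_1,\xi_2,\xi_3\rangle$; $\eta_{ab}=\eta_a\wedge\eta_b$, $\eta_{abc}=\eta_a\wedge\eta_b\wedge\eta_c$; $\Phi_i^{\mathcal H}=\Phi_i+\eta_{jk}$ for even permutations $(i,j,k)$ of $(1,2,3)$ (the horizontal part of $\Phi_i$). Adapted (local) orthonormal frame in dimension $7$: $e_i=\xi_i$ ($i=1,2,3$), $e_4$ any unit vector field orthogonal to $\mathcal V$, $e_5=\varphi_1e_4$, $e_6=\varphi_2e_4$, $e_7=\varphi_3e_4$, with dual $1$-forms $\eta_1,\dots,\eta_7$; in it $\Phi_1^{\mathcal H}=-\eta_{45}-\eta_{67}$, $\Phi_2^{\mathcal H}=-\eta_{46}+\eta_{57}$, $\Phi_3^{\mathcal H}=-\eta_{47}-\eta_{56}$. A $G_2$-structure (with underlying metric $g$) given by a $3$-form $\omega$ is cocalibrated (type $W_1\oplus W_3$) if $d{*}\omega=0$. Its characteristic connection is the metric connection with skew torsion (i.e. $g(T(X,Y),Z)$ is a $3$-form) satisfying $\nabla\omega=0$; for cocalibrated $G_2$-structures it is known to exist and to be unique. The canonical connection of a $3$-$(\alpha,\delta)$-Sasaki manifold is the unique metric connection $\nabla$ with skew torsion such that $\nabla_X\varphi_i=\beta(\eta_k(X)\varphi_j-\eta_j(X)\varphi_k)$ for all vector fields $X$ and every even permutation $(i,j,k)$ of $(1,2,3)$, where $\beta=2(\delta-2\alpha)$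 (it is known to exist). Conventions: $d\eta(X,Y)=X(\eta(Y))-Y(\eta(X))-\eta([X,Y])$, $(\eta\wedge\zeta)(X,Y)=\eta(X)\zeta(Y)-\eta(Y)\zeta(X)$, and analogously in higher degree. *)

(* Defs.v *)
From HB Require Import structures.
From mathcomp Require Import all_boot all_order all_algebra perm.
From mathcomp Require Import boolp classical_sets functions reals topology.
From mathcomp Require Import normedtype derive ring.

Set Implicit Arguments.
Unset Strict Implicit.
Unset Printing Implicit Defensive.

Import Order.TTheory GRing.Theory Num.Theory.
Import numFieldTopology.Exports numFieldNormedType.Exports.

Local Open Scope classical_set_scope.
Local Open Scope ring_scope.

Section EuclideanSmooth.
Context {R : realType} {n : nat}.
Implicit Types (U : set 'rV[R]_n) (f g : 'rV[R]_n -> R).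

(* f is of class C^k on the open set U: all iterated partial derivatives up to
   order k exist and are continuous at the points of U. *)
Fixpoint Ck (k : nat) U f : Prop :=
  (forall x, U x -> {for x, continuous f}) /\
  if k is k'.+1 then
    forall i : 'I_n, (forall x, U x -> derivable f x (delta_mx ord0 i)) /\
      Ck k' U (fun x => 'D_(delta_mx ord0 i) f x)
  else True.

Definition Cinf U f := forall k, Ck k U f.

Lemma Ck_ext k U f g : open U -> (forall x, U x -> f x = g x) ->
  Ck k U f -> Ck k U g.
Proof.
move=> oU; elim: k f g => [|k IH] f g fg.
all: have nfg x : U x -> \forall y \near x, f y = g y.
1,3: by move=> Ux; apply: filterS (open_nbhs_nbhs (conj oU Ux)) => y /fg.
all: have cg : (forall x, U x -> {for x, continuous f}) ->
  forall x, U x -> {for x, continuous g}.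
1,3: move=> cf x Ux; rewrite /prop_for /continuous_at -(fg x Ux).
1,2: exact: cvg_trans (near_eq_cvg (nfg x Ux)) (cf x Ux).
  by case=> cf _; split => //; exact: cg.
case=> cf df; split; first exact: cg.
move=> i; have [dfi Di] := df i; split.
  by move=> x Ux; exact: near_eq_derivable (nfg x Ux) (dfi x Ux).
apply: IH Di => x Ux; exact: near_eq_derive (nfg x Ux).
Qed.

Lemma Ck_cst k U (c : R) : Ck k U (fun=> c).
Proof.
elim: k c => [|k IH] c; split => //; try by move=> x _; exact: cst_continuous.
move=> i; split; first by move=> x _; exact: derivable_cst.
have -> : 'D_(delta_mx ord0 i) (fun=> c) = (fun=> 0) :> ('rV[R]_n -> R).
  by apply/funext => x; exact: derive_cst.
exact: IH.
Qed.

Lemma CkS k U f : Ck k.+1 U f -> Ck k U f.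
Proof.
elim: k f => [|k IH] f [cf df]; split => // i.
by have [dfi /IH] := df i.
Qed.

Lemma Ck_add k U f g : open U -> Ck k U f -> Ck k U g ->
  Ck k U (fun x => f x + g x).
Proof.
move=> oU; elim: k f g => [|k IH] f g [cf df] [cg dg]; split => //;
  try by move=> x Ux; exact: continuousD (cf x Ux) (cg x Ux).
move=> i; have [dfi Dfi] := df i; have [dgi Dgi] := dg i; split.
  by move=> x Ux; apply: derivableD; [exact: dfi|exact: dgi].
apply: Ck_ext (IH _ _ Dfi Dgi) => // x Ux.
by rewrite -deriveD; [|exact: dfi|exact: dgi].
Qed.

Lemma Ck_mul k U f g : open U -> Ck k U f -> Ck k U g ->
  Ck k U (fun x => f x * g x).
Proof.
move=> oU; elim: k f g => [|k IH] f g Hf Hg;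
  have [cf df] := Hf; have [cg dg] := Hg; split => //;
  try by move=> x Ux; exact: continuousM (cf x Ux) (cg x Ux).
move=> i; have [dfi Dfi] := df i; have [dgi Dgi] := dg i; split.
  by move=> x Ux; apply: derivableM; [exact: dfi|exact: dgi].
apply: Ck_ext (Ck_add oU (IH _ _ (CkS Hf) Dgi) (IH _ _ (CkS Hg) Dfi)) => // x Ux.
by rewrite -[_ + _]deriveM; [|exact: dfi|exact: dgi].
Qed.

End EuclideanSmooth.

(* chart_fun and chart_inv are total functions; only their restrictions to
   chart_dom and to its image are constrained. *)
Record chart (R : realType) (n : nat) (M : topologicalType) := Chart {
  chart_dom : set M;
  chart_fun : M -> 'rV[R]_n;
  chart_inv : 'rV[R]_n -> M;
  chart_dom_open : open chart_dom;
  chart_cod_open : open (chart_fun @` chart_dom);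
  chart_funK : forall p, chart_dom p -> chart_inv (chart_fun p) = p;
  chart_fun_continuous : forall p, chart_dom p -> {for p, continuous chart_fun};
  chart_inv_continuous :
    forall x, (chart_fun @` chart_dom) x -> {for x, continuous chart_inv} }.

Arguments chart_cod_open {R n M} c.

Definition chart_cod (R : realType) n M (c : chart R n M) : set 'rV[R]_n :=
  chart_fun c @` chart_dom c.

Record smooth_manifold (R : realType) (n : nat) := SmoothManifold {
  mcarrier :> topologicalType;
  atlas : set (chart R n mcarrier);
  manifold_hausdorff : hausdorff_space mcarrier;
  manifold_second_countable : @second_countable mcarrier;
  atlas_cover : forall p : mcarrier, exists2 c, atlas c & chart_dom c p;
  atlas_compat : forall c d, atlas c -> atlas d -> forall i : 'I_n,
    Cinf (chart_fun c @` (chart_dom c `&` chart_dom d))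
      (fun x => chart_fun d (chart_inv c x) ord0 i) }.

Section Manifold.
Context {R : realType} {n : nat} (M : smooth_manifold R n).

Definition smooth (f : M -> R) :=
  forall c, atlas c -> Cinf (chart_cod c) (f \o chart_inv c).

(* R^o is R seen as a module over itself, so that smooth functions inherit both
   a ring and an R-module structure. *)
Definition smoothb : {pred M -> R^o} := fun f => `[< smooth f >].

Lemma smooth_subring : subring_closed smoothb.
Proof.
split.
- by apply/asboolP => c _ k; exact: Ck_cst.
- move=> f g /asboolP sf /asboolP sg; apply/asboolP => c ac k.
  have oc := chart_cod_open c.
  have := Ck_add oc (sf c ac k) (Ck_mul oc (Ck_cst k _ (-1)) (sg c ac k)).
  by apply: Ck_ext => // x _ /=; rewrite mulN1r.
- move=> f g /asboolP sf /asboolP sg; apply/asboolP => c ac k.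
  exact: Ck_mul (chart_cod_open c) (sf c ac k) (sg c ac k).
Qed.

Lemma smooth_scale : GRing.scaler_closed smoothb.
Proof.
move=> a f /asboolP sf; apply/asboolP => c ac k.
exact: Ck_mul (chart_cod_open c) (Ck_cst k _ a) (sf c ac k).
Qed.

HB.instance Definition _ :=
  GRing.isSubringClosed.Build (M -> R^o) smoothb smooth_subring.
HB.instance Definition _ :=
  GRing.isScaleClosed.Build R (M -> R^o) smoothb smooth_scale.

Record smooth_fun := SmoothFun {
  smooth_val :> M -> R^o;
  smooth_valP : smooth_val \in smoothb }.

HB.instance Definition _ := [isSub for smooth_val].
HB.instance Definition _ := [Choice of smooth_fun by <:].
HB.instance Definition _ := GRing.SubChoice_isSubComPzRing.Build
  (M -> R^o) smoothb smooth_fun smooth_subring.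
HB.instance Definition _ := [SubZmodule_isSubLmodule of smooth_fun by <:].

(* Equal to f if f is smooth and to 0 otherwise; below it is only meaningful on
   functions which are smooth by hypothesis (values of smooth forms on smooth
   vector fields). *)
Definition to_smooth (f : M -> R) : smooth_fun := insubd (0 : smooth_fun) f.

Definition derivation_at (p : M) : {pred smooth_fun -> R^o} := fun D =>
  `[< (forall (a : R) (f g : smooth_fun), D (a *: f + g) = a * D f + D g) /\
      (forall f g : smooth_fun, D (f * g) = f p * D g + g p * D f) >].

Lemma derivation_at_submod p : submod_closed (derivation_at p).
Proof.
split; first by apply/asboolP; split=> *; rewrite /= !mulr0 addr0.
move=> a D E /asboolP[lD mD] /asboolP[lE mE]; apply/asboolP.
have aDE f : (a *: D + E) f = a * D f + E f by [].
split=> [b f g|f g]; rewrite !aDE.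
  rewrite lD lE !mulrDr !mulrA (mulrC a b) -!addrA.
  by congr (_ + _); rewrite addrCA.
rewrite mD mE !mulrDr !mulrA (mulrC a (f p)) (mulrC a (g p)) -!addrA.
by congr (_ + _); rewrite addrCA.
Qed.

HB.instance Definition _ p := GRing.isSubSemiModClosed.Build
  R (smooth_fun -> R^o) (derivation_at p) (derivation_at_submod p).

(* Tangent vectors at p are the R-linear derivations at p of the algebra of
   smooth functions on M. *)
Record tangent (p : M) := Tangent {
  tangent_val :> smooth_fun -> R^o;
  tangent_valP : tangent_val \in derivation_at p }.

HB.instance Definition _ p := [isSub for @tangent_val p].
HB.instance Definition _ p := [Choice of tangent p by <:].
HB.instance Definition _ p := [SubChoice_isSubLmodule of tangent p by <:].

Record vfield := VField {
  vfield_val :> forall p, tangent p;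
  vfield_smooth : forall f : smooth_fun, smooth (fun p => vfield_val p f) }.

Lemma vfieldP (X Y : vfield) : (forall p, X p = Y p) -> X = Y.
Proof.
case: X Y => [X sX] [Y sY] /= XY.
have {}XY : X = Y by apply: functional_extensionality_dep.
by rewrite {}XY in sX *; congr VField; exact: Prop_irrelevance.
Qed.

Definition vfield_app (X : vfield) (f : smooth_fun) : smooth_fun :=
  SmoothFun (introT (asboolP _) (vfield_smooth X f)).

Lemma smoothP (f : smooth_fun) : smooth f.
Proof. by apply/asboolP; exact: smooth_valP. Qed.

Fact vfield0_smooth (f : smooth_fun) : smooth (fun p => (0 : tangent p) f).
Proof. exact: (smoothP 0). Qed.

Fact vfieldN_smooth (X : vfield) (f : smooth_fun) :
  smooth (fun p => (- X p) f).
Proof. exact: (smoothP (- vfield_app X f)). Qed.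

Fact vfieldD_smooth (X Y : vfield) (f : smooth_fun) :
  smooth (fun p => (X p + Y p) f).
Proof. exact: (smoothP (vfield_app X f + vfield_app Y f)). Qed.

Fact vfieldZ_smooth (h : smooth_fun) (X : vfield) (f : smooth_fun) :
  smooth (fun p => (h p *: X p) f).
Proof. exact: (smoothP (h * vfield_app X f)). Qed.

Definition vfield0 := VField vfield0_smooth.
Definition vfieldN X := VField (vfieldN_smooth X).
Definition vfieldD X Y := VField (vfieldD_smooth X Y).
Definition vfieldZ h X := VField (vfieldZ_smooth h X).

HB.instance Definition _ := gen_eqMixin vfield.
HB.instance Definition _ := gen_choiceMixin vfield.

Fact vfieldDA : associative vfieldD.
Proof. by move=> X Y Z; apply: vfieldP => p; exact: addrA. Qed.
Fact vfieldDC : commutative vfieldD.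
Proof. by move=> X Y; apply: vfieldP => p; exact: addrC. Qed.
Fact vfieldD0 : left_id vfield0 vfieldD.
Proof. by move=> X; apply: vfieldP => p; exact: add0r. Qed.
Fact vfieldDN : left_inverse vfield0 vfieldN vfieldD.
Proof. by move=> X; apply: vfieldP => p; exact: addNr. Qed.

HB.instance Definition _ :=
  GRing.isZmodule.Build vfield vfieldDA vfieldDC vfieldD0 vfieldDN.

Fact vfieldZA h k X : vfieldZ h (vfieldZ k X) = vfieldZ (h * k) X.
Proof. by apply: vfieldP => p; exact: scalerA. Qed.
Fact vfieldZ1 : left_id 1 vfieldZ.
Proof. by move=> X; apply: vfieldP => p; exact: scale1r. Qed.
Fact vfieldZDr : right_distributive vfieldZ +%R.
Proof. by move=> h X Y; apply: vfieldP => p; exact: scalerDr. Qed.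
Fact vfieldZDl X : {morph vfieldZ^~ X : h k / h + k}.
Proof. by move=> h k; apply: vfieldP => p; exact: scalerDl. Qed.

HB.instance Definition _ := GRing.Zmodule_isLmodule.Build smooth_fun vfield
  vfieldZA vfieldZ1 vfieldZDr vfieldZDl.

Fact tangent_lin p (D : tangent p) (a : R) (f g : smooth_fun) :
  D (a *: f + g) = a * D f + D g.
Proof. by have /asboolP[lD _] := tangent_valP D; exact: lD. Qed.

Fact tangentM p (D : tangent p) (f g : smooth_fun) :
  D (f * g) = f p * D g + g p * D f.
Proof. by have /asboolP[_ mD] := tangent_valP D; exact: mD. Qed.

Fact tangentD p (D : tangent p) (f g : smooth_fun) : D (f + g) = D f + D g.
Proof. by have := tangent_lin D 1 f g; rewrite scale1r mul1r. Qed.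

Definition bracket_at (X Y : vfield) p : smooth_fun -> R^o := fun f =>
  X p (vfield_app Y f) - Y p (vfield_app X f).

Fact bracket_derivation X Y p : bracket_at X Y p \in derivation_at p.
Proof.
have appL (Z : vfield) (a : R) f g :
    vfield_app Z (a *: f + g) = a *: vfield_app Z f + vfield_app Z g.
  by apply: val_inj; apply/funext => q; exact: tangent_lin.
have appM (Z : vfield) f g :
    vfield_app Z (f * g) = f * vfield_app Z g + g * vfield_app Z f.
  by apply: val_inj; apply/funext => q; exact: tangentM.
apply/asboolP; split=> [a f g|f g]; rewrite /bracket_at !(appL, appM).
  by rewrite !tangent_lin mulrBr addrACA opprD.
rewrite !tangentD !tangentM /=.
ring.
Qed.

Fact bracket_smooth X Y (f : smooth_fun) :
  smooth (fun p => Tangent (bracket_derivation X Y p) f).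
Proof.
exact: (smoothP (vfield_app X (vfield_app Y f) - vfield_app Y (vfield_app X f))).
Qed.

Definition bracket X Y := VField (bracket_smooth X Y).

Record oneform := OneForm {
  oneform_val :> forall p, tangent p -> R;
  oneform_lin : forall p (a : R) (u v : tangent p),
    oneform_val (a *: u + v) = a * oneform_val u + oneform_val v;
  oneform_smooth : forall X : vfield, smooth (fun p => oneform_val (X p)) }.

Record endo := Endo {
  endo_val :> forall p, tangent p -> tangent p;
  endo_lin : forall p (a : R) (u v : tangent p),
    endo_val (a *: u + v) = a *: endo_val u + endo_val v;
  endo_smooth : forall (X : vfield) (f : smooth_fun),
    smooth (fun p => endo_val (X p) f) }.

Definition endo_app (phi : endo) (X : vfield) : vfield :=
  VField (endo_smooth phi X).

Record riemannian_metric := RiemannianMetric {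
  metric_val :> forall p, tangent p -> tangent p -> R;
  metric_lin : forall p (a : R) (u v w : tangent p),
    metric_val (a *: u + v) w = a * metric_val u w + metric_val v w;
  metric_sym : forall p (u v : tangent p), metric_val u v = metric_val v u;
  metric_pos : forall p (u : tangent p), u != 0 -> 0 < metric_val u u;
  metric_smooth : forall X Y : vfield,
    smooth (fun p => metric_val (X p) (Y p)) }.

Definition metric_app (g : riemannian_metric) (X Y : vfield) : smooth_fun :=
  SmoothFun (introT (asboolP _) (metric_smooth g X Y)).

(* Pointwise k-forms, without regularity; is_form singles out the differential
   k-forms. *)
Definition form_field (k : nat) := forall p, ('I_k -> tangent p) -> R.

Record is_form k (w : form_field k) : Prop := IsForm {
  form_multilinear : forall p (v : 'I_k -> tangent p) i (a : R) (x y : tangent p),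
    w p [eta v with i |-> a *: x + y] =
      a * w p [eta v with i |-> x] + w p [eta v with i |-> y];
  form_alternating : forall p (v : 'I_k -> tangent p) i j,
    i != j -> v i = v j -> w p v = 0;
  form_smooth : forall X : 'I_k -> vfield, smooth (fun p => w p (fun l => X l p)) }.

(* Invariant formula for the exterior derivative, normalised by
   (d eta)(X, Y) = X (eta Y) - Y (eta X) - eta [X, Y]. In the second sum the
   bracket [X_i, X_j], i < j, is left in position i instead of being moved to
   the front, which turns the usual sign (-1)^(i + j) into (-1)^j. *)
Definition ext_d k (w : form_field k) (X : 'I_k.+1 -> vfield) (p : M) : R :=
  \sum_(i < k.+1)
     (-1) ^+ i * X i p (to_smooth (fun q => w q (fun l => X (lift i l) q)))
  + \sum_(j < k.+1) \sum_(i < k.+1 | (i < j)%N)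
     (-1) ^+ j *
       w p (fun l => [eta X with i |-> bracket (X i) (X j)] (lift j l) p).

Record connection := Connection {
  conn_val :> vfield -> vfield -> vfield;
  conn_linl : forall (f : smooth_fun) (X Y Z : vfield),
    conn_val (f *: X + Y) Z = f *: conn_val X Z + conn_val Y Z;
  conn_addr : forall X Y Z : vfield,
    conn_val X (Y + Z) = conn_val X Y + conn_val X Z;
  conn_leibniz : forall (f : smooth_fun) (X Y : vfield),
    conn_val X (f *: Y) = vfield_app X f *: Y + f *: conn_val X Y }.

Definition torsion (D : connection) (X Y : vfield) : vfield :=
  D X Y - D Y X - bracket X Y.

Definition metric_connection (g : riemannian_metric) (D : connection) : Prop :=
  forall (X Y Z : vfield) p,
    X p (metric_app g Y Z) = g p (D X Y p) (Z p) + g p (Y p) (D X Z p).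

Definition skew_torsion (g : riemannian_metric) (D : connection) : Prop :=
  exists2 tau : form_field 3, is_form tau &
    forall (X : 'I_3 -> vfield) p,
      g p (torsion D (X 0) (X 1) p) (X 2%:R p) = tau p (fun l => X l p).

(* (nabla_X w)(Y_1, ..., Y_k) and, below, (nabla_X phi) Y. *)
Definition cov_form k (D : connection) (w : form_field k)
    (X : vfield) (Y : 'I_k -> vfield) (p : M) : R :=
  X p (to_smooth (fun q => w q (fun l => Y l q)))
  - \sum_(i < k) w p (fun l => [eta Y with i |-> D X (Y i)] l p).

Definition parallel_form k (D : connection) (w : form_field k) : Prop :=
  forall X Y p, cov_form D w X Y p = 0.

Definition cov_endo (D : connection) (phi : endo) (X Y : vfield) : vfield :=
  D X (endo_app phi Y) - endo_app phi (D X Y).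

End Manifold.

Section Exterior.
Context {R : realType} {V : lmodType R}.

Definition form1 (a : V -> R) : ('I_1 -> V) -> R := fun v => a (v ord0).

(* Wedge product of a covector with a k-covector, in the convention
   (a ^ b)(x, y) = a x * b y - a y * b x. *)
Definition wedge (a : V -> R) k (w : ('I_k -> V) -> R) : ('I_k.+1 -> V) -> R :=
  fun v => \sum_(i < k.+1) (-1) ^+ i * a (v i) * w (fun l => v (lift i l)).

Definition wedge2 (a b : V -> R) := wedge a (form1 b).
Definition wedge3 (a b c : V -> R) := wedge a (wedge2 b c).

End Exterior.

Record almost_contact_metric (R : realType) n (M : smooth_manifold R n)
    (phi : endo M) (xi : vfield M) (eta : oneform M) (g : riemannian_metric M)
    : Prop := AlmostContactMetric {
  acm_phi2 : forall p (v : tangent p),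
    phi p (phi p v) = - v + eta p v *: xi p;
  acm_eta_xi : forall p, eta p (xi p) = 1;
  acm_metric : forall p (u v : tangent p),
    g p (phi p u) (phi p v) = g p u v - eta p u * eta p v }.

(* The index set {1, 2, 3} is 'I_3 = {0, 1, 2}. The even permutations (i, j, k)
   are the cyclic ones, i.e. j and k are the cyclic successors of i and j. *)
Record almost_3_contact_metric (R : realType) n (M : smooth_manifold R n) :=
  Almost3ContactMetric {
  a3_phi : 'I_3 -> endo M;
  a3_xi : 'I_3 -> vfield M;
  a3_eta : 'I_3 -> oneform M;
  a3_g : riemannian_metric M;
  a3_acm : forall i,
    almost_contact_metric (a3_phi i) (a3_xi i) (a3_eta i) a3_g;
  a3_phi_l : forall i (j := ordS i) (k := ordS j) p (v : tangent p),
    a3_phi k p v = a3_phi i p (a3_phi j p v) - a3_eta j p v *: a3_xi i p;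
  a3_phi_r : forall i (j := ordS i) (k := ordS j) p (v : tangent p),
    a3_phi k p v = - a3_phi j p (a3_phi i p v) + a3_eta i p v *: a3_xi j p;
  a3_xi_l : forall i (j := ordS i) (k := ordS j) p,
    a3_xi k p = a3_phi i p (a3_xi j p);
  a3_xi_r : forall i (j := ordS i) (k := ordS j) p,
    a3_xi k p = - a3_phi j p (a3_xi i p);
  a3_eta_l : forall i (j := ordS i) (k := ordS j) p (v : tangent p),
    a3_eta k p v = a3_eta i p (a3_phi j p v);
  a3_eta_r : forall i (j := ordS i) (k := ordS j) p (v : tangent p),
    a3_eta k p v = - a3_eta j p (a3_phi i p v) }.

Section ThreeContact.
Context {R : realType} {n : nat} {M : smooth_manifold R n}.
Variable S : almost_3_contact_metric M.
Local Notation phi := (a3_phi S).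
Local Notation xi := (a3_xi S).
Local Notation eta := (a3_eta S).
Local Notation g := (a3_g S).

Definition fundamental_form (i : 'I_3) : form_field M 2 := fun p v =>
  g p (v 0) (phi i p (v 1)).
Arguments fundamental_form i p v : clear implicits.

Definition three_alpha_delta_sasaki (alpha delta : R) : Prop :=
  alpha != 0 /\
  forall i (j := ordS i) (k := ordS j) (X : 'I_2 -> vfield M) p,
    ext_d (fun q => form1 (eta i q)) X p =
      2 * alpha * fundamental_form i p (fun l => X l p)
      + 2 * (alpha - delta) * wedge2 (eta j p) (eta k p) (fun l => X l p).

Definition horizontal_form (i : 'I_3) : form_field M 2 :=
  let j := ordS i in let k := ordS j in
  fun p => fundamental_form i p + wedge2 (eta j p) (eta k p).
Arguments horizontal_form i p v : clear implicits.

Definition canonical_3form : form_field M 3 := fun p =>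
  \sum_(i < 3) wedge (eta i p) (horizontal_form i p)
  + wedge3 (eta 0 p) (eta 1 p) (eta 2%:R p).
Arguments canonical_3form p v : clear implicits.

Definition canonical_connection (alpha delta : R) (D : connection M) : Prop :=
  [/\ metric_connection g D, skew_torsion g D &
    forall i (j := ordS i) (k := ordS j) (X Y : vfield M) p,
      cov_endo D (phi i) X Y p =
        (2 * (delta - 2 * alpha)) *:
          (eta k p (X p) *: phi j p (Y p) - eta j p (X p) *: phi k p (Y p))].

Definition adapted_frame p (e4 : tangent p) : 'I_7 -> tangent p :=
  tnth [tuple xi 0 p; xi 1 p; xi 2%:R p;
              e4; phi 0 p e4; phi 1 p e4; phi 2%:R p e4].

End ThreeContact.

Arguments fundamental_form {R n M} S i p _.
Arguments horizontal_form {R n M} S i p _.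
Arguments canonical_3form {R n M} S p _.

Section Frames.
Context {R : realType} {n : nat} {M : smooth_manifold R n}.
Variable g : riemannian_metric M.

Definition orthonormal_basis m p (e : 'I_m -> tangent p) : Prop :=
  (forall i j, g p (e i) (e j) = (i == j)%:R) /\
  (forall v : tangent p, exists c : 'I_m -> R, v = \sum_i c i *: e i).

(* e^a /\ e^b /\ e^c for the coframe e^a = g(e_a, -) dual to an orthonormal
   frame e_1, ..., e_7; the indices a, b, c range over 1, ..., 7. *)
Definition coframe3 p (e : 'I_7 -> tangent p) (a b c : nat) :
    ('I_3 -> tangent p) -> R :=
  let eta a := g p (e (inord a.-1)) in wedge3 (eta a) (eta b) (eta c).

(* The normal form of G2-forms used by Bryant and Joyce. *)
Definition g2_model p (e : 'I_7 -> tangent p) : ('I_3 -> tangent p) -> R :=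
  let eta := coframe3 e in
  eta 1%N 2%N 3%N + eta 1%N 4%N 5%N + eta 1%N 6%N 7%N + eta 2%N 4%N 6%N
  - eta 2%N 5%N 7%N - eta 3%N 4%N 7%N - eta 3%N 5%N 6%N.

Definition g2_frame (w : form_field M 3) p (e : 'I_7 -> tangent p) : Prop :=
  orthonormal_basis e /\ w p = g2_model e.

Definition g2_structure (w : form_field M 3) : Prop :=
  is_form w /\ forall p, exists e : 'I_7 -> tangent p, g2_frame w e.

(* Positive frames for the orientation induced by w, in which the frames where w
   takes the standard form are positive. *)
Definition g2_oriented (w : form_field M 3) p (f : 'I_7 -> tangent p) : Prop :=
  exists2 e : 'I_7 -> tangent p, g2_frame w e &
    0 < \det (\matrix_(i, j) g p (e i) (f j)).

(* psi = *w: for positive orthonormal bases f and permutations s,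
   ( *w)(f_s(k+1), ..., f_s(k+l)) = sgn(s) w(f_s(1), ..., f_s(k)). *)
Definition hodge_dual k l
    (oriented : forall p, ('I_(k + l) -> tangent p) -> Prop)
    (w : form_field M k) (psi : form_field M l) : Prop :=
  forall p (f : 'I_(k + l) -> tangent p),
    orthonormal_basis f -> oriented p f ->
  forall s : 'S_(k + l),
    psi p (fun i => f (s (rshift k i))) =
      (-1) ^+ s * w p (fun i => f (s (lshift l i))).

Definition cocalibrated_g2 (w : form_field M 3) : Prop :=
  g2_structure w /\
  exists psi : form_field M 4,
    [/\ is_form psi, @hodge_dual 3 4 (g2_oriented w) w psi &
        forall (X : 'I_5 -> vfield M) p, ext_d psi X p = 0].

Definition characteristic_connection (w : form_field M 3) (D : connection M)
    : Prop :=
  [/\ metric_connection g D, skew_torsion g D & parallel_form D w].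

End Frames.

(* Main.v *)
(* Write F_i for the horizontal part of Phi_i. The structure equations and
   d(d eta_i) = 0 give d F_i = 2 delta (F_j ^ eta_k - eta_j ^ F_k), so that the
   4-form 1/6 sum F_i ^ F_i + sum eta_jk ^ F_i, which is the Hodge dual of omega,
   is closed.
   The canonical connection is the metric connection with torsion
   2 alpha sum eta_i ^ Phi_i + 2 (delta - alpha) eta_123, given by the Koszul
   formula. The covariant derivatives of the phi_i are found with Hitchin's
   argument on the metric cone: an almost quaternionic structure whose three
   fundamental forms have the right exterior derivatives is parallel. The
   derivatives of the phi_i determine those of xi_i, eta_i and Phi_i, and omega
   is parallel.
   Two connections with skew torsion making omega parallel differ by a 3-form t
   such that every contraction of t with a vector lies in the Lie algebra g2,
   which forces t = 0. Hence the characteristic connection is unique, and so is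
   the canonical one, being characteristic. *)
Require Import Defs.
From HB Require Import structures.
From mathcomp Require Import all_boot all_order all_algebra perm.
From mathcomp Require Import boolp classical_sets functions reals topology.
From mathcomp Require Import normedtype ereal sequences derive realfun exp measure.
From mathcomp Require Import landau interval_inference lebesgue_measure lebesgue_integral.
From mathcomp Require Import ftc ring lra.
Set Implicit Arguments.
Unset Strict Implicit.
Unset Printing Implicit Defensive.
Import Order.TTheory GRing.Theory Num.Theory.
Import numFieldTopology.Exports numFieldNormedType.Exports.
Local Open Scope classical_set_scope.
Local Open Scope ring_scope.
(* The analysis library shadows names of [Defs] such as [metric_sym]. *)
Import Defs.

(** * Calculus in coordinates *)

(** Tangent vectors are derivations of the algebra of global smooth functions, so even their
    dimension has to be proved: Hadamard's lemma, a cutoff and the Hausdorff property turn chart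
    coordinates into global fields, which form a basis at one given point. Where a smooth frame
    would be convenient, identities are instead multiplied by a Gram determinant that is nonzero at
    the point in question. The constant beta = 2 (delta - 2 alpha) is what the structure equations
    leave over: d Phi_i carries 2 (delta - alpha), the torsion carries 2 alpha, and their difference
    is beta. The phi_i therefore rotate among themselves instead of being parallel, and Hitchin's
    argument applies to derivatives from which this rotation has been subtracted; omega is invariant
    under such rotations. The factor 1/6 arises because each F_i ^ F_i is twice the horizontal
    volume form. Hodge duality is required for every positive basis, with the orientation read off
    from an arbitrary frame in which omega is standard. Such frames are compared through the
    contraction of omega with itself, which expresses the 4-form by omega and g. *)

Section LineDerivative.
Context {R : realType} {V : normedModType R}.
Implicit Types (f : V -> R) (v y : V).

Lemma is_derive_line f v y (t l : R) :
  is_derive (t *: v + y) v f l -> is_derive t 1 (fun s => f (s *: v + y)) l.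
Proof.
move=> [df <-].
have E : (fun h : R => h^-1 *: (((fun s => f (s *: v + y)) \o shift t) (h *: 1)
    - f (t *: v + y))) =
  (fun h => h^-1 *: ((f \o shift (t *: v + y)) (h *: v) - f (t *: v + y))).
  by apply/funext => h /=; rewrite /shift /= [h%:A]mulr1 scalerDl addrA.
by apply: DeriveDef; rewrite /derivable /derive E.
Qed.

(** Only the derivative along [v] is assumed to exist, so the factor comes from the chain rule for s
    -> c s on the line through [y]; this treats c = 0 together with the other values. *)
Lemma is_deriveZv f v y (c l : R) :
  is_derive y v f l -> is_derive y (c *: v) f (c * l).
Proof.
move=> H; have := @is_derive_line f v y 0 l.
rewrite scale0r add0r => /(_ H) [Hd Hl].
pose m (s : R) : R := c * s.
have [dm mE] : is_derive (0 : R) (1 : R) m c.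
  by apply: is_derive_eq; rewrite ?mulr1 //= [_%:A]mulr1.
have [dd dl] : is_derive (0 : R) (1 : R) (fun s : R => f ((c * s) *: v + y)) (c * l).
  have m0 : m 0 = 0 by rewrite /m mulr0.
  have d2 : derivable (fun s : R => f (s *: v + y)) (m 0) (1 : R) by rewrite m0.
  apply: DeriveDef.
    apply/derivable1_diffP/(@differentiable_comp _ _ _ _ m
      (fun s => f (s *: v + y))); first exact/derivable1_diffP.
    exact/derivable1_diffP.
  have := @derive1_comp _ m (fun s => f (s *: v + y)) _ dm d2.
  by rewrite !derive1E mE m0 Hl mulrC.
have E : (fun h : R => h^-1 *: ((f \o shift y) (h *: (c *: v)) - f y)) =
   (fun h : R => h^-1 *: (((fun s : R => f ((c * s) *: v + y)) \o shift 0) (h *: 1)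
     - f ((c * 0) *: v + y))).
  apply/funext => h /=; rewrite /shift /= [h%:A]mulr1 addr0 scalerA mulr0.
  by rewrite scale0r add0r mulrC.
by apply: DeriveDef; rewrite /derivable /derive E.
Qed.

Lemma mean_value_line f v y (c e : R) :
  (forall t : R, 0 <= t <= 1 -> derivable f (t *: v + y) v /\
     `|'D_v f (t *: v + y) - c| <= e) ->
  `|f (v + y) - f y - c| <= e.
Proof.
move=> H.
have dF (t : R) : 0 <= t <= 1 ->
    is_derive t 1 (fun s : R => f (s *: v + y)) ('D_v f (t *: v + y)).
  by move=> /H [dt _]; apply: is_derive_line; exact: derivableP.
have [|||t] := @MVT_segment R (fun s : R => f (s *: v + y))
  (fun t => 'D_v f (t *: v + y)) 0 1.
- exact: ler01.
- by move=> t; rewrite in_itv /= => /andP[t0 t1]; apply: dF; rewrite !ltW.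
- apply: derivable_within_continuous => t; rewrite in_itv /= => t01.
  by case: (dF t t01).
rewrite in_itv /= subr0 mulr1 scale1r scale0r add0r => t01 ->.
exact: (H t t01).2.
Qed.

End LineDerivative.

Section Increment.
Context {R : realType} {n : nat}.
Implicit Types (f : 'rV[R]_n -> R) (x y h : 'rV[R]_n) (U : set 'rV[R]_n).
Local Notation basis i := (delta_mx ord0 i : 'rV[R]_n).

(* Change one coordinate at a time and use the mean value theorem on each
   segment. *)
Lemma increment_bound f x h (c : 'I_n -> R) (e : R) :
  (forall z : 'rV[R]_n, (forall i, `|z ord0 i - x ord0 i| <= `|h ord0 i|) ->
     forall i, derivable f z (basis i) /\ `|'D_(basis i) f z - c i| <= e) ->
  `|f (x + h) - f x - \sum_i h ord0 i * c i| <= e * \sum_i `|h ord0 i|.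
Proof.
move=> H.
pose tr m : 'rV[R]_n := \row_i (if (i < m)%N then h ord0 i else 0).
suff K m : (m <= n)%N -> `|f (x + tr m) - f x - \sum_(i < n | (i < m)%N) h ord0 i * c i|
    <= e * \sum_(i < n | (i < m)%N) `|h ord0 i|.
  have := K n (leqnn n).
  have -> : tr n = h by apply/rowP => i; rewrite mxE ltn_ord.
  rewrite [X in _ - X](eq_bigl xpredT); last by move=> i; rewrite ltn_ord.
  by rewrite [X in _ * X](eq_bigl xpredT) // => i; rewrite ltn_ord.
elim: m => [_|m IH mn].
  have -> : tr 0%N = 0 by apply/rowP => i; rewrite !mxE.
  by rewrite addr0 !big_pred0 // subrr subr0 normr0 mulr0.
pose i0 := Ordinal mn.
have trS : x + tr m.+1 = h ord0 i0 *: basis i0 + (x + tr m).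
  rewrite addrCA; congr (_ + _); apply/rowP => i; rewrite !mxE eqxx /= ltnS leq_eqVlt.
  rewrite -(inj_eq val_inj) /=; have [im|_] := eqVneq (i : nat) m.
    have -> : i = i0 by apply: val_inj.
    by rewrite ltnn mulr1 addr0.
  by rewrite mulr0 add0r.
have big1 (F : 'I_n -> R) : \sum_(i < n | (i < m.+1)%N) F i =
    F i0 + \sum_(i < n | (i < m)%N) F i.
  rewrite (bigD1 i0) //=; congr (_ + _); apply: eq_bigl => i.
  by rewrite ltnS -(inj_eq val_inj) /= andbC -ltn_neqAle.
rewrite !big1 mulrDr trS.
set a := f (_ *: _ + _); set b := f (x + tr m) in IH *.
have step : `|a - b - h ord0 i0 * c i0| <= e * `|h ord0 i0|.
  apply: mean_value_line => t /andP[t0 t1].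
  have zP i : `|(t *: (h ord0 i0 *: basis i0) + (x + tr m)) ord0 i - x ord0 i|
      <= `|h ord0 i|.
    rewrite !mxE eqxx /= addrCA addrAC subrr add0r.
    rewrite -(inj_eq val_inj) /=; have [im|_] := eqVneq (i : nat) m.
      have -> : i = i0 by apply: val_inj.
      by rewrite ltnn mulr1 addr0 normrM ger0_norm // ler_piMl.
    by rewrite !mulr0 add0r; case: ifP => // _; rewrite normr0.
  have [dz Dz] := H _ zP i0.
  have [d D] := is_deriveZv (h ord0 i0) (derivableP dz).
  split=> //; rewrite D -mulrBr normrM mulrC.
  by apply: ler_wpM2r.
have -> : a - f x - (h ord0 i0 * c i0 + \sum_(i < n | (i < m)%N) h ord0 i * c i) =
  (a - b - h ord0 i0 * c i0) + (b - f x - \sum_(i < n | (i < m)%N) h ord0 i * c i).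
  by ring.
by apply: le_trans (ler_normD _ _) _; apply: lerD step (IH (ltnW mn)).
Qed.

Lemma normr_coord_le x i : `|x ord0 i| <= `|x|.
Proof.
rewrite [leRHS]/Num.Def.normr /= mx_normrE.
exact: (le_bigmax _ (fun ij : 'I_1 * 'I_n => `|x ij.1 ij.2|) (ord0, i)).
Qed.

Lemma normr_le_coord x (r : R) : 0 <= r ->
  (forall i, `|x ord0 i| <= r) -> `|x| <= r.
Proof.
move=> r0 xr; rewrite [leLHS]/Num.Def.normr /= mx_normrE.
by apply: bigmax_le => // -[i j] _ /=; rewrite (ord1 i).
Qed.

Lemma normr_lt_coord x (r : R) : 0 < r ->
  (forall i, `|x ord0 i| < r) -> `|x| < r.
Proof.
move=> r0 xr; rewrite [ltLHS]/Num.Def.normr /= mx_normrE.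
by apply: bigmax_lt => // -[i j] _ /=; rewrite (ord1 i).
Qed.

Lemma sum_coord_le x : \sum_i `|x ord0 i| <= n%:R * `|x|.
Proof.
apply: (@le_trans _ _ (\sum_(i < n) `|x|)).
  by apply: ler_sum => i _; exact: normr_coord_le.
by rewrite sumr_const card_ord mulr_natl.
Qed.

Lemma Ck_continuous k U f x : Ck k U f -> U x -> {for x, continuous f}.
Proof. by case: k => [|k] [cf _]; exact: cf. Qed.

(** Near [x] all partial derivatives are close to their values at [x], so [increment_bound] applies
    with these values as constants and bounds the non-linear part of the increment by o(h). *)
Lemma Ck1_differentiable k U f x : open U -> Ck k.+1 U f -> U x ->
  differentiable f x /\ forall v, 'D_v f x = \sum_i v ord0 i * 'D_(basis i) f x.
Proof.
move=> oU [cf df] Ux.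
pose L (v : 'rV[R]_n) : R := \sum_i v ord0 i * 'D_(basis i) f x.
have Llin : linear L.
  move=> a u v; rewrite /L scaler_sumr -big_split; apply: eq_bigr => i _.
  by rewrite !mxE mulrDl -mulrA.
pose LL := GRing.isLinear.Build R 'rV[R]_n R^o *:%R L Llin.
pose Lf : {linear 'rV[R]_n -> R^o} := HB.pack L LL.
have cL : continuous Lf.
  have dL i : differentiable (fun v : 'rV[R]_n => v ord0 i * 'D_(basis i) f x) (0:'rV[R]_n).
    by apply: differentiableM => //; exact: differentiable_coord.
  move=> y; have : {for y, continuous L}.
    have -> : L = \sum_i (fun v : 'rV[R]_n => v ord0 i * 'D_(basis i) f x).
      by apply/funext => v; rewrite fct_sumE.
    apply: differentiable_continuous; apply: differentiable_sum => i.
    by apply: differentiableM => //; exact: differentiable_coord.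
  exact.
have exp : f \o shift x = cst (f x) + Lf +o_ (0 : 'rV[R]_n) id.
  apply/eqaddoP => _/posnumP[e].
  (* Summing the coordinate errors costs a factor n; dividing by n + 1 absorbs it and also covers n
     = 0. *)
  have e'0 : 0 < e%:num / n.+1%:R by rewrite divr_gt0.
  have nd : \forall z \near x, U z /\ forall i,
      `|'D_(basis i) f z - 'D_(basis i) f x| <= e%:num / n.+1%:R.
    have nD : \forall z \near x, forall i : 'I_n,
        `|'D_(basis i) f z - 'D_(basis i) f x| <= e%:num / n.+1%:R.
      apply: (@filter_forall 'rV[R]_n 'I_n (fun i z =>
        `|'D_(basis i) f z - 'D_(basis i) f x| <= e%:num / n.+1%:R) (nbhs x)) => i.
      have [_ Di] := df i; have := Ck_continuous Di Ux.
      move/cvgrPdist_le => /(_ _ e'0); apply: filterS => z.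
      by rewrite distrC.
    by apply: filterS2 nD (open_nbhs_nbhs (conj oU Ux)) => z.
  move/nbhs_ballP : nd => [d /= d0 Hd].
  apply/nbhs_ballP; exists d => //= h.
  rewrite -ball_normE /= sub0r normrN => hd.
  have := @increment_bound f x h (fun i => 'D_(basis i) f x) (e%:num / n.+1%:R).
  have -> : (f \o shift x - (cst (f x) + Lf)) h = f (x + h) - f x - L h.
    by rewrite [x + h]addrC -addrA -opprD.
  move=> IB.
  apply: le_trans (IB _) _.
    move=> z Hz i.
    have /Hd [Uz Dz] : ball x d z.
      rewrite -ball_normE /=; apply: le_lt_trans hd.
      apply: normr_le_coord => // j; rewrite !mxE distrC.
      by apply: le_trans (Hz j) _; exact: normr_coord_le.
    by split; [exact: (df i).1|exact: Dz].
  rewrite mulrAC ler_pdivrMr // -mulrA ler_wpM2l //.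
  apply: le_trans (sum_coord_le h) _; rewrite mulrC ler_wpM2l //.
  by rewrite ler_nat.
have E := diff_unique cL exp.
have dfx : differentiable f x.
  by apply/diff_locallyP; rewrite E.
by split=> // v; rewrite deriveE // E.
Qed.

End Increment.

Lemma derive_line0 {R : realType} (V W : normedModType R) (g : V -> W) x v :
  'D_v g x = 'D_(1 : R) (fun h : R => g (h *: v + x)) 0.
Proof.
rewrite /derive; set g1 := fun h => h^-1 *: _; set g2 := fun h => h^-1 *: _.
suff -> : g1 = g2 by [].
by rewrite funeqE /g1 /g2 => h /=; rewrite addr0 scale0r add0r [_%:A]mulr1.
Qed.

(** * Functions of class C^k under restriction, composition and inversion *)

Section CkCalculus.
Context {R : realType}.

Lemma Ck_subset n k (U V : set 'rV[R]_n) f : V `<=` U -> Ck k U f -> Ck k V f.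
Proof.
move=> VU; elim: k f => [|k IH] f [cf df]; split=> //;
  try by move=> x /VU; exact: cf.
by move=> i; have [dfi Di] := df i; split; [move=> x /VU; exact: dfi|exact: IH].
Qed.

Lemma Ck_local n k (U : set 'rV[R]_n) f :
  (forall x, U x -> exists2 V, V x & Ck k V f) -> Ck k U f.
Proof.
elim: k f => [|k IH] f H; split=> //;
  try by move=> x /H [V Vx fV]; exact: Ck_continuous fV Vx.
move=> i; split; first by move=> x /H [V Vx [_ /(_ i)[dV _]]]; exact: dV.
by apply: IH => x /H [V Vx [_ /(_ i)[_ dV]]]; exists V.
Qed.

Lemma Ck_sum n k (U : set 'rV[R]_n) (I : Type) (r : seq I) (F : I -> 'rV[R]_n -> R) :
  open U -> (forall i, Ck k U (F i)) -> Ck k U (fun x => \sum_(i <- r) F i x).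
Proof.
move=> oU H; elim: r => [|i r IH].
  by apply: Ck_ext (Ck_cst k U 0) => // x _; rewrite big_nil.
by apply: Ck_ext (Ck_add oU (H i) IH) => // x _; rewrite big_cons.
Qed.

Lemma is_derive_coord n (i : 'I_n) (x v : 'rV[R]_n) :
  is_derive x v (fun x : 'rV[R]_n => x ord0 i) (v ord0 i).
Proof.
have -> : v ord0 i = 'D_v (fun x : 'rV[R]_n => x ord0 i) x.
  by rewrite -[v in LHS](@derive_id _ _ x v) derive_mx ?mxE //; exact: derivable_id.
by apply: derivableP; apply: (derivable_mxP id x v).1; exact: derivable_id.
Qed.

Lemma Ck_coord n k (U : set 'rV[R]_n) (i : 'I_n) :
  Ck k U (fun x => x ord0 i).
Proof.
case: k => [|k]; split=> //; try by move=> x _; exact: coord_continuous.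
move=> j; split; first by move=> x _; case: (is_derive_coord i x (delta_mx ord0 j)).
have -> : (fun x : 'rV[R]_n => 'D_(delta_mx ord0 j) (fun x : 'rV[R]_n => x ord0 i) x) =
    (fun=> (delta_mx ord0 j : 'rV[R]_n) ord0 i).
  by apply/funext => x; case: (is_derive_coord i x (delta_mx ord0 j)).
exact: Ck_cst.
Qed.

Lemma continuous_row n m (T : 'rV[R]_n -> 'rV[R]_m) (x : 'rV[R]_n) :
  (forall j, {for x, continuous (fun y => T y ord0 j)}) -> {for x, continuous T}.
Proof.
move=> H; rewrite /prop_for /continuous_at; apply/(@cvgrPdist_le _ _ _ (nbhs x) _ T) => /= e e0.
suff : \forall y \near x, forall j : 'I_m, `|T x ord0 j - T y ord0 j| <= e.
  apply: filterS => y Hy; apply: normr_le_coord (ltW e0) _ => j.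
  by rewrite !mxE.
apply: (@filter_forall 'rV[R]_n 'I_m (fun j y =>
        `|T x ord0 j - T y ord0 j| <= e) (nbhs x)) => j.
by have := H j; rewrite /prop_for /continuous_at => /cvgrPdist_le; apply.
Qed.

Lemma is_derive_chain n m (T : 'rV[R]_n -> 'rV[R]_m) (f : 'rV[R]_m -> R) (x v : 'rV[R]_n) :
  differentiable f (T x) -> (forall j, derivable (fun y => T y ord0 j) x v) ->
  is_derive x v (f \o T) ('D_(\row_j 'D_v (fun y => T y ord0 j) x) f (T x)).
Proof.
move=> df dT.
have dTx : derivable T x v by apply/derivable_mxP => i j; rewrite (ord1 i).
have DT : \row_j 'D_v (fun y => T y ord0 j) x = 'D_v T x.
  by rewrite derive_mx //; apply/rowP => j; rewrite !mxE.
have dl := (derivable1P _ _ _).1 dTx.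
have dfl : differentiable f (T (0 *: v + x)) by rewrite scale0r add0r.
have dl' := (derivable1_diffP _ _).1 dl.
have dc : differentiable (f \o (fun h : R => T (h *: v + x))) 0.
  exact: differentiable_comp.
apply: DeriveDef.
  by apply/derivable1P; exact/derivable1_diffP.
rewrite DT (deriveE _ df) (derive_line0 T) (deriveE _ dl') (derive_line0 (f \o T)).
have -> : (fun h : R => (f \o T) (h *: v + x)) = f \o (fun h : R => T (h *: v + x)) by [].
rewrite (deriveE _ dc) (diff_comp dl' dfl).
have -> : T (0 *: v + x) = T x by rewrite scale0r add0r.
exact: erefl.
Qed.

(** By the chain rule the partial derivatives of the composite are sums of products of derivatives
    of [T] with derivatives of [f] taken along [T]. The latter are again composites, of order one
    less, with the same inner map. *)
Lemma Ck_comp n m k (U : set 'rV[R]_n) (V : set 'rV[R]_m) (T : 'rV[R]_n -> 'rV[R]_m) f :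
  open U -> open V -> (forall x, U x -> V (T x)) ->
  (forall j, Ck k U (fun x => T x ord0 j)) -> Ck k V f -> Ck k U (f \o T).
Proof.
move=> oU oV TUV; elim: k f => [|k IH] f HT Hf.
  split=> // x Ux; apply: continuous_comp; last exact: Ck_continuous Hf (TUV _ Ux).
  by apply: continuous_row => j; exact: Ck_continuous (HT j) Ux.
have ch i x : U x -> is_derive x (delta_mx ord0 i) (f \o T)
    (\sum_j 'D_(delta_mx ord0 i) (fun y => T y ord0 j) x * 'D_(delta_mx ord0 j) f (T x)).
  move=> Ux; have [dfT DfT] := Ck1_differentiable oV Hf (TUV _ Ux).
  have := @is_derive_chain _ _ T f x (delta_mx ord0 i) dfT.
  rewrite DfT => /(_ (fun j => ((HT j).2 i).1 x Ux)) H.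
  by apply: is_derive_eq; apply: eq_bigr => j _; rewrite mxE.
split.
  move=> x Ux; apply: continuous_comp; last exact: Ck_continuous Hf (TUV _ Ux).
  by apply: continuous_row => j; exact: Ck_continuous (HT j) Ux.
move=> i; split; first by move=> x Ux; case: (ch i x Ux).
apply: (@Ck_ext _ _ _ _ (fun x => \sum_j
    'D_(delta_mx ord0 i) (fun y => T y ord0 j) x * 'D_(delta_mx ord0 j) f (T x))) => //.
  by move=> x Ux; case: (ch i x Ux).
apply: Ck_sum => // j; apply: Ck_mul => //; first exact: ((HT j).2 i).2.
by apply: (IH _ _ (Hf.2 j).2) => l; exact: CkS.
Qed.

Lemma is_derive_comp1 n (g : 'rV[R]_n -> R) (u : R -> R) (x v : 'rV[R]_n) (l d : R) :
  is_derive x v g d -> is_derive (g x) 1 u l -> is_derive x v (u \o g) (l * d).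
Proof.
move=> [dg Dg] [du Du].
pose l0 (h : R) : R := g (h *: v + x).
have dl : derivable l0 0 (1 : R) := (derivable1P _ _ _).1 dg.
have l0E : l0 0 = g x by rewrite /l0 scale0r add0r.
have du' : derivable u (l0 0) (1 : R) by rewrite l0E; exact: du.
apply: DeriveDef.
  apply/derivable1P/derivable1_diffP.
  apply: (@differentiable_comp _ _ _ _ l0 u); first apply: (derivable1_diffP _ _).1 dl.
  exact: (derivable1_diffP _ _).1 du'.
rewrite derive_line0 -derive1E.
have := @derive1_comp _ l0 u _ dl du'; rewrite !derive1E -derive_line0 Dg l0E Du.
exact.
Qed.

Lemma Ck_inv n k (U : set 'rV[R]_n) g : open U -> (forall x, U x -> g x != 0) ->
  Ck k U g -> Ck k U (fun x => (g x)^-1).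
Proof.
move=> oU g0; elim: k => [|k IH] Hg.
  by split=> // x Ux; apply: continuousV (g0 _ Ux) (Ck_continuous Hg Ux).
split.
  by move=> x Ux; apply: continuousV (g0 _ Ux) (Ck_continuous Hg Ux).
move=> i; have [dgi Dgi] := Hg.2 i.
have dV x : U x -> derivable (fun x => (g x)^-1) x (delta_mx ord0 i).
  by move=> Ux; apply: derivableV; [exact: g0|exact: dgi].
split=> //.
have gV := IH (CkS Hg).
apply: (@Ck_ext _ _ _ _ (fun x => -1 * ((g x)^-1 * (g x)^-1 * 'D_(delta_mx ord0 i) g x))) => //.
  move=> x Ux; rewrite [RHS]deriveV; [|exact: g0|exact: dgi].
  by rewrite mulN1r -[RHS]/(- (g x ^- 2) * _) mulNr expr2 invfM.
apply: Ck_mul oU (Ck_cst _ _ _) (Ck_mul oU (Ck_mul oU gV gV) Dgi).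
Qed.

End CkCalculus.

(** * Bump functions and Hadamard's lemma *)

Section Bump.
Context {R : realType}.

(** The classical flat function exp(-1/x). The factor x^-m makes the family closed under
    differentiation up to linear combinations, so smoothness follows by induction for all m at
    once. *)
Definition flat (m : nat) (x : R) : R :=
  if 0 < x then x^-1 ^+ m * expR (- x^-1) else 0.

(** From exp y >= 1 + y^(m+1) / (m+1)! at y = 1/x. A bound linear in x is what forces the difference
    quotients at 0 to tend to 0. *)
Lemma flat_le m x : `|flat m x| <= m.+1`!%:R * `|x|.
Proof.
rewrite /flat; case: ifPn => [x0|_]; last by rewrite normr0 mulr_ge0.
have y0 : 0 < x^-1 by rewrite invr_gt0.
rewrite !gtr0_norm // ?mulr_gt0 ?exprn_gt0 ?expR_gt0 //.
rewrite expRN ler_pdivrMr ?expR_gt0 //.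
apply: (@le_trans _ _ (m.+1`!%:R * x * (x^-1 ^+ m.+1 / m.+1`!%:R))).
  have f0 : m.+1`!%:R != 0 :> R by rewrite pnatr_eq0 -lt0n fact_gt0.
  have -> // : m.+1`!%:R * x * (x^-1 ^+ m.+1 / m.+1`!%:R) = x^-1 ^+ m.
  by rewrite exprS; field; rewrite f0 gt_eqF.
apply: ler_wpM2l; first by rewrite mulr_ge0 // ltW.
by apply: le_trans (expR_ge1Dxn m (ltW y0)); rewrite lerDr.
Qed.

Lemma is_derive_flat m (x : R) :
  is_derive x (1 : R) (flat m) (flat m.+2 x - m%:R * flat m.+1 x).
Proof.
have [x0|x0|->] := ltgtP x 0.
- apply: (@near_eq_is_derive _ _ _ (cst 0)).
    near=> y; rewrite /flat ifN // -leNgt ltW //; near: y; exact: lt_nbhsl.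
  by apply: is_derive_eq; rewrite /flat !ltNge (ltW x0) /= mulr0 subrr.
- apply: (@near_eq_is_derive _ _ _ (fun y : R => y^-1 ^+ m * expR (- y^-1))).
    near=> y; rewrite /flat ifT //; near: y; exact: (open_nbhs_nbhs (conj (@open_gt R 0) x0)).
  have dV : is_derive x (1 : R) (fun y : R => y^-1) (- x^-2).
    apply: DeriveDef; first by apply: derivableV; rewrite ?gt_eqF //; exact: derivable_id.
    by rewrite deriveV ?gt_eqF // derive_id [_ *: _]mulr1.
  have dX : is_derive x (1 : R) (fun y : R => y^-1 ^+ m) (m%:R * x^-1 ^+ m.-1 * - x^-2).
    have -> : (fun y : R => y^-1 ^+ m) = (fun y : R => y^-1) ^+ m.
      by apply/funext => y; elim: m => // m IH; rewrite !exprS IH.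
    exact: is_deriveX.
  have dE : is_derive x (1 : R) (fun y : R => expR (- y^-1)) (expR (- x^-1) * x^-2).
    rewrite -[x^-2]opprK.
    exact: (@is_derive1_comp R expR (fun y : R => - y^-1)).
  have -> : flat m.+2 x - m%:R * flat m.+1 x = x^-1 ^+ m *: (expR (- x^-1) * x^-2)
      + expR (- x^-1) *: (m%:R * x^-1 ^+ m.-1 * - x^-2); last exact: is_deriveM.
  rewrite /flat x0 -![_ *: _]/(_ * _).
  case: m {dX} => [|m] /=.
    by rewrite !mul0r !mulr0 subr0 addr0 !expr0 mul1r mulrC exprVn.
  rewrite !exprS; field; rewrite ?gt_eqF //.
- have -> : flat m.+2 0 - m%:R * flat m.+1 0 = 0 by rewrite /flat ltxx mulr0 subrr.
  (* The difference quotient of [flat m] at 0 is [flat m.+1] itself, which [flat_le] sends to 0. *)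
  have cv : h^-1 *: ((flat m \o shift 0) (h *: 1) - flat m 0) @[h --> (0:R)^'] --> (0 : R).
    apply/cvgrPdist_le => /= e e0.
    near=> h; rewrite sub0r normrN addr0 [_%:A]mulr1 {2}/flat ltxx subr0.
    have h0 : h != 0 by near: h; exact: nbhs_dnbhs_neq.
    have -> : h^-1 *: flat m h = flat m.+1 h.
      rewrite /flat; case: ifP => _; last by rewrite scaler0.
      by rewrite exprS -mulrA.
    apply: le_trans (flat_le _ _) _.
    rewrite mulrC -ler_pdivlMr ?ltr0n ?fact_gt0 //.
    near: h; apply: dnbhs0_le; rewrite divr_gt0 // ltr0n fact_gt0 //.
  apply: DeriveDef; first by apply/cvg_ex; exists 0.
  exact: cvg_lim.
Unshelve. all: by end_near. Qed.

Lemma Ck_flat n k m (U : set 'rV[R]_n) g : open U -> Ck k U g ->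
  Ck k U (fun x => flat m (g x)).
Proof.
move=> oU; elim: k m => [|k IH] m Hg.
  split=> // x Ux; apply: (continuous_comp (Ck_continuous Hg Ux)).
  apply/differentiable_continuous/derivable1_diffP.
  by case: (is_derive_flat m (g x)).
have cf x : U x -> {for x, continuous (fun x => flat m (g x))}.
  move=> Ux; apply: (continuous_comp (Ck_continuous Hg Ux)).
  apply/differentiable_continuous/derivable1_diffP.
  by case: (is_derive_flat m (g x)).
split=> // i; have [dgi Dgi] := Hg.2 i.
have dF x : U x -> is_derive x (delta_mx ord0 i) (fun x => flat m (g x))
   ((flat m.+2 (g x) - m%:R * flat m.+1 (g x)) * 'D_(delta_mx ord0 i) g x).
  by move=> Ux; apply: is_derive_comp1 (derivableP (dgi _ Ux)) (is_derive_flat _ _).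
split; first by move=> x Ux; case: (dF x Ux).
apply: (@Ck_ext _ _ _ _ (fun x => (flat m.+2 (g x) + - m%:R * flat m.+1 (g x)) *
    'D_(delta_mx ord0 i) g x)) => //.
  by move=> x Ux; case: (dF x Ux) => _ ->; rewrite mulNr.
have gk := CkS Hg.
exact: Ck_mul oU (Ck_add oU (IH _ gk) (Ck_mul oU (Ck_cst _ _ _) (IH _ gk))) Dgi.
Qed.

(** The norm in the statement is the sup norm, which is not smooth. The witness uses r^2 minus the
    squared Euclidean distance, whose positivity set lies inside the sup ball. *)
Lemma bump_function n (x0 : 'rV[R]_n) (r : R) : 0 < r ->
  exists b : 'rV[R]_n -> R, [/\ Cinf setT b, b x0 != 0 &
    forall x, b x != 0 -> `|x - x0| < r].
Proof.
move=> r0.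
exists (fun x => flat 0 (r ^+ 2
  + \sum_i -1 * ((x ord0 i + - x0 ord0 i) * (x ord0 i + - x0 ord0 i)))).
split.
- move=> k; apply: Ck_flat; first exact: openT.
  apply: Ck_add; [exact: openT|exact: Ck_cst|].
  apply: Ck_sum; first exact: openT.
  move=> i; apply: Ck_mul; [exact: openT|exact: Ck_cst|].
  by apply: Ck_mul; first exact: openT; apply: Ck_add;
    [exact: openT|exact: Ck_coord|exact: Ck_cst|exact: openT|exact: Ck_coord|exact: Ck_cst].
- rewrite big1; last by move=> i _; rewrite subrr !mulr0.
  by rewrite addr0 /flat exprn_gt0 // mulf_neq0 // gt_eqF // expR_gt0.
- move=> x; rewrite /flat; case: ifP => [H _|]; last by rewrite eqxx.
  apply: normr_lt_coord => // i; rewrite !mxE.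
  rewrite -(ltr_pXn2r (n := 2)) // ?nnegrE ?normr_ge0 ?ltW // real_normK ?num_real //.
  move: H; rewrite (bigD1 i) //= mulN1r addrCA addrC subr_gt0 -expr2.
  move=> /lt_le_trans; apply; rewrite gerDl; apply: sumr_le0 => j _.
  by rewrite mulN1r oppr_le0 -expr2 sqr_ge0.
Qed.

End Bump.

Lemma Rintegral_unit_cst {R : realType} (c : R) :
  Rintegral (@lebesgue_measure R) `[0, 1] (fun=> c) = c.
Proof.
rewrite Rintegral_cst //.
have /= := @lebesgue_measure_itv R `[0%R, 1%R].
rewrite lte_fin ltr01 oppr0 adde0 => H.
have -> : fine (@lebesgue_measure R `[0, 1]) = 1 by rewrite H.
by rewrite mulr1.
Qed.

Section Hadamard.
Context {R : realType} {n : nat}.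
Variables (U : set 'rV[R]_n) (x0 : 'rV[R]_n) (r : R).
Hypotheses (oU : open U) (r0 : 0 < r) (cbU : forall x, `|x - x0| <= r -> U x).
Implicit Types (G : 'rV[R]_n -> R) (x v y : 'rV[R]_n).
Local Notation basis i := (delta_mx ord0 i : 'rV[R]_n).
Local Notation mu := (@lebesgue_measure R).
Local Notation B := [set x : 'rV[R]_n | `|x - x0| < r].

Lemma bounded_on_ball G : Ck 0 U G ->
  exists2 M : R, 0 <= M & forall x, `|x - x0| <= r -> `|G x| <= M.
Proof.
move=> cG.
have cb : compact (closed_ball x0 r).
  apply: bounded_closed_compact; last exact: closed_ball_closed.
  exists (`|x0| + r); split; first exact: num_real.
  move=> M MM x /=; rewrite closed_ballE // /closed_ball_ /= => xr.
  apply: le_trans (ltW MM); rewrite -[x](subrK x0) addrC.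
  by apply: le_trans (ler_normD _ _) _; rewrite lerD2l distrC.
have inb x : x \in closed_ball x0 r <-> `|x - x0| <= r.
  by rewrite inE closed_ballE // /closed_ball_ /= distrC.
have [||c cB cM] := @EVT_max_rV R n (fun x => `|G x|) (closed_ball x0 r) _ cb.
- by exists x0; apply/set_mem/inb; rewrite subrr normr0 ltW.
- apply: continuous_in_subspaceT => x /inb /cbU Ux.
  apply: (@continuous_comp _ _ _ G (fun y : R => `|y|)); last exact: norm_continuous.
  exact: Ck_continuous cG Ux.
by exists `|G c| => // x /inb; exact: cM.
Qed.

Lemma segment_in_ball x (t : R) : 0 <= t <= 1 -> `|x - x0| < r ->
  `|t *: (x - x0) + x0 - x0| <= r.
Proof.
move=> /andP[t0 t1] xr; rewrite addrK normrZ ger0_norm //.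
by apply: le_trans (ltW xr); rewrite ler_piMl.
Qed.

Lemma continuous_segment_at m G x (t : R) : Ck 0 U G -> `|x - x0| < r -> 0 <= t <= 1 ->
  {for t, continuous (fun t : R => t ^+ m * G (t *: (x - x0) + x0))}.
Proof.
move=> cG xr t01.
have ct : {for t, continuous (fun t : R => t *: (x - x0) + x0)}.
  apply: continuousD; last exact: cst_continuous.
  by apply: continuousZl; exact: cvg_id.
apply: (@continuousM _ _ (fun t : R => t ^+ m) (fun t : R => G (t *: (x - x0) + x0))).
  exact: exprn_continuous.
apply: (continuous_comp ct).
apply: (Ck_continuous cG).
by apply: cbU; exact: segment_in_ball.
Qed.

Lemma continuous_segment m G x : Ck 0 U G -> `|x - x0| < r ->
  {within `[0, 1], continuous (fun t : R => t ^+ m * G (t *: (x - x0) + x0))}.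
Proof.
move=> cG xr; apply: continuous_in_subspaceT => t.
by rewrite inE /= in_itv /= => t01; exact: continuous_segment_at.
Qed.

Lemma integrable_segment m G x : Ck 0 U G -> `|x - x0| < r ->
  mu.-integrable `[0, 1] (EFin \o (fun t : R => t ^+ m * G (t *: (x - x0) + x0))).
Proof.
move=> cG xr; apply: continuous_compact_integrable; first exact: segment_compact.
exact: continuous_segment.
Qed.

(** Each differentiation in x under the integral brings out one factor t. The weight [t ^+ m] keeps
    all derivatives within the same family. *)
Definition ray_mean m G x : R :=
  Rintegral mu `[0, 1] (fun t : R => t ^+ m * G (t *: (x - x0) + x0)).

Lemma ray_mean_bound m G x M : Ck 0 U G -> 0 <= M ->
  (forall y, `|y - x0| <= r -> `|G y| <= M) ->
  `|x - x0| < r -> `|ray_mean m G x| <= M.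
Proof.
move=> cG M0 GM xr.
apply: le_trans (le_normr_Rintegral _ (integrable_segment m cG xr)) _ => //.
apply: (@le_trans _ _ (Rintegral mu `[0, 1] (fun=> M))).
  apply: le_Rintegral => //.
  - by apply: (integrable_abse (integrable_segment m cG xr)).
  - apply: continuous_compact_integrable; first exact: segment_compact.
    by apply: continuous_subspaceT => ?; exact: cst_continuous.
  - move=> t /=; rewrite in_itv /= => /[dup] t01 /andP[t0 t1].
    rewrite normrM normrX ger0_norm //.
    apply: le_trans (GM _ (segment_in_ball t01 xr)).
    by rewrite ler_piMl // exprn_ile1.
by rewrite Rintegral_unit_cst.
Qed.

Lemma is_derive_ray_mean m G x i : Ck 1 U G -> `|x - x0| < r ->
  is_derive x (basis i) (ray_mean m G)
    (ray_mean m.+1 (fun y => 'D_(basis i) G y) x).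
Proof.
move=> cG xr; have [dG cDG] := cG.2 i.
have [M M0 DGM] := bounded_on_ball cDG.
(* Basis vectors have sup norm at most 1, so for |s| < eta the shifted point stays in the open ball
   and its whole segment to [x0] stays in [U]. *)
pose eta := r - `|x - x0|.
have eta0 : 0 < eta by rewrite subr_gt0.
pose f (s t : R) : R := t ^+ m * G (t *: (s *: basis i + x - x0) + x0).
have sB s : s \in `]- eta, eta[ -> `|s *: basis i + x - x0| < r.
  rewrite in_itv /= -ltr_norml => sE.
  rewrite -addrA; apply: le_lt_trans (ler_normD _ _) _.
  rewrite -ltrBrDr; apply: le_lt_trans sE.
  rewrite normrZ -[leRHS]mulr1 ler_wpM2l //.
  apply: normr_le_coord => // j; rewrite mxE eqxx /=.
  by case: (j == i); rewrite ?normr1 ?normr0.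
have df s t : s \in `]- eta, eta[ -> 0 <= t <= 1 -> is_derive s (1 : R) (f ^~ t)
    (t ^+ m.+1 * 'D_(basis i) G (t *: (s *: basis i + x - x0) + x0)).
  move=> sI t01.
  have E s' : t *: (s' *: basis i + x - x0) + x0 =
      s' *: (t *: basis i) + (t *: (x - x0) + x0).
    by rewrite -addrA scalerDr !scalerA mulrC addrA.
  have Uz := cbU (segment_in_ball t01 (sB _ sI)).
  have H := is_deriveZv t (derivableP (dG _ Uz)).
  rewrite {1}E in H.
  have := is_derive_line H => H2.
  have -> : f ^~ t = (fun s => t ^+ m * G (s *: (t *: basis i) + (t *: (x - x0) + x0))).
    by apply/funext => s'; rewrite /f E.
  rewrite exprSr -mulrA.
  have [dd DD] := H2.
  apply: DeriveDef; first exact: (derivableM (derivable_cst _ _ _) dd).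
  by rewrite [LHS](deriveMl _ dd) DD.
have I0 : `](- eta), eta[%classic (0 : R) by rewrite /= in_itv /= oppr_lt0 eta0.
have intf s : `](- eta), eta[%classic s -> mu.-integrable `[0, 1] (EFin \o f s).
  by move=> /= sI; apply: integrable_segment; [exact: CkS cG|exact: sB].
have derf s t : `](- eta), eta[%classic s -> `[0, 1]%classic t -> derivable (f ^~ t) s 1.
  by move=> /= sI; rewrite in_itv /= => t01; case: (df s t sI t01).
have Gub s t : `](- eta), eta[%classic s -> `[0, 1]%classic t ->
    `|partial1of2 f s t| <= cst M t.
  move=> /= sI; rewrite in_itv /= => /[dup] t01 /andP[t0 t1].
  rewrite partial1of2E; case: (df s t sI t01) => _ ->.
  rewrite normrM normrX ger0_norm //.
  apply: le_trans (DGM _ (segment_in_ball t01 (sB _ sI))).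
  by rewrite ler_piMl // exprn_ile1.
have intM : mu.-integrable `[0, 1] (EFin \o (cst M : R -> R)).
  apply: continuous_compact_integrable; first exact: segment_compact.
  by apply: continuous_subspaceT => ?; exact: cst_continuous.
have mI : measurable (`[0, 1]%classic : set R) by [].
have dF := @derivable_under_integral R _ _ mu f _ mI 0 (- eta) eta I0 intf derf
   (cst M) (fun=> M0) intM Gub.
have DF := @differentiation_under_integral R _ _ mu f _ mI 0 (- eta) eta I0 intf derf
   (cst M) (fun=> M0) intM Gub.
have EF : (fun s : R => ray_mean m G (s *: basis i + x)) =
    (fun s => Rintegral mu `[0, 1] (f s)) by [].
apply: DeriveDef; first by apply/derivable1P; rewrite EF; exact: dF.
rewrite derive_line0 EF -derive1E DF; apply: eq_Rintegral => t.
rewrite inE /= in_itv /= => t01; rewrite partial1of2E.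
have sI : 0 \in `](- eta), eta[ by [].
by case: (df 0 t sI t01) => _ ->; rewrite scale0r add0r.
Qed.

Lemma open_ray_ball : open B.
Proof.
have -> : B = ball x0 r.
  by apply/seteqP; split=> x /=; rewrite -ball_normE /= distrC.
exact: ball_open.
Qed.

Lemma Cinf_derive G i : Cinf U G -> Cinf U (fun y => 'D_(basis i) G y).
Proof. by move=> cG l; exact: ((cG l.+1).2 i).2. Qed.

(* The partial derivatives of a ray mean are bounded, so that it is Lipschitz. *)
Lemma continuous_ray_mean m G x : Cinf U G -> `|x - x0| < r ->
  {for x, continuous (ray_mean m G)}.
Proof.
move=> cG xB.
have Mi i : {M : R | 0 <= M /\ forall y, `|y - x0| <= r -> `|'D_(basis i) G y| <= M}.
  by apply: cid; have [M M0 MG] := bounded_on_ball (Cinf_derive i cG 0%N); exists M.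
pose M := \sum_i sval (Mi i).
have MG i y : `|y - x0| <= r -> `|'D_(basis i) G y| <= M.
  move=> /(svalP (Mi i)).2 H; apply: le_trans H _; rewrite /M (bigD1 i) //= lerDl.
  by apply: sumr_ge0 => j _; exact: (svalP (Mi j)).1.
have M0 : 0 <= M by apply: sumr_ge0 => j _; exact: (svalP (Mi j)).1.
rewrite /prop_for /continuous_at.
apply/(@cvgrPdist_le _ _ _ (nbhs x) _ (ray_mean m G)) => /= e e0.
have nb : nbhs x B by exact: open_nbhs_nbhs (conj open_ray_ball xB).
move/nbhs_ballP : nb => [d /= d0 dB].
have K0 : 0 < M * n%:R + 1 by rewrite ltr_wpDl // mulr_ge0.
have nd : nbhs x (ball x (Num.min d (e / (M * n%:R + 1)))).
  by apply: nbhsx_ballx; rewrite lt_min d0 divr_gt0.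
apply: filterS nd => y; rewrite -ball_normE /= distrC lt_min => /andP[yd /ltW ye].
have := @increment_bound _ _ (ray_mean m G) x (y - x) (fun=> 0) M.
rewrite [x + _]addrC subrK big1 ?subr0 1?distrC; last by move=> i _; rewrite mulr0.
move=> H; apply: le_trans (H _) _.
  move=> z zP i.
  have zB : `|z - x0| < r.
    apply: dB; rewrite -ball_normE /= distrC; apply: le_lt_trans yd.
    by apply: normr_le_coord => // j; have := le_trans (zP j) (normr_coord_le _ _); rewrite !mxE.
  have [dz Dz] := is_derive_ray_mean m i (cG 1%N) zB.
  split=> //; rewrite Dz subr0; apply: ray_mean_bound => //.
    exact: (Cinf_derive i cG 0%N).
  by move=> w; exact: MG.
apply: le_trans (ler_wpM2l M0 (sum_coord_le _)) _.
apply: (@le_trans _ _ ((M * n%:R + 1) * `|y - x|)).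
  by rewrite mulrA ler_wpM2r // lerDl.
by rewrite mulrC -ler_pdivlMr.
Qed.

Lemma Cinf_ray_mean m G : Cinf U G -> Cinf B (ray_mean m G).
Proof.
move=> cG k; elim: k m G cG => [|k IH] m G cG.
  by split=> // x xB; exact: continuous_ray_mean.
split; first by move=> x xB; exact: continuous_ray_mean.
move=> i; split.
  by move=> x xB; case: (is_derive_ray_mean m i (cG 1%N) xB).
apply: Ck_ext (IH m.+1 _ (Cinf_derive i cG)); first exact: open_ray_ball.
by move=> x xB; case: (is_derive_ray_mean m i (cG 1%N) xB).
Qed.

Lemma hadamard G : Cinf U G ->
  exists h : 'I_n -> 'rV[R]_n -> R, [/\ forall i, Cinf B (h i),
    forall i, h i x0 = 'D_(basis i) G x0 &
    forall x, B x -> G x = G x0 + \sum_i (x ord0 i - x0 ord0 i) * h i x].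
Proof.
move=> cG; pose DG i := fun y => 'D_(basis i) G y.
have cDG i : Cinf U (DG i) := Cinf_derive i cG.
(* The coefficients that the fundamental theorem of calculus produces along the ray from [x0]: means
   of the partial derivatives of [G]. At [x0] the ray is constant. *)
exists (fun i => ray_mean 0 (DG i)); split.
- by move=> i; exact: Cinf_ray_mean.
- move=> i; rewrite /ray_mean.
  rewrite (@eq_Rintegral _ _ _ _ _ (fun=> DG i x0)).
    by rewrite Rintegral_unit_cst.
  by move=> t _; rewrite subrr scaler0 add0r expr0 mul1r.
move=> x xB; apply/eqP; rewrite addrC -subr_eq; apply/eqP.
have dF (t : R) : 0 <= t <= 1 -> is_derive t (1 : R) (fun s : R => G (s *: (x - x0) + x0))
    (\sum_i (x ord0 i - x0 ord0 i) * DG i (t *: (x - x0) + x0)).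
  move=> t01; apply: is_derive_line.
  have Ut := cbU (segment_in_ball t01 xB).
  have [dGt DGt] := Ck1_differentiable oU (cG 1%N) Ut.
  apply: DeriveDef; first exact: diff_derivable.
  by rewrite DGt; apply: eq_bigr => i _; rewrite !mxE.
(* The idle factor [t ^+ 0] keeps the integrand in the shape of [ray_mean 0]. *)
pose S (t : R) := \sum_i (x ord0 i - x0 ord0 i) * (t ^+ 0 * DG i (t *: (x - x0) + x0)).
have cS i (t : R) : 0 <= t <= 1 -> {for t, continuous (fun t : R =>
    (x ord0 i - x0 ord0 i) * (t ^+ 0 * DG i (t *: (x - x0) + x0)))}.
  move=> t01; apply: (@continuousM _ _ (fun=> x ord0 i - x0 ord0 i)
    (fun t : R => t ^+ 0 * DG i (t *: (x - x0) + x0))); first exact: cst_continuous.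
  exact: continuous_segment_at (cDG i 0%N) xB t01.
have iS i : mu.-integrable `[0, 1] (EFin \o (fun t : R => (x ord0 i - x0 ord0 i) *
    (t ^+ 0 * DG i (t *: (x - x0) + x0)))).
  apply: continuous_compact_integrable; first exact: segment_compact.
  by apply: continuous_in_subspaceT => t; rewrite inE /= in_itv /=; exact: cS.
have cSS : {within `[0, 1], continuous S}.
  apply: continuous_in_subspaceT => t; rewrite inE /= in_itv /= => t01.
  have -> : S = \sum_i (fun t : R => (x ord0 i - x0 ord0 i) *
    (t ^+ 0 * DG i (t *: (x - x0) + x0))) by apply/funext => s; rewrite fct_sumE.
  elim/big_ind : _ => [||i _]; last exact: cS.
    exact: cst_continuous.
  by move=> F F' cF cF'; apply: continuousD.
have SE t : S t = \sum_i (x ord0 i - x0 ord0 i) * DG i (t *: (x - x0) + x0).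
  by apply: eq_bigr => i _; rewrite expr0 mul1r.
have FTC := @continuous_FTC2 R S (fun s : R => G (s *: (x - x0) + x0)) 0 1 ltr01 cSS.
have : (\int[mu]_(t in `[0%R, 1%R]) (S t)%:E = (G x)%:E - (G x0)%:E)%E.
  rewrite FTC ?scale1r ?scale0r ?subrK ?add0r //.
  - have cF (t : R) : 0 <= t <= 1 -> {for t, continuous (fun s : R => G (s *: (x - x0) + x0))}.
      move=> t01; apply/differentiable_continuous/derivable1_diffP.
      by case: (dF t t01).
    have cF0 := cF 0 _; have cF1 := cF 1 _.
    split.
    + by move=> t; rewrite in_itv /= => /andP[/ltW t0 /ltW t1]; case: (dF t _); rewrite ?t0.
    + by apply: cvg_at_right_filter; apply: cF0; rewrite lexx ler01.
    + by apply: cvg_at_left_filter; apply: cF1; rewrite lexx ler01.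
  - move=> t; rewrite in_itv /= => /andP[/ltW t0 /ltW t1]; rewrite derive1E SE.
    by case: (dF t _); rewrite ?t0.
under eq_integral do rewrite /S -sumEFin.
rewrite (@integral_sum _ _ R mu `[0, 1] _ 'I_n (fun i => EFin \o (fun t : R =>
   (x ord0 i - x0 ord0 i) * (t ^+ 0 * DG i (t *: (x - x0) + x0)))) iS) //.
move=> /(congr1 fine); rewrite -EFinB /= => <-.
rewrite -sum_fine; last by move=> i _; apply: integrable_fin_num; last exact: iS.
apply: eq_bigr => i _.
rewrite /ray_mean -RintegralZl //.
by apply: integrable_segment => //; exact: cDG.
Qed.

End Hadamard.

(** * Tangent frames and calculus of vector fields *)

Lemma open_setI_preimage {S T : topologicalType} (A : set S) (f : S -> T) (O : set T) :
  open A -> (forall x, A x -> {for x, continuous f}) -> open O ->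
  open (A `&` f @^-1` O).
Proof.
move=> oA cf oO; rewrite openE => x [Ax Ofx].
apply: filterI; first exact: open_nbhs_nbhs.
by apply: (cf x Ax); exact: open_nbhs_nbhs.
Qed.

Section ChartExtension.
Context {R : realType} {n : nat} (M : smooth_manifold R n).
Variables (c : chart R n M) (ac : atlas c) (x0 : 'rV[R]_n) (r : R).
Variable b : 'rV[R]_n -> R.
Hypotheses (r0 : 0 < r) (cbc : forall x, `|x - x0| <= r -> chart_cod c x).
Hypotheses (sb : Cinf setT b) (suppb : forall x, b x != 0 -> `|x - x0| < r / 2).
Local Notation B := [set x : 'rV[R]_n | `|x - x0| < r].

Definition chart_ext (u : 'rV[R]_n -> R) (q : M) : R :=
  if `[< chart_dom c q >] then b (chart_fun c q) * u (chart_fun c q) else 0.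

Lemma chart_extE u q : chart_dom c q ->
  chart_ext u q = b (chart_fun c q) * u (chart_fun c q).
Proof. by move=> cq; rewrite /chart_ext asboolT. Qed.

Lemma chart_ext_out u q : ~ chart_dom c q -> chart_ext u q = 0.
Proof. by move=> cq; rewrite /chart_ext asboolF. Qed.

Let r20 : 0 < r / 2. Proof. by rewrite divr_gt0. Qed.

Let K : set M := chart_inv c @` closed_ball x0 (r / 2).

Let inK x : closed_ball x0 (r / 2) x <-> `|x - x0| <= r / 2.
Proof. by rewrite closed_ballE // /closed_ball_ /= distrC. Qed.

Let r2r (x : R) : x <= r / 2 -> x < r.
Proof.
move=> H; apply: le_lt_trans H _.
by rewrite ltr_pdivrMr // ltr_pMr // ltr1n.
Qed.

Let closedK : closed K.
Proof.
apply: compact_closed; first exact: manifold_hausdorff.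
apply: continuous_compact.
  apply: continuous_in_subspaceT => x; rewrite inE => /inK xr.
  by apply: chart_inv_continuous; apply: cbc; exact: ltW (r2r xr).
apply: bounded_closed_compact; last exact: closed_ball_closed.
exists (`|x0| + r / 2); split; first exact: num_real.
move=> m mm x /= /inK xr.
apply: le_trans (ltW mm); rewrite -[x](subrK x0) addrC.
by apply: le_trans (ler_normD _ _) _; rewrite lerD2l.
Qed.

Lemma chart_invP x : chart_cod c x -> chart_dom c (chart_inv c x) /\
  chart_fun c (chart_inv c x) = x.
Proof. by case=> q cq <-; rewrite chart_funK. Qed.

(** Two open sets cover the manifold: the part of the chart domain over [B], where the extension is
    a smooth expression in the chart, and the complement of [K], where it vanishes. The second is
    open because [K] is compact in a Hausdorff space. *)
Lemma smooth_chart_ext u : Cinf B u -> smooth (chart_ext u).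
Proof.
move=> su d ad k; apply: Ck_local => y [q dq yq].
have cd : open (chart_cod d) := chart_cod_open d.
have oB : open B.
  have -> : B = ball x0 r.
    by apply/seteqP; split=> x /=; rewrite -ball_normE /= distrC.
  exact: ball_open.
have [Kq|nKq] := pselect (K q).
  pose O : set M := chart_dom c `&` chart_fun c @^-1` B.
  have oO : open O.
    apply: open_setI_preimage => //; first exact: chart_dom_open.
    exact: chart_fun_continuous.
  have oN : open (chart_cod d `&` chart_inv d @^-1` O).
    by apply: open_setI_preimage => //; exact: chart_inv_continuous.
  exists (chart_cod d `&` chart_inv d @^-1` O).
    split; first by exists q.
    have [x /inK xr xq] := Kq.
    have [cx cxx] := chart_invP (cbc (ltW (r2r xr))).
    by rewrite /= -yq chart_funK // -xq; split=> //=; rewrite cxx; exact: r2r.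
  pose T y := chart_fun c (chart_inv d y).
  apply: (@Ck_ext _ _ _ _ ((fun x => b x * u x) \o T)) => //.
    by move=> z [_ [/= cz _]]; rewrite chart_extE.
  apply: (Ck_comp oN oB) => [z [_ []] //|j|].
    apply: Ck_subset (atlas_compat ad ac j k).
    move=> z [[q' dq' q'z] [cz _]]; exists q' => //; split=> //.
    by move: cz; rewrite -q'z chart_funK.
  by apply: Ck_mul => //; apply: Ck_subset (sb k).
exists (chart_cod d `&` chart_inv d @^-1` ~` K).
  by split; [exists q|rewrite /= -yq chart_funK].
apply: (@Ck_ext _ _ _ _ (fun=> 0)); last exact: Ck_cst.
  apply: open_setI_preimage => //; first exact: chart_inv_continuous.
  exact: closed_openC.
move=> z [_ /= nKz]; have [cz|ncz] := pselect (chart_dom c (chart_inv d z)); last first.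
  by rewrite chart_ext_out.
rewrite chart_extE //; have [->|bz] := eqVneq (b (chart_fun c (chart_inv d z))) 0.
  by rewrite mul0r.
exfalso; apply: nKz; exists (chart_fun c (chart_inv d z)); last exact: chart_funK.
by apply/inK; exact: ltW (suppb bz).
Qed.

End ChartExtension.

Section TangentFrame.
Context {R : realType} {n : nat} (M : smooth_manifold R n).
Implicit Types p q : M.

Lemma smoothb_of (f : M -> R) : smooth f -> f \in @smoothb R n M.
Proof. by move=> sf; apply/asboolP. Qed.

Lemma tangent_sum p (I : Type) (s : seq I) (F : I -> tangent p) f :
  (\sum_(i <- s) F i) f = \sum_(i <- s) F i f.
Proof. exact: (big_morph (fun u : tangent p => u f)). Qed.

Lemma tangentP p (D E : tangent p) : (forall f, D f = E f) -> D = E.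
Proof. by move=> DE; apply: val_inj; apply/funext. Qed.

Lemma tangentZ p (D : tangent p) (a : R) f : D (a *: f) = a * D f.
Proof.
have := tangent_lin D a f 0; rewrite addr0 => ->.
suff -> : D 0 = 0 by rewrite addr0.
by have := tangentD D 0 0; rewrite addr0 => /eqP; rewrite -subr_eq subrr => /eqP.
Qed.

(** Multiplying Hadamard's expansion of f by the square of the cutoff gives an identity between
    global functions, [key]: b^2 f = f(p) b^2 + sum of th_i eh_i. A derivation at p can be applied
    to it; the terms with D(b^2) cancel, and since each th_i vanishes at p only D(th_i) times the
    i-th partial derivative remains. *)
Lemma tangent_frame p : exists (E : 'I_n -> vfield M) (th : 'I_n -> smooth_fun M),
  (forall i j, E i p (th j) = (i == j)%:R) /\
  (forall D : tangent p, D = \sum_i D (th i) *: E i p).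
Proof.
have [c ac cp] := atlas_cover p.
pose x0 := chart_fun c p.
have cx0 : chart_cod c x0 by exists p.
have oc : open (chart_cod c) := chart_cod_open c.
have [e /= e0 ec] : exists2 e : R, 0 < e & ball x0 e `<=` chart_cod c.
  by have /nbhs_ballP := open_nbhs_nbhs (conj oc cx0).
pose r := e / 2.
have r0 : 0 < r by rewrite divr_gt0.
have cbc x : `|x - x0| <= r -> chart_cod c x.
  move=> xr; apply: ec; rewrite -ball_normE /= distrC.
  by apply: le_lt_trans xr _; rewrite ltr_pdivrMr // ltr_pMr // ltr1n.
have [b [sb bx0 suppb]] := bump_function x0 (divr_gt0 r0 (ltr0Sn R 1)).
have sext u := @smooth_chart_ext R n M c ac x0 r b r0 cbc sb suppb u.
pose ext := @chart_ext R n M c b.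
have sub (u : 'rV[R]_n -> R) : Cinf (chart_cod c) u ->
    Cinf [set x : 'rV[R]_n | `|x - x0| < r] u.
  by move=> su k; apply: Ck_subset (su k) => x /ltW /cbc.
pose basis i := delta_mx ord0 i : 'rV[R]_n.
pose loc (f : smooth_fun M) x := f (chart_inv c x).
have sloc f : Cinf (chart_cod c) (loc f) := smoothP f ac.
have sDloc f i : Cinf (chart_cod c) (fun x => 'D_(basis i) (loc f) x).
  by move=> k; exact: ((sloc f k.+1).2 i).2.
have dloc f i q : chart_dom c q -> derivable (loc f) (chart_fun c q) (basis i).
  by move=> cq; apply: ((sloc f 1%N).2 i).1; exists q.
pose Ev i q (f : smooth_fun M) : R := ext (fun x => 'D_(basis i) (loc f) x) q.
have Eder i q : Ev i q \in derivation_at q.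
  apply/asboolP; rewrite /Ev /ext; have [cq|ncq] := pselect (chart_dom c q); last first.
    by split=> *; rewrite !chart_ext_out // !mulr0 addr0.
  split=> [a f g|f g]; rewrite !chart_extE //.
    have -> : loc (a *: f + g) = a \*: loc f + loc g by [].
    rewrite deriveD; [|exact: derivableZ (dloc f i q cq)|exact: dloc].
    rewrite deriveZ; last exact: dloc.
    by rewrite mulrDr mulrCA.
  have -> : loc (f * g) = loc f * loc g by [].
  rewrite deriveM; [|exact: dloc..].
  have lE h : loc h (chart_fun c q) = h q by rewrite /loc chart_funK.
  rewrite !lE mulrDr; congr (_ + _); exact: mulrCA.
have Esm i f : smooth (fun q => Tangent (Eder i q) f) by apply: sext; exact: sub.
pose E i := VField (Esm i).
have EE i f : E i p f = b x0 * 'D_(basis i) (loc f) x0 by rewrite /= /Ev /ext chart_extE.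
have oB : open [set x : 'rV[R]_n | `|x - x0| < r].
  have -> : [set x : 'rV[R]_n | `|x - x0| < r] = ball x0 r.
    by apply/seteqP; split=> x /=; rewrite -ball_normE /= distrC.
  exact: ball_open.
have scoord i : Cinf [set x : 'rV[R]_n | `|x - x0| < r] (fun x => x ord0 i - x0 ord0 i).
  by move=> k; apply: Ck_add oB (Ck_coord _ _ _) (Ck_cst _ _ _).
pose th i := SmoothFun (smoothb_of (sext _ (scoord i))).
have thE i q : th i q = ext (fun x => x ord0 i - x0 ord0 i) q by [].
have th0 i : th i p = 0 by rewrite thE /ext chart_extE // subrr mulr0.
have Eth i j : E i p (th j) = b x0 ^+ 2 * (i == j)%:R.
  rewrite EE.
  have -> : 'D_(basis i) (loc (th j)) x0 =
      'D_(basis i) (fun x => b x * (x ord0 j - x0 ord0 j)) x0.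
    apply: near_eq_derive; apply: filterS (open_nbhs_nbhs (conj oc cx0)) => x cx.
    have [cx' cxx] := chart_invP cx.
    by rewrite /loc thE /ext chart_extE // cxx.
  have db : derivable b x0 (basis i) by apply: ((sb 1%N).2 i).1.
  have dx : is_derive x0 (basis i) (fun x : 'rV[R]_n => x ord0 j - x0 ord0 j) (i == j)%:R.
    have := is_derive_coord j x0 (basis i); rewrite mxE eqxx /= eq_sym => H.
    by apply: is_derive_eq; rewrite subr0.
  have [dx1 dx2] := dx.
  have -> : (fun x => b x * (x ord0 j - x0 ord0 j)) =
     b * (fun x : 'rV[R]_n => x ord0 j - x0 ord0 j) by [].
  rewrite (deriveM db dx1) dx2 subrr scale0r addr0 expr2.
  by rewrite -[_ *: _]/(_ * _) mulrA.
(* One factor b(x0) comes from the cut-off field, the other from the cut-off coordinate; dividing by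
   the square makes the two families dual at [p]. *)
exists E, (fun j => (b x0 ^- 2) *: th j); split.
  move=> i j; rewrite tangentZ Eth mulrA mulVf ?mul1r //.
  by rewrite expf_eq0.
move=> D; apply: tangentP => f; rewrite tangent_sum.
have [h [sh h0 fh]] := hadamard oc r0 cbc (sloc f).
have s1 : Cinf [set x : 'rV[R]_n | `|x - x0| < r] (fun=> 1) by move=> k; exact: Ck_cst.
pose be := SmoothFun (smoothb_of (sext _ s1)).
pose eh i := SmoothFun (smoothb_of (sext _ (sh i))).
have key : be * be * f = f p *: (be * be) + \sum_i th i * eh i.
  apply: val_inj; apply/funext => q.
  have vs (F : 'I_n -> smooth_fun M) : val (\sum_i F i) q = \sum_i F i q.
    exact: (big_morph (fun u : smooth_fun M => u q)).
  have {}vs : val (\sum_i th i * eh i) q = \sum_i th i q * eh i q by rewrite vs.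
  rewrite -[RHS]/(f p * (be q * be q) + val (\sum_i th i * eh i) q) vs.
  rewrite -[LHS]/(be q * be q * f q).
  have [cq|ncq] := pselect (chart_dom c q); last first.
    rewrite -[be q]/(ext _ q) /ext chart_ext_out // !mul0r mulr0 add0r big1 // => i _.
    by rewrite thE /ext chart_ext_out // mul0r.
  have beq : be q = b (chart_fun c q) by rewrite -[be q]/(ext _ q) /ext chart_extE // mulr1.
  rewrite beq; have [b0|bn0] := eqVneq (b (chart_fun c q)) 0.
    rewrite b0 !mul0r mulr0 add0r big1 // => i _.
    by rewrite thE /ext chart_extE // b0 !mul0r.
  have qB : `|chart_fun c q - x0| < r.
    apply: lt_le_trans (suppb _ bn0) _.
    by rewrite ler_pdivrMr // ler_pMr // ler1n.
  have := fh _ qB; rewrite /loc !chart_funK // => ->.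
  rewrite mulrDr mulrC; congr (_ + _); rewrite mulr_sumr; apply: eq_bigr => i _.
  rewrite thE -[eh i q]/(ext _ q) /ext !chart_extE //.
  by rewrite mulrACA.
have bep : be p = b x0 by rewrite -[be p]/(ext _ p) /ext chart_extE // mulr1.
have Dsum (F : 'I_n -> smooth_fun M) : D (\sum_i F i) = \sum_i D (F i).
  have D0 : D 0 = 0 by have := tangentZ D 0 0; rewrite scale0r mul0r.
  exact: (big_morph (fun u => D u) (tangentD D) D0).
have := congr1 D key; rewrite tangentM tangentD tangentZ Dsum.
rewrite -[(be * be) p]/(be p * be p) bep addrC => /addrI H.
have b20 : b x0 * b x0 != 0 by rewrite mulf_neq0.
apply: (mulfI b20); rewrite H mulr_sumr; apply: eq_bigr => i _.
rewrite tangentM th0 mul0r add0r.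
rewrite -[eh i p]/(ext _ p) /ext chart_extE // h0.
rewrite -[RHS]/(b x0 * b x0 * (D (b x0 ^- 2 *: th i) * E i p f)) tangentZ EE.
by field.
Qed.

End TangentFrame.

Section FieldCalculus.
Context {R : realType} {n : nat} {M : smooth_manifold R n}.
Implicit Types (f h : smooth_fun M) (X Y Z : vfield M).
Local Notation "X · f" := (vfield_app X f) (at level 34, right associativity).

Lemma smooth_funP f h : (forall p, f p = h p) -> f = h.
Proof. by move=> fh; apply: val_inj; apply/funext. Qed.

Lemma vfield_ext X Y : (forall f, X · f = Y · f) -> X = Y.
Proof.
move=> XY; apply: vfieldP => p; apply: tangentP => f.
by have := congr1 (fun h => smooth_val h p) (XY f).
Qed.

Lemma vappD X f h : X · (f + h) = X · f + X · h.
Proof. by apply: smooth_funP => p; exact: tangentD. Qed.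

Lemma vappN X f : X · (- f) = - X · f.
Proof. by apply: smooth_funP => p; have := tangentZ (X p) (-1) f; rewrite scaleN1r mulN1r. Qed.

Lemma vappM X f h : X · (f * h) = f * X · h + h * X · f.
Proof. by apply: smooth_funP => p; exact: tangentM. Qed.

Lemma vappZ X (a : R) f : X · (a *: f) = a *: X · f.
Proof. by apply: smooth_funP => p; exact: tangentZ. Qed.

Lemma vapp_fieldD X Y f : (X + Y) · f = X · f + Y · f.
Proof. exact: smooth_funP. Qed.

Lemma vapp_fieldN X f : (- X) · f = - X · f.
Proof. exact: smooth_funP. Qed.

Lemma vapp_fieldZ h X f : (h *: X) · f = h * X · f.
Proof. exact: smooth_funP. Qed.

Lemma vapp_bracket X Y f : bracket X Y · f = X · Y · f - Y · X · f.
Proof. exact: smooth_funP. Qed.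

Definition vappE := (vappD, vappN, vappM, vapp_fieldD, vapp_fieldN, vapp_fieldZ, vapp_bracket).

Lemma bracketC X Y : bracket Y X = - bracket X Y.
Proof. by apply: vfield_ext => f; rewrite !vappE opprB. Qed.

Lemma bracketDr X Y Z : bracket X (Y + Z) = bracket X Y + bracket X Z.
Proof. by apply: vfield_ext => f; rewrite !vappE; ring. Qed.

Lemma bracketZr X f Y : bracket X (f *: Y) = f *: bracket X Y + X · f *: Y.
Proof. by apply: vfield_ext => h; rewrite !vappE; ring. Qed.

Lemma bracketDl X Y Z : bracket (X + Y) Z = bracket X Z + bracket Y Z.
Proof. by apply: vfield_ext => f; rewrite !vappE; ring. Qed.

Lemma bracketZl X f Y : bracket (f *: X) Y = f *: bracket X Y - Y · f *: X.
Proof. by apply: vfield_ext => h; rewrite !vappE; ring. Qed.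

Lemma jacobi_bracket X Y Z :
  bracket (bracket X Y) Z + bracket (bracket Y Z) X + bracket (bracket Z X) Y = 0.
Proof.
apply: vfield_ext => f; rewrite !vappE.
by have -> : vfield_app 0 f = 0 by [exact: smooth_funP]; ring.
Qed.

Definition eval_at (p : M) (f : smooth_fun M) : R := f p.

Fact eval_at_zmod p : zmod_morphism (eval_at p). Proof. by []. Qed.
Fact eval_at_monoid p : monoid_morphism (eval_at p). Proof. by []. Qed.
HB.instance Definition _ p :=
  GRing.isZmodMorphism.Build (smooth_fun M) R (eval_at p) (eval_at_zmod p).
HB.instance Definition _ p :=
  GRing.isMonoidMorphism.Build (smooth_fun M) R (eval_at p) (eval_at_monoid p).

Lemma smooth_sum (I : Type) (s : seq I) (F : I -> smooth_fun M) p :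
  (\sum_(i <- s) F i) p = \sum_(i <- s) F i p.
Proof. exact: (raddf_sum (eval_at p)). Qed.

Lemma vfield_sum (I : Type) (s : seq I) (F : I -> vfield M) p :
  (\sum_(i <- s) F i) p = \sum_(i <- s) F i p.
Proof. exact: (big_morph (fun X : vfield M => X p)). Qed.

(** Reduces local smoothness to identities between global smooth functions: the denominator may
    vanish elsewhere, as Gram determinants of fields do. *)
Lemma smooth_divide (f : M -> R) :
  (forall p, exists d h : smooth_fun M, d p != 0 /\ forall q, d q * f q = h q) ->
  smooth f.
Proof.
move=> H c ac k; apply: Ck_local => x [p cp px].
have [d [h [dp dfh]]] := H p.
have oc := chart_cod_open c.
pose V := chart_cod c `&` (d \o chart_inv c) @^-1` [set y | y != 0].
have oV : open V.
  apply: (@open_setI_preimage _ _ _ _ [set y : R | y != 0] oc); last exact: open_neq.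
  by move=> y cy; exact: Ck_continuous (smoothP d ac 0%N) cy.
exists V; first by split; [exists p|rewrite /= -px chart_funK].
apply: (@Ck_ext _ _ _ _ (fun y => (h \o chart_inv c) y * ((d \o chart_inv c) y)^-1)) => //.
  by move=> y [_ /= dy]; rewrite -dfh mulrAC mulfV // mul1r.
have sV : V `<=` chart_cod c by move=> y [].
apply: Ck_mul => //; first by apply: Ck_subset sV _; exact: smoothP.
by apply: Ck_inv => //; [move=> y []|apply: Ck_subset sV _; exact: smoothP].
Qed.

Lemma vector_extension p (u : tangent p) : exists X : vfield M, X p = u.
Proof.
have [E [th [_ /(_ u) uE]]] := tangent_frame p.
exists (\sum_i (u (th i) *: (1 : smooth_fun M)) *: E i); rewrite vfield_sum [RHS]uE.
apply: eq_bigr => i _; rewrite -[LHS]/((u (th i) * 1) *: E i p).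
by rewrite mulr1.
Qed.

End FieldCalculus.

(** * Gram determinants and duality between fields and one-forms *)

Section Metric.
Context {R : realType} {n : nat} {M : smooth_manifold R n}.
Variable g : riemannian_metric M.
Implicit Types (f h : smooth_fun M) (X Y Z W : vfield M).

Lemma metricDl p (u v w : tangent p) : g p (u + v) w = g p u w + g p v w.
Proof. by have := metric_lin g 1 u v w; rewrite scale1r mul1r. Qed.

Lemma metric0l p (w : tangent p) : g p 0 w = 0.
Proof.
by have := metricDl (0 : tangent p) 0 w; rewrite addr0 => /eqP; rewrite -subr_eq subrr => /eqP.
Qed.

Lemma metricZl p a (u w : tangent p) : g p (a *: u) w = a * g p u w.
Proof. by have := metric_lin g a u 0 w; rewrite addr0 metric0l addr0. Qed.

Lemma metricNl p (u w : tangent p) : g p (- u) w = - g p u w.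
Proof. by rewrite -scaleN1r metricZl mulN1r. Qed.

Lemma metricBl p (u v w : tangent p) : g p (u - v) w = g p u w - g p v w.
Proof. by rewrite metricDl metricNl. Qed.

Lemma metricDr p (u v w : tangent p) : g p w (u + v) = g p w u + g p w v.
Proof. by rewrite metric_sym metricDl !(metric_sym g w). Qed.

Lemma metricZr p a (u w : tangent p) : g p w (a *: u) = a * g p w u.
Proof. by rewrite metric_sym metricZl (metric_sym g w). Qed.

Lemma metricNr p (u w : tangent p) : g p w (- u) = - g p w u.
Proof. by rewrite metric_sym metricNl (metric_sym g w). Qed.

Lemma metricBr p (u v w : tangent p) : g p w (u - v) = g p w u - g p w v.
Proof. by rewrite metricDr metricNr. Qed.

Definition metricE := (metricDl, metricBl, metricNl, metricZl, metricDr, metricBr,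
  metricNr, metricZr).

Lemma metric_suml p (I : Type) (s : seq I) (F : I -> tangent p) w :
  g p (\sum_(i <- s) F i) w = \sum_(i <- s) g p (F i) w.
Proof. exact: (big_morph (fun u => g p u w) (fun u v => metricDl u v w) (metric0l w)). Qed.

Lemma metric_sumr p (I : Type) (s : seq I) (F : I -> tangent p) w :
  g p w (\sum_(i <- s) F i) = \sum_(i <- s) g p w (F i).
Proof. by rewrite metric_sym metric_suml; apply: eq_bigr => i _; rewrite metric_sym. Qed.

Lemma metric_nondeg p (u : tangent p) : g p u u = 0 -> u = 0.
Proof. by move=> gu; have [//|/(metric_pos g)] := eqVneq u 0; rewrite gu ltxx. Qed.

Lemma metric_inj p (u v : tangent p) : (forall w, g p u w = g p v w) -> u = v.
Proof.
move=> uv; apply/eqP; rewrite -subr_eq0; apply/eqP/metric_nondeg.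
by rewrite metricBl uv subrr.
Qed.

Definition gram p (e : 'I_n -> tangent p) : 'M[R]_n := \matrix_(i, j) g p (e i) (e j).

(** The Gram matrix factors through the matrix [C] of coordinates in a basis of the tangent space,
    so its invertibility forces that of the square matrix [C]. *)
Lemma gram_spanning p (e : 'I_n -> tangent p) : gram e \in unitmx ->
  forall u, exists z : 'I_n -> R, u = \sum_i z i *: e i.
Proof.
move=> Gu; have [E [th [_ Eth]]] := tangent_frame p.
pose C : 'M[R]_n := \matrix_(i, j) e i (th j).
have CG : gram e = C *m \matrix_(k, j) g p (E k p) (e j).
  apply/matrixP => i j; rewrite !mxE [in LHS](Eth (e i)) metric_suml.
  by apply: eq_bigr => k _; rewrite metricZl !mxE.
have Cu : C \in unitmx by move: Gu; rewrite CG unitmx_mul => /andP[].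
have EC k : E k p = \sum_i invmx C k i *: e i.
  transitivity (\sum_j (invmx C *m C) k j *: E j p).
    rewrite mulVmx // (bigD1 k) //= !mxE eqxx scale1r big1 ?addr0 // => j jk.
    by rewrite !mxE eq_sym (negbTE jk) scale0r.
  under eq_bigr => j _ do rewrite mxE scaler_suml.
  rewrite exchange_big; apply: eq_bigr => i _.
  rewrite [in RHS](Eth (e i)) scaler_sumr; apply: eq_bigr => j _.
  by rewrite scalerA !mxE.
move=> u; exists (fun i => \sum_k u (th k) * invmx C k i).
rewrite [LHS]Eth; under eq_bigr => k _ do rewrite EC scaler_sumr.
rewrite exchange_big; apply: eq_bigr => i _; rewrite scaler_suml.
by apply: eq_bigr => k _; rewrite scalerA.
Qed.

(* Cramer's rule. If the determinant vanishes, the right-hand side is both in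
   the span of the e_i and orthogonal to it. *)
Lemma gram_expansion p (e : 'I_n -> tangent p) (w : tangent p) :
  \det (gram e) *: w = \sum_i (\sum_j \adj (gram e) j i * g p (e j) w) *: e i.
Proof.
set y := RHS; have yE : y = \sum_i (\sum_j \adj (gram e) j i * g p (e j) w) *: e i by [].
have gye k : g p y (e k) = \det (gram e) * g p (e k) w.
  rewrite metric_suml.
  transitivity (\sum_j (\adj (gram e) *m gram e) j k * g p (e j) w).
    under eq_bigr => i _ do rewrite metricZl mulr_suml.
    rewrite exchange_big; apply: eq_bigr => j _; rewrite !mxE mulr_suml.
    by apply: eq_bigr => i _; rewrite !mxE mulrAC.
  rewrite mul_adj_mx (bigD1 k) //= !mxE eqxx big1 ?addr0 // => j jk.
  by rewrite !mxE (negbTE jk) mul0r.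
have [d0|dn0] := eqVneq (\det (gram e)) 0.
  rewrite d0 scale0r; apply/esym/metric_nondeg; rewrite {2}yE metric_sumr.
  by apply: big1 => i _; rewrite metricZr gye d0 mul0r mulr0.
have Gu : gram e \in unitmx by rewrite unitmxE unitfE.
have [z zE] := gram_spanning Gu (\det (gram e) *: w - y).
apply/eqP; rewrite -subr_eq0; apply/eqP/metric_nondeg.
rewrite {2}zE metric_sumr; apply: big1 => i _.
by rewrite metricZr metricBl gye metricZl (metric_sym g w) subrr mulr0.
Qed.

Definition gram_field (E : 'I_n -> vfield M) : 'M[smooth_fun M]_n :=
  \matrix_(i, j) metric_app g (E i) (E j).

Lemma gram_fieldE E p : map_mx (eval_at p) (gram_field E) = gram (fun i => E i p).
Proof. by apply/matrixP => i j; rewrite !mxE. Qed.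

(** Fields that form a basis at p may degenerate elsewhere, but Cramer's rule, multiplied through by
    the Gram determinant [d E], expands every field globally as in [dZ]. Applying [A] to this
    expansion shows that its value at p depends on the value of the field at p only, and the same
    expansion of the dual vector gives smoothness through [smooth_divide]. *)
Lemma sharp (A : vfield M -> smooth_fun M) :
  (forall f X Y, A (f *: X + Y) = f * A X + A Y) ->
  exists W : vfield M, forall Z, metric_app g W Z = A Z.
Proof.
move=> Alin.
have AD X Y : A (X + Y) = A X + A Y by have := Alin 1 X Y; rewrite scale1r mul1r.
have A0 : A 0 = 0 by have := AD 0 0; rewrite addr0 => /eqP; rewrite -subr_eq subrr => /eqP.
have AZ f X : A (f *: X) = f * A X by have := Alin f X 0; rewrite addr0 A0 addr0.
have Asum (F : 'I_n -> vfield M) : A (\sum_i F i) = \sum_i A (F i).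
  exact: (big_morph A AD A0).
pose d E := \det (gram_field E).
pose c E i j := \adj (gram_field E) j i.
have dE E p : (d E) p = \det (gram (fun i => E i p)).
  by rewrite -gram_fieldE det_map_mx.
have cE E i j p : (c E i j) p = \adj (gram (fun i => E i p)) j i.
  by rewrite -gram_fieldE -map_mx_adj mxE.
have nd p : exists E, (d E) p != 0.
  have [E [th [Eth Espan]]] := tangent_frame p.
  exists E; rewrite dE; apply/negP => /eqP d0.
  have [v v0 /rowP vG] : exists2 v : 'rV[R]_n, v != 0 & v *m gram (fun i => E i p) = 0.
    by apply/det0P/eqP.
  pose u := \sum_i v ord0 i *: E i p.
  have uE : u = \sum_i v ord0 i *: E i p by [].
  have u0 : u = 0.
    apply: metric_nondeg; rewrite {2}uE metric_sumr big1 // => j _.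
    rewrite metricZr metric_suml -[RHS](mulr0 (v ord0 j)); congr (_ * _).
    have := vG j; rewrite !mxE => vGj; rewrite -[RHS]vGj.
    by apply: eq_bigr => i _; rewrite metricZl !mxE.
  have /negP := v0; apply; apply/eqP/rowP => j; rewrite mxE.
  have <- : u (th j) = v ord0 j.
    rewrite tangent_sum (bigD1 j) //= -[(_ *: _) (th j)]/(v ord0 j * E j p (th j)) Eth eqxx.
    rewrite mulr1 big1 ?addr0 // => i ij.
    by rewrite -[LHS]/(v ord0 i * E i p (th j)) Eth (negbTE ij) mulr0.
  by rewrite u0.
have dZ E (Z : vfield M) : d E *: Z = \sum_i (\sum_j c E i j * metric_app g (E j) Z) *: E i.
  apply: vfieldP => q; rewrite vfield_sum -[LHS]/(d E q *: Z q) dE gram_expansion.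
  apply: eq_bigr => i _; rewrite -[RHS]/((\sum_j c E i j * metric_app g (E j) Z) q *: E i q).
  rewrite smooth_sum; congr (_ *: _); apply: eq_bigr => j _.
  by rewrite -[RHS]/((c E i j) q * g q (E j q) (Z q)) cE.
have wex p : exists w : tangent p, forall Z, g p w (Z p) = A Z p.
  have [E dp] := nd p.
  exists (((d E) p)^-1 *: \sum_j (\sum_i (c E i j) p * A (E i) p) *: E j p) => Z.
  apply: (mulfI dp); rewrite metricZl mulrA mulfV // mul1r metric_suml.
  rewrite -[RHS]/((d E * A Z) p) -AZ dZ Asum smooth_sum.
  under eq_bigr => j _ do rewrite metricZl mulr_suml.
  rewrite exchange_big; apply: eq_bigr => i _.
  rewrite AZ -[RHS]/((\sum_j c E i j * metric_app g (E j) Z) p * A (E i) p) smooth_sum.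
  rewrite mulr_suml; apply: eq_bigr => j _.
  by rewrite -[RHS]/((c E i j) p * g p (E j p) (Z p) * A (E i) p) mulrAC.
pose w p := sval (cid (wex p)).
have wA p Z : g p (w p) (Z p) = A Z p := svalP (cid (wex p)) Z.
have sw (f : smooth_fun M) : smooth (fun p => w p f).
  apply: smooth_divide => p; have [E dp] := nd p.
  exists (d E), (\sum_i (\sum_j c E i j * A (E j)) * vfield_app (E i) f); split=> // q.
  rewrite -[LHS]/((d E q *: w q) f) dE (gram_expansion (fun i => E i q)) tangent_sum smooth_sum.
  apply: eq_bigr => i _.
  rewrite -[RHS]/((\sum_j c E i j * A (E j)) q * E i q f) smooth_sum.
  rewrite -[LHS]/((\sum_j _) * E i q f); congr (_ * _); apply: eq_bigr => j _.
  by rewrite -[RHS]/((c E i j) q * A (E j) q) cE metric_sym wA.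
by exists (VField sw) => Z; apply: smooth_funP => p; exact: wA.
Qed.

End Metric.

(** * Metric connections with prescribed torsion *)

Section Koszul.
Context {R : realType} {n : nat} {M : smooth_manifold R n}.
Variable g : riemannian_metric M.
Implicit Types (f : smooth_fun M) (X Y Z W : vfield M).
Local Notation "X · f" := (vfield_app X f) (at level 34, right associativity).
Local Notation "⟨ X , Y ⟩" := (metric_app g X Y).

Lemma mappC X Y : ⟨Y, X⟩ = ⟨X, Y⟩.
Proof. by apply: smooth_funP => p; exact: metric_sym. Qed.

Lemma mappDl X Y Z : ⟨X + Y, Z⟩ = ⟨X, Z⟩ + ⟨Y, Z⟩.
Proof. by apply: smooth_funP => p; exact: metricDl. Qed.

Lemma mappNl X Z : ⟨- X, Z⟩ = - ⟨X, Z⟩.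
Proof. by apply: smooth_funP => p; exact: metricNl. Qed.

Lemma mappZl f X Z : ⟨f *: X, Z⟩ = f * ⟨X, Z⟩.
Proof. by apply: smooth_funP => p; exact: metricZl. Qed.

Lemma mappDr X Y Z : ⟨Z, X + Y⟩ = ⟨Z, X⟩ + ⟨Z, Y⟩.
Proof. by rewrite mappC mappDl !(mappC Z). Qed.

Lemma mappNr X Z : ⟨Z, - X⟩ = - ⟨Z, X⟩.
Proof. by rewrite mappC mappNl (mappC Z). Qed.

Lemma mappZr f X Z : ⟨Z, f *: X⟩ = f * ⟨Z, X⟩.
Proof. by rewrite mappC mappZl (mappC Z). Qed.

Definition mappE := (mappDl, mappDr, mappNl, mappNr, mappZl, mappZr).

Lemma mapp_inj X Y : (forall Z, ⟨X, Z⟩ = ⟨Y, Z⟩) -> X = Y.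
Proof.
move=> XY; apply: vfieldP => p; apply: (metric_inj (g := g)) => w.
have [Z <-] := vector_extension w.
exact: (congr1 (eval_at p) (XY Z)).
Qed.

Variable t : vfield M -> vfield M -> vfield M -> smooth_fun M.
Hypothesis t_lin : forall f X Y Z W, t X Y (f *: Z + W) = f * t X Y Z + t X Y W.
Hypothesis t_skew12 : forall X Y Z, t Y X Z = - t X Y Z.
Hypothesis t_skew23 : forall X Y Z, t X Z Y = - t X Y Z.

Let tDr X Y Z W : t X Y (Z + W) = t X Y Z + t X Y W.
Proof. by have := t_lin 1 X Y Z W; rewrite scale1r mul1r. Qed.

Let t0r X Y : t X Y 0 = 0.
Proof. by have := tDr X Y 0 0; rewrite addr0 => /eqP; rewrite -subr_eq subrr => /eqP. Qed.

Let tZr f X Y Z : t X Y (f *: Z) = f * t X Y Z.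
Proof. by have := t_lin f X Y Z 0; rewrite !addr0 t0r addr0. Qed.

Let tDm X Y Z W : t X (Y + Z) W = t X Y W + t X Z W.
Proof. by rewrite t_skew23 tDr !(t_skew23 X W) opprD. Qed.

Let tZm f X Y Z : t X (f *: Y) Z = f * t X Y Z.
Proof. by rewrite t_skew23 tZr (t_skew23 X Z) mulrN. Qed.

Let tDl X Y Z W : t (X + Y) Z W = t X Z W + t Y Z W.
Proof. by rewrite t_skew12 tDm !(t_skew12 Z) opprD. Qed.

Let tZl f X Y Z : t (f *: X) Y Z = f * t X Y Z.
Proof. by rewrite t_skew12 tZm (t_skew12 Y) mulrN. Qed.

Let tE := (tDr, tZr, tDm, tZm, tDl, tZl).

(** Twice g(D_X Y, Z): the formula for the Levi-Civita connection plus the prescribed torsion,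
    because a metric connection with skew torsion t is the Levi-Civita connection plus t/2. *)
Definition koszul X Y Z : smooth_fun M :=
  X · ⟨Y, Z⟩ + Y · ⟨X, Z⟩ - Z · ⟨X, Y⟩
  + ⟨bracket X Y, Z⟩ - ⟨bracket X Z, Y⟩ - ⟨bracket Y Z, X⟩ + t X Y Z.

Definition bracketE := (@bracketDr R n M, @bracketDl R n M, @bracketZr R n M, @bracketZl R n M).

Lemma koszul_lin f X Y Z W : koszul X Y (f *: Z + W) = f * koszul X Y Z + koszul X Y W.
Proof. by rewrite /koszul !(bracketE, mappE, vappE, tE); rewrite (mappC X Z) (mappC Y Z); ring. Qed.

Lemma koszul_linl f X Y Z W : koszul (f *: X + Y) Z W = f * koszul X Z W + koszul Y Z W.
Proof. by rewrite /koszul !(bracketE, mappE, vappE, tE); ring. Qed.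

Lemma koszul_addr X Y Z W : koszul X (Y + Z) W = koszul X Y W + koszul X Z W.
Proof. by rewrite /koszul !(bracketE, mappE, vappE, tE); ring. Qed.

Lemma koszul_leibniz f X Y Z :
  koszul X (f *: Y) Z = f * koszul X Y Z + (X · f * ⟨Y, Z⟩ + X · f * ⟨Y, Z⟩).
Proof. by rewrite /koszul !(bracketE, mappE, vappE, tE); rewrite (mappC X Y); ring. Qed.

Lemma koszul_metric X Y Z : koszul X Y Z + koszul X Z Y = X · ⟨Y, Z⟩ + X · ⟨Y, Z⟩.
Proof.
by rewrite /koszul (bracketC Y Z) (t_skew23 X Y Z) mappNl (mappC Y Z); ring.
Qed.

Lemma koszul_torsion X Y Z : koszul X Y Z - koszul Y X Z =
  ⟨bracket X Y, Z⟩ + ⟨bracket X Y, Z⟩ + (t X Y Z + t X Y Z).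
Proof.
by rewrite /koszul (bracketC X Y) (t_skew12 X Y Z) mappNl (mappC X Y); ring.
Qed.

Lemma metric_connection_with_torsion :
  exists D : connection M, metric_connection g D /\
    forall X Y Z, ⟨torsion D X Y, Z⟩ = t X Y Z.
Proof.
(* Smooth functions are only a ring, so the factor 1/2 enters as a constant function. *)
pose c : smooth_fun M := (2^-1 : R) *: (1 : smooth_fun M).
have cc f : c * (f + f) = f.
  apply: smooth_funP => p; rewrite -[LHS]/((2^-1 * 1) * (f p + f p)).
  by field.
have [w wE] := choice (fun XY => @sharp R n M g (koszul XY.1 XY.2)
  (fun f => koszul_lin f XY.1 XY.2)).
pose D X Y := c *: w (X, Y).
have DE X Y Z : ⟨D X Y, Z⟩ = c * koszul X Y Z by rewrite mappZl wE.
have Dl f X Y Z : D (f *: X + Y) Z = f *: D X Z + D Y Z.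
  by apply: mapp_inj => W; rewrite !(mappE, DE) koszul_linl; ring.
have Da X Y Z : D X (Y + Z) = D X Y + D X Z.
  by apply: mapp_inj => W; rewrite !(mappE, DE) koszul_addr; ring.
have DL f X Y : D X (f *: Y) = X · f *: Y + f *: D X Y.
  apply: mapp_inj => W; rewrite !(mappE, DE) koszul_leibniz mulrDr cc.
  by ring.
exists (Connection Dl Da DL); split.
  move=> X Y Z p.
  have E : X · ⟨Y, Z⟩ = ⟨D X Y, Z⟩ + ⟨Y, D X Z⟩.
    by rewrite -[LHS]cc -koszul_metric (mappC (D X Z)) !DE; ring.
  exact: (congr1 (eval_at p) E).
move=> X Y Z; rewrite /torsion /= !(mappE, DE).
have -> : c * koszul X Y Z - c * koszul Y X Z = c * (koszul X Y Z - koszul Y X Z) by ring.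
by rewrite koszul_torsion mulrDr !cc; ring.
Qed.

End Koszul.

(** * Almost 3-contact metric structures *)

(** An even permutation of the indices. The redundant third equation closes the cycle and makes the
    relation visibly invariant under rotation. *)
Definition cyc3 (i j k : 'I_3) : Prop := [/\ j = ordS i, k = ordS j & i = ordS k].

Lemma cyc3P (i : 'I_3) : cyc3 i (ordS i) (ordS (ordS i)).
Proof. by split=> //; apply: val_inj; case: i => [[|[|[|]]]]. Qed.

Lemma cyc3_rot i j k : cyc3 i j k -> cyc3 j k i.
Proof. by case. Qed.

Lemma cyc3_012 : cyc3 0 1 2%:R.
Proof. by split; apply: val_inj. Qed.

Lemma ord3P (P : 'I_3 -> Prop) : P 0 -> P 1 -> P 2%:R -> forall i, P i.
Proof.
move=> P0 P1 P2 [[|[|[|//]]] Hi].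
- by have -> : Ordinal Hi = 0 by apply: val_inj.
- by have -> : Ordinal Hi = 1 by apply: val_inj.
- by have -> : Ordinal Hi = 2%:R by apply: val_inj.
Qed.

Section ThreeContactAlgebra.
Context {R : realType} {n : nat} {M : smooth_manifold R n}.
Variable S : almost_3_contact_metric M.
Local Notation φ := (a3_phi S).
Local Notation ξ := (a3_xi S).
Local Notation η := (a3_eta S).
Local Notation g := (a3_g S).
Implicit Types (p : M) (i j k : 'I_3).

Lemma endoD (f : endo M) p (u v : tangent p) : f p (u + v) = f p u + f p v.
Proof. by have := endo_lin f 1 u v; rewrite !scale1r. Qed.

Lemma endo0 (f : endo M) p : f p 0 = 0.
Proof.
by have := endoD f (0 : tangent p) 0; rewrite addr0 => /eqP; rewrite -subr_eq subrr => /eqP.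
Qed.

Lemma endoZ (f : endo M) p a (u : tangent p) : f p (a *: u) = a *: f p u.
Proof. by have := endo_lin f a u 0; rewrite !addr0 endo0 addr0. Qed.

Lemma endoN (f : endo M) p (u : tangent p) : f p (- u) = - f p u.
Proof. by rewrite -scaleN1r endoZ scaleN1r. Qed.

Lemma oneformD (a : oneform M) p (u v : tangent p) : a p (u + v) = a p u + a p v.
Proof. by have := oneform_lin a 1 u v; rewrite scale1r mul1r. Qed.

Lemma oneform0 (a : oneform M) p : a p (0 : tangent p) = 0.
Proof.
by have := oneformD a (0 : tangent p) 0; rewrite addr0 => /eqP; rewrite -subr_eq subrr => /eqP.
Qed.

Lemma oneformZ (a : oneform M) p c (u : tangent p) : a p (c *: u) = c * a p u.
Proof. by have := oneform_lin a c u 0; rewrite addr0 oneform0 addr0. Qed.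

Lemma oneformN (a : oneform M) p (u : tangent p) : a p (- u) = - a p u.
Proof. by rewrite -scaleN1r oneformZ mulN1r. Qed.

Lemma phi_sq i p (v : tangent p) : φ i p (φ i p v) = - v + η i p v *: ξ i p.
Proof. exact: (acm_phi2 (a3_acm S i)). Qed.

Lemma eta_xi i p : η i p (ξ i p) = 1.
Proof. exact: (acm_eta_xi (a3_acm S i)). Qed.

Lemma metric_phi_phi i p (u v : tangent p) :
  g p (φ i p u) (φ i p v) = g p u v - η i p u * η i p v.
Proof. exact: (acm_metric (a3_acm S i)). Qed.

Lemma xi_neq0 i p : ξ i p != 0.
Proof.
by apply/eqP => x0; have := eta_xi i p; rewrite x0 oneform0 => /eqP; rewrite eq_sym oner_eq0.
Qed.

(** The square of phi kills xi; applied to phi xi it gives phi xi = c xi, and applying phi once more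
    gives c^2 xi = 0. *)
Lemma phi_xi i p : φ i p (ξ i p) = 0.
Proof.
have sq : φ i p (φ i p (ξ i p)) = 0 by rewrite phi_sq eta_xi scale1r addNr.
have [c xE] : exists c, φ i p (ξ i p) = c *: ξ i p.
  exists (η i p (φ i p (ξ i p))); have := phi_sq i (φ i p (ξ i p)).
  by rewrite sq endo0 => /esym/eqP; rewrite addrC subr_eq0 => /eqP.
move: sq; rewrite xE endoZ xE scalerA => /eqP.
rewrite scaler_eq0 (negbTE (xi_neq0 i p)) orbF mulf_eq0 orbb => /eqP ->.
exact: scale0r.
Qed.

Lemma etaE i p (v : tangent p) : η i p v = g p (ξ i p) v.
Proof.
have := metric_phi_phi i (ξ i p) v; rewrite phi_xi metric0l eta_xi mul1r => /eqP.
by rewrite eq_sym subr_eq0 => /eqP.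
Qed.

Lemma eta_phi i p (v : tangent p) : η i p (φ i p v) = 0.
Proof.
have := phi_sq i (φ i p v); rewrite [in LHS](phi_sq i v) endoD endoN endoZ phi_xi scaler0 addr0.
move=> /eqP; rewrite -subr_eq0 opprD addrA subrr sub0r oppr_eq0.
by rewrite scaler_eq0 (negbTE (xi_neq0 i p)) orbF => /eqP.
Qed.

Lemma phi_skew i p (u v : tangent p) : g p (φ i p u) v = - g p u (φ i p v).
Proof.
have := metric_phi_phi i u (φ i p v).
rewrite eta_phi mulr0 subr0 phi_sq metricDr metricNr metricZr.
rewrite (metric_sym g (φ i p u) (ξ i p)) -etaE eta_phi mulr0 addr0 => <-.
by rewrite opprK.
Qed.

Section Cyclic.
Variables (i j k : 'I_3) (C : cyc3 i j k).

Lemma phi_comp_l p (v : tangent p) : φ i p (φ j p v) = φ k p v + η j p v *: ξ i p.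
Proof. by case: C => -> -> _; rewrite a3_phi_l subrK. Qed.

Lemma phi_comp_r p (v : tangent p) : φ j p (φ i p v) = - φ k p v + η i p v *: ξ j p.
Proof. by case: C => -> -> _; rewrite a3_phi_r opprD opprK subrK. Qed.

Lemma phi_xi_l p : φ i p (ξ j p) = ξ k p.
Proof. by case: C => -> -> _; rewrite -a3_xi_l. Qed.

Lemma phi_xi_r p : φ j p (ξ i p) = - ξ k p.
Proof. by case: C => -> -> _; rewrite a3_xi_r opprK. Qed.

Lemma eta_phi_l p (v : tangent p) : η i p (φ j p v) = η k p v.
Proof. by case: C => -> -> _; rewrite a3_eta_l. Qed.

Lemma eta_phi_r p (v : tangent p) : η j p (φ i p v) = - η k p v.
Proof. by case: C => -> -> _; rewrite a3_eta_r opprK. Qed.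

End Cyclic.

(** Since xi_j = phi_k xi_i and eta_i o phi_k = - eta_j, the number eta_i(xi_j) is minus
    eta_j(xi_i), which equals itself by symmetry of the metric. *)
Lemma eta_xi_l i j k (C : cyc3 i j k) p : η i p (ξ j p) = 0.
Proof.
have C2 := cyc3_rot (cyc3_rot C).
have H : η i p (ξ j p) = - η i p (ξ j p).
  rewrite -[in LHS](phi_xi_l C2) (eta_phi_r C2).
  by rewrite (etaE i) (etaE j) metric_sym.
by apply/eqP; rewrite -[_ == 0](mulrn_eq0 _ 2) mulr2n {1}H addNr.
Qed.

Lemma eta_xi_r i j k (C : cyc3 i j k) p : η j p (ξ i p) = 0.
Proof. by rewrite etaE metric_sym -etaE (eta_xi_l C). Qed.

End ThreeContactAlgebra.

(** * Hitchin's argument as linear algebra at a point *)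

Section Hitchin.
Context {R : realFieldType} {V : zmodType}.
(** Read [a1], [a2], [a3] as g((D_x I) y, z) and its analogues for J and IJ. Then [a1I] is the
    derivative of I^2 = -1, [a3E] is the Leibniz rule for IJ, and the cyclic identities say that the
    three fundamental forms are closed. *)
Variables (I J : V -> V) (a1 a2 a3 : V -> V -> V -> R).
Hypotheses (II : forall x, I (I x) = - x) (JJ : forall x, J (J x) = - x).
Hypothesis IJ : forall x, J (I x) = - I (J x).
Hypotheses (a1N : forall x y z, a1 x (- y) z = - a1 x y z)
  (a2N : forall x y z, a2 x (- y) z = - a2 x y z).
Hypotheses (a1_skew : forall x y z, a1 x z y = - a1 x y z)
  (a2_skew : forall x y z, a2 x z y = - a2 x y z)
  (a3_skew : forall x y z, a3 x z y = - a3 x y z).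
Hypothesis a1I : forall x y z, a1 x (I y) z = a1 x y (I z).
Hypothesis a3E : forall x y z, a3 x y z = a1 x (J y) z - a2 x y (I z).
Hypotheses (a1_cyc : forall x y z, a1 x y z + a1 y z x + a1 z x y = 0)
  (a2_cyc : forall x y z, a2 x y z + a2 y z x + a2 z x y = 0)
  (a3_cyc : forall x y z, a3 x y z + a3 y z x + a3 z x y = 0).

Let a1Nr x y z : a1 x y (- z) = - a1 x y z.
Proof. by rewrite a1_skew a1N (a1_skew x z y) opprK. Qed.

Let a2Nr x y z : a2 x y (- z) = - a2 x y z.
Proof. by rewrite a2_skew a2N (a2_skew x z y) opprK. Qed.

Let a3E' x y z : a3 x y z = a1 x y (J z) - a2 x (I y) z.
Proof. by rewrite a3_skew a3E (a1_skew x y) (a2_skew x (I y)); ring. Qed.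

(* Integrability of I: the torsion of the complex structure vanishes because
   the forms attached to J and IJ are closed. *)
Lemma hitchin_nijenhuis x y w :
  a1 (I x) y w + a1 x (I y) w = a1 y (I x) w + a1 (I y) x w.
Proof.
have -> : w = J (- J w).
  have JN u : J (- u) = - J u by rewrite -[in LHS](JJ u) JJ.
  by rewrite JN JJ opprK.
move: (- J w) => z.
have e1 := a2_cyc x y z; have e2 := a2_cyc (I x) (I y) z.
have e3 := a3_cyc (I x) y z; have e4 := a3_cyc x (I y) z.
rewrite (a3E' (I x)) (a3E y z) (a3E' z) !II in e3.
rewrite (a3E' x) (a3E (I y)) (a3E' z) !II IJ in e4.
rewrite !(a2N, a2Nr) in e3; rewrite !(a2N, a1Nr) in e4.
have h := a1I z x (J y); have s1 := a1_skew y (I x) (J z); have s2 := a1_skew (I y) x (J z).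
lra.
Qed.

(** The expression [s] is symmetric in its first two and skew in its last two arguments, hence zero,
    so I may be moved between the first two slots of [a1] at the cost of a sign. The cyclic identity
    at (x, I y, I z) then differs from that at (x, y, z) only in the sign of its first term. *)
Lemma hitchin_vanish x y z : a1 x y z = 0.
Proof.
pose s x y w := a1 (I x) y w + a1 x (I y) w.
have s_sym u v w : s v u w = s u v w by rewrite /s addrC -hitchin_nijenhuis addrC.
have s_skew u v w : s u w v = - s u v w.
  by rewrite /s a1_skew (a1_skew _ v (I w)) -a1I opprD.
have s0 u v w : s u v w = 0.
  have h1 := s_skew u v w; have h2 := s_sym u w v; have h3 := s_skew w u v.
  have h4 := s_sym w v u; have h5 := s_skew v w u; have h6 := s_sym v u w.
  lra.
have aI u v w : a1 (I u) v w = - a1 u (I v) w by have := s0 u v w; rewrite /s; lra.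
have h1 := a1_cyc x y z; have := a1_cyc x (I y) (I z).
rewrite (aI y) (aI z) a1I !II (a1I z x (I y)) !II !(a1N, a1Nr).
lra.
Qed.

End Hitchin.

(** * One-forms and their exterior derivatives *)

Section OneFormCalculus.
Context {R : realType} {n : nat} {M : smooth_manifold R n}.
Implicit Types (f : smooth_fun M) (X Y Z : vfield M) (a : oneform M).
Local Notation "X · f" := (vfield_app X f) (at level 34, right associativity).

Lemma to_smooth_val f : to_smooth f = f.
Proof. exact: valKd. Qed.

Definition oneform_app a X : smooth_fun M :=
  SmoothFun (introT (asboolP _) (oneform_smooth a X)).

Lemma oappD a X Y : oneform_app a (X + Y) = oneform_app a X + oneform_app a Y.
Proof. by apply: smooth_funP => p; exact: oneformD. Qed.

Lemma oappN a X : oneform_app a (- X) = - oneform_app a X.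
Proof. by apply: smooth_funP => p; exact: oneformN. Qed.

Lemma oappZ a f X : oneform_app a (f *: X) = f * oneform_app a X.
Proof. by apply: smooth_funP => p; exact: oneformZ. Qed.

Definition oappE := (oappD, oappN, oappZ).

Lemma eappD (F : endo M) X Y : endo_app F (X + Y) = endo_app F X + endo_app F Y.
Proof. by apply: vfieldP => p; exact: endoD. Qed.

Lemma eappN (F : endo M) X : endo_app F (- X) = - endo_app F X.
Proof. by apply: vfieldP => p; exact: endoN. Qed.

Lemma eappZ (F : endo M) f X : endo_app F (f *: X) = f *: endo_app F X.
Proof. by apply: vfieldP => p; exact: endoZ. Qed.

Definition eappE := (eappD, eappN, eappZ).

Definition d1 a X Y : smooth_fun M :=
  X · oneform_app a Y - Y · oneform_app a X - oneform_app a (bracket X Y).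

(** The identity d(da) = 0 in invariant form: second derivatives combine into brackets, and the
    terms with double brackets vanish by the Jacobi identity. *)
Lemma d1_closed a X Y Z :
  X · d1 a Y Z + Y · d1 a Z X + Z · d1 a X Y
  = d1 a (bracket X Y) Z + d1 a (bracket Y Z) X + d1 a (bracket Z X) Y.
Proof.
have J : oneform_app a (bracket (bracket X Y) Z) =
   - (oneform_app a (bracket (bracket Y Z) X) + oneform_app a (bracket (bracket Z X) Y)).
  apply/eqP; rewrite -subr_eq0 opprK addrA -!oappD jacobi_bracket.
  by apply/eqP; apply: smooth_funP => p; exact: oneform0.
by rewrite /d1 J !vappE; ring.
Qed.

Definition vec2 {T : Type} (x y : T) : 'I_2 -> T := fun l => if val l is 0%N then x else y.

Lemma ext_d_oneform a X Y p : ext_d (fun q => form1 (a q)) (vec2 X Y) p = d1 a X Y p.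
Proof.
rewrite /ext_d !big_ord_recl !big_ord0 /= !big_mkcond !big_ord_recl !big_ord0 /=.
have -> : to_smooth (fun q => form1 (a q) (fun l => vec2 X Y (lift ord0 l) q)) =
    oneform_app a Y by rewrite -[RHS]to_smooth_val.
have -> : to_smooth (fun q => form1 (a q) (fun l => vec2 X Y (lift (lift ord0 ord0) l) q)) =
    oneform_app a X by rewrite -[RHS]to_smooth_val.
rewrite !(addr0, add0r, expr0, expr1, mul1r, mulN1r) /form1 /=.
rewrite big_mkcond !big_ord_recl big_ord0 /= !addr0 mulN1r.
by [].
Qed.

Lemma wedge2E {V : lmodType R} (a b : V -> R) (v : 'I_2 -> V) :
  wedge2 a b v = a (v 0) * b (v 1) - a (v 1) * b (v 0).
Proof.
rewrite /wedge2 /wedge !big_ord_recl big_ord0 /form1 /= addr0 expr0 expr1 mul1r mulN1r.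
have -> : lift ord0 ord0 = 1 :> 'I_2 by apply: val_inj.
have -> : lift 1 ord0 = 0 :> 'I_2 by apply: val_inj.
by rewrite mulNr.
Qed.

End OneFormCalculus.

Section ThreeContactFields.
Context {R : realType} {n : nat} {M : smooth_manifold R n}.
Variable S : almost_3_contact_metric M.
Implicit Types (f : smooth_fun M) (X Y Z : vfield M) (i j k : 'I_3).
Local Notation "X · f" := (vfield_app X f) (at level 34, right associativity).
Local Notation "⟨ X , Y ⟩" := (metric_app (a3_g S) X Y).
Local Notation ξ := (a3_xi S).
Local Notation H i := (oneform_app (a3_eta S i)).
Local Notation F i := (endo_app (a3_phi S i)).

Lemma F_sq i X : F i (F i X) = - X + H i X *: ξ i.
Proof. by apply: vfieldP => p; exact: phi_sq. Qed.

Lemma H_xi i : H i (ξ i) = 1.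
Proof. by apply: smooth_funP => p; exact: eta_xi. Qed.

Lemma F_xi i : F i (ξ i) = 0.
Proof. by apply: vfieldP => p; exact: phi_xi. Qed.

Lemma HE i X : ⟨ξ i, X⟩ = H i X.
Proof. by apply: smooth_funP => p; rewrite [RHS]etaE. Qed.

Lemma HE' i X : ⟨X, ξ i⟩ = H i X.
Proof. by rewrite mappC HE. Qed.

Lemma H_F i X : H i (F i X) = 0.
Proof. by apply: smooth_funP => p; exact: eta_phi. Qed.

Lemma F_skew i X Y : ⟨F i X, Y⟩ = - ⟨X, F i Y⟩.
Proof. by apply: smooth_funP => p; exact: phi_skew. Qed.

Lemma Phi_skew i X Y : ⟨Y, F i X⟩ = - ⟨X, F i Y⟩.
Proof. by rewrite mappC F_skew. Qed.

Section Cyclic.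
Variables (i j k : 'I_3) (C : cyc3 i j k).

Lemma F_comp_l X : F i (F j X) = F k X + H j X *: ξ i.
Proof. by apply: vfieldP => p; exact: phi_comp_l. Qed.

Lemma F_comp_r X : F j (F i X) = - F k X + H i X *: ξ j.
Proof. by apply: vfieldP => p; exact: phi_comp_r. Qed.

Lemma F_xi_l : F i (ξ j) = ξ k.
Proof. by apply: vfieldP => p; exact: phi_xi_l. Qed.

Lemma F_xi_r : F j (ξ i) = - ξ k.
Proof. by apply: vfieldP => p; exact: phi_xi_r. Qed.

Lemma H_F_l X : H i (F j X) = H k X.
Proof. by apply: smooth_funP => p; exact: eta_phi_l. Qed.

Lemma H_F_r X : H j (F i X) = - H k X.
Proof. by apply: smooth_funP => p; exact: eta_phi_r. Qed.

Lemma H_xi_l : H i (ξ j) = 0.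
Proof. by apply: smooth_funP => p; exact: (eta_xi_l S C). Qed.

Lemma H_xi_r : H j (ξ i) = 0.
Proof. by apply: smooth_funP => p; exact: (eta_xi_r S C). Qed.

End Cyclic.

Variables alpha delta : R.
Hypothesis hS : three_alpha_delta_sasaki S alpha delta.

Definition cst_fun (c : R) : smooth_fun M := c *: (1 : smooth_fun M).

Local Notation α := (cst_fun alpha).
Local Notation δ := (cst_fun delta).

Lemma cst_funE c p : cst_fun c p = c.
Proof. by rewrite -[LHS]/(c * 1) mulr1. Qed.

Lemma cst_funM c f p : (cst_fun c * f) p = c * f p.
Proof. by rewrite -[LHS]/(cst_fun c p * f p) cst_funE. Qed.

Lemma cst_fun_nat m : m%:R = cst_fun m%:R.
Proof.
by apply: smooth_funP => p; rewrite cst_funE; exact: (rmorph_nat (eval_at p)).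
Qed.

Lemma vapp_cst X c : X · cst_fun c = 0.
Proof.
have X1 : X · (1 : smooth_fun M) = 0.
  have := vappM X 1 1; rewrite !mul1r => /eqP.
  by rewrite -subr_eq subrr eq_sym => /eqP.
by rewrite vappZ X1 scaler0.
Qed.

Lemma vapp_nat X m : X · (m%:R : smooth_fun M) = 0.
Proof. by rewrite cst_fun_nat vapp_cst. Qed.

Lemma structure_equation i j k (C : cyc3 i j k) X Y :
  d1 (a3_eta S i) X Y = 2 * α * ⟨X, F i Y⟩ + 2 * (α - δ) * (H j X * H k Y - H j Y * H k X).
Proof.
case: C => -> -> _; apply: smooth_funP => p.
have [_ /(_ i (vec2 X Y) p)] := hS; rewrite ext_d_oneform => ->.
rewrite wedge2E /fundamental_form /=.
rewrite -[RHS]/(2 * α p * _ + 2 * (α p - δ p) * (_ - _)) !cst_funE.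
by [].
Qed.

Definition dPhi i X Y Z : smooth_fun M :=
  X · ⟨Y, F i Z⟩ + Y · ⟨Z, F i X⟩ + Z · ⟨X, F i Y⟩
  - ⟨bracket X Y, F i Z⟩ - ⟨bracket Y Z, F i X⟩ - ⟨bracket Z X, F i Y⟩.

Lemma cst_fun_inj c f : c != 0 -> cst_fun c * f = 0 -> f = 0.
Proof.
move=> c0 cf; apply: smooth_funP => p; apply: (mulfI c0).
by rewrite -cst_funM cf mulr0.
Qed.

(* d(d eta_i) = 0 gives d Phi_i, as alpha is invertible. *)
Lemma dPhiE i j k (C : cyc3 i j k) X Y Z : dPhi i X Y Z = 2 * (δ - α) *
  (⟨X, F j Y⟩ * H k Z + ⟨Y, F j Z⟩ * H k X + ⟨Z, F j X⟩ * H k Y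
   - H j Z * ⟨X, F k Y⟩ - H j X * ⟨Y, F k Z⟩ - H j Y * ⟨Z, F k X⟩).
Proof.
have C1 := cyc3_rot C; have C2 := cyc3_rot C1.
have := d1_closed (a3_eta S i) X Y Z.
rewrite !(structure_equation C) => e.
have hj U V : H j (bracket U V) = U · H j V - V · H j U
    - (2 * α * ⟨U, F j V⟩ + 2 * (α - δ) * (H k U * H i V - H k V * H i U)).
  by rewrite -(structure_equation C1) /d1; ring.
have hk U V : H k (bracket U V) = U · H k V - V · H k U
    - (2 * α * ⟨U, F k V⟩ + 2 * (α - δ) * (H i U * H j V - H i V * H j U)).
  by rewrite -(structure_equation C2) /d1; ring.
have [a0 _] := hS.
apply/eqP; rewrite -subr_eq0; apply/eqP.
apply: (@cst_fun_inj (2 * alpha)); first by rewrite mulf_neq0 // pnatr_eq0.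
have -> : cst_fun (2 * alpha) = 2 * α.
  by apply: smooth_funP => p; rewrite (cst_fun_nat 2) cst_funM !cst_funE.
move/eqP: e; rewrite -subr_eq0 => /eqP e; rewrite -[RHS]e.
rewrite !(vappE, vapp_cst, vapp_nat) !hj !hk /dPhi.
ring.
Qed.

Definition eta_wedge_Phi l X Y Z : smooth_fun M :=
  H l X * ⟨Y, F l Z⟩ + H l Y * ⟨Z, F l X⟩ + H l Z * ⟨X, F l Y⟩.

Definition eta_det i j k X Y Z : smooth_fun M :=
  H i X * (H j Y * H k Z - H j Z * H k Y) - H i Y * (H j X * H k Z - H j Z * H k X)
  + H i Z * (H j X * H k Y - H j Y * H k X).

Definition canonical_torsion X Y Z : smooth_fun M :=
  2 * α * (eta_wedge_Phi 0 X Y Z + eta_wedge_Phi 1 X Y Z + eta_wedge_Phi 2%:R X Y Z)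
  + 2 * (δ - α) * eta_det 0 1 2%:R X Y Z.

Local Notation T := canonical_torsion.

Lemma cyc3_ind (P : 'I_3 -> 'I_3 -> 'I_3 -> Prop) :
  P 0 1 2%:R -> P 1 2%:R 0 -> P 2%:R 0 1 -> forall i j k, cyc3 i j k -> P i j k.
Proof.
move=> P0 P1 P2 i j k [-> -> _]; move: i.
have o0 : ordS 0 = 1 :> 'I_3 by apply: val_inj.
have o1 : ordS 1 = 2%:R :> 'I_3 by apply: val_inj.
have o2 : ordS 2%:R = 0 :> 'I_3 by apply: val_inj.
by apply: ord3P; rewrite !(o0, o1, o2).
Qed.

Lemma canonical_torsionE i j k (C : cyc3 i j k) X Y Z : T X Y Z =
  2 * α * (eta_wedge_Phi i X Y Z + eta_wedge_Phi j X Y Z + eta_wedge_Phi k X Y Z)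
  + 2 * (δ - α) * eta_det i j k X Y Z.
Proof.
by move: i j k C; apply: cyc3_ind; rewrite /T /eta_det //; ring.
Qed.

Lemma canonical_torsion_lin f X Y Z W : T X Y (f *: Z + W) = f * T X Y Z + T X Y W.
Proof.
rewrite /T /eta_det /eta_wedge_Phi !(eappE, oappE, mappE); ring.
Qed.

Lemma canonical_torsion_skew12 X Y Z : T Y X Z = - T X Y Z.
Proof.
rewrite /T /eta_det /eta_wedge_Phi.
by rewrite !(Phi_skew _ X Y) !(Phi_skew _ Y Z) !(Phi_skew _ Z X); ring.
Qed.

Lemma canonical_torsion_skew23 X Y Z : T X Z Y = - T X Y Z.
Proof.
rewrite /T /eta_det /eta_wedge_Phi.
by rewrite !(Phi_skew _ X Y) !(Phi_skew _ Y Z) !(Phi_skew _ Z X); ring.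
Qed.

(** Besides Phi_i, contraction with xi_i picks up eta_jk once from eta_123 and, with a minus sign,
    once from each of eta_j ^ Phi_j and eta_k ^ Phi_k. This accounts for 2 (delta - alpha) - 4
    alpha. *)
Lemma canonical_torsion_xi i j k (C : cyc3 i j k) X Y : T X Y (ξ i) =
  2 * α * ⟨X, F i Y⟩ + (2 * δ - 6 * α) * (H j X * H k Y - H j Y * H k X).
Proof.
have C1 := cyc3_rot C; have C2 := cyc3_rot C1.
rewrite (canonical_torsionE C) /eta_det /eta_wedge_Phi.
have m0 U : ⟨U, 0⟩ = 0 by rewrite mappC; apply: smooth_funP => p; exact: metric0l.
rewrite F_xi (F_xi_l C2) (F_xi_r C) !(mappE, HE', HE) H_F (H_F_l C) (H_F_r C2).
by rewrite H_xi (H_xi_l C2) (H_xi_r C) m0; ring.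
Qed.

(** The way the torsion enters when d Phi_i is computed with the connection. The right-hand side is
    the same combination as in [dPhiE], so the two contributions can be merged. *)
Lemma canonical_torsion_F i j k (C : cyc3 i j k) X Y Z :
  T X Y (F i Z) + T Y Z (F i X) + T Z X (F i Y) =
  2 * α * (H k Z * ⟨X, F j Y⟩ + H k X * ⟨Y, F j Z⟩ + H k Y * ⟨Z, F j X⟩
   - H j Z * ⟨X, F k Y⟩ - H j X * ⟨Y, F k Z⟩ - H j Y * ⟨Z, F k X⟩).
Proof.
have C1 := cyc3_rot C; have C2 := cyc3_rot C1.
rewrite !(canonical_torsionE C) /eta_det /eta_wedge_Phi.
rewrite !(H_F, H_F_r C, H_F_l C2) !F_sq !(F_comp_r C) !(F_comp_l C2).
have sk l U V : ⟨F i U, F l V⟩ = - ⟨V, F l (F i U)⟩ by rewrite Phi_skew.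
rewrite !sk !F_sq !(F_comp_r C) !(F_comp_l C2) !(mappE, HE').
rewrite (mappC _ X Y) (mappC _ Y Z) (mappC _ Z X).
rewrite !(Phi_skew _ X Y) !(Phi_skew _ Y Z) !(Phi_skew _ Z X).
ring.
Qed.

End ThreeContactFields.

(** * Existence of the canonical connection *)

(** Stands in for linear arithmetic in the ring of smooth functions: an equation follows from a
    known one once [ring] identifies the differences of their sides. *)
Lemma eq_of_sub {V : zmodType} (x y a b : V) : a = b -> x - y = a - b -> x = y.
Proof. by move=> -> /eqP; rewrite subrr subr_eq0 => /eqP. Qed.

Section Existence.
Context {R : realType} {n : nat} {M : smooth_manifold R n}.
Variable S : almost_3_contact_metric M.
Implicit Types (f : smooth_fun M) (X Y Z : vfield M) (i j k : 'I_3).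
Local Notation "X · f" := (vfield_app X f) (at level 34, right associativity).
Local Notation "⟨ X , Y ⟩" := (metric_app (a3_g S) X Y).
Local Notation ξ := (a3_xi S).
Local Notation H i := (oneform_app (a3_eta S i)).
Local Notation F i := (endo_app (a3_phi S i)).
Variables alpha delta : R.
Hypothesis hS : three_alpha_delta_sasaki S alpha delta.
Local Notation α := (cst_fun alpha).
Local Notation δ := (cst_fun delta).
Local Notation β := (2 * (δ - 2 * α)).

(* A pair (X, f) stands for X plus f times the radial field of the metric cone,
   on which the three almost contact structures extend to an almost
   quaternionic structure. *)
Definition cone : zmodType := (vfield M * smooth_fun M)%type.
Implicit Types (u v w : cone).

Definition cone_metric u v : smooth_fun M := ⟨u.1, v.1⟩ + u.2 * v.2.
Definition cone_J i u : cone := (F i u.1 - u.2 *: ξ i, H i u.1).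

Local Notation "⟪ u , v ⟫" := (cone_metric u v).
Local Notation J := cone_J.

Lemma cone_metricC u v : ⟪v, u⟫ = ⟪u, v⟫.
Proof. by rewrite /cone_metric mappC mulrC. Qed.

Lemma cone_metricNl u v : ⟪- u, v⟫ = - ⟪u, v⟫.
Proof. by rewrite /cone_metric /= mappNl; ring. Qed.

Lemma cone_metricNr u v : ⟪u, - v⟫ = - ⟪u, v⟫.
Proof. by rewrite cone_metricC cone_metricNl cone_metricC. Qed.

Lemma cone_JJ i u : J i (J i u) = - u.
Proof.
case: u => X f; rewrite /cone_J /=; congr pair.
  by rewrite eappD eappN eappZ F_sq F_xi scaler0 subr0 addrK.
by rewrite oappD oappN oappZ H_F H_xi mulr1 sub0r.
Qed.

Lemma cone_JN i u : J i (- u) = - J i u.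
Proof. by rewrite -[in LHS](cone_JJ i u) cone_JJ. Qed.

Lemma cone_J_skew i u v : ⟪J i u, v⟫ = - ⟪u, J i v⟫.
Proof. by rewrite /cone_metric /= !mappE F_skew HE HE'; ring. Qed.

(** The terms eta_j (x) xi_i that spoil the quaternion relations on the tangent space are cancelled
    by the radial component. *)
Lemma cone_J_comp i j k (C : cyc3 i j k) u : J i (J j u) = J k u.
Proof.
case: u => X f; rewrite /cone_J /=; congr pair.
  rewrite eappD eappN eappZ (F_comp_l S C) (F_xi_l S C).
  by rewrite addrAC addrK.
by rewrite oappD oappN oappZ (H_F_l S C) (H_xi_l S C) mulr0 subr0.
Qed.

Lemma cone_J_anticomp i j k (C : cyc3 i j k) u : J j (J i u) = - J k u.
Proof.
by rewrite -(cone_J_comp (cyc3_rot C)) cone_JJ.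
Qed.

Variable D : connection M.
Hypothesis D_metric : metric_connection (a3_g S) D.
Hypothesis D_torsion : forall X Y Z,
  ⟨torsion D X Y, Z⟩ = canonical_torsion S alpha delta X Y Z.

Lemma conn_metric X Y Z : X · ⟨Y, Z⟩ = ⟨D X Y, Z⟩ + ⟨Y, D X Z⟩.
Proof. by apply: smooth_funP => p; exact: D_metric. Qed.

Lemma connN X Y : D X (- Y) = - D X Y.
Proof.
have D0 : D X 0 = 0.
  by have := conn_addr D X 0 0; rewrite addr0 => /eqP; rewrite -subr_eq subrr => /eqP.
apply/eqP; rewrite -subr_eq0 opprK -conn_addr addNr; exact/eqP.
Qed.

(** The product of [D] with the trivial connection in the radial component, instead of the
    Levi-Civita connection of the cone. Radial directions of differentiation contribute nothing,
    since [deviation] uses its first argument only through the tangential part. *)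
Definition cone_D X u : cone := (D X u.1, X · u.2).

Lemma cone_D_metric X u v : X · ⟪u, v⟫ = ⟪cone_D X u, v⟫ + ⟪u, cone_D X v⟫.
Proof. by rewrite /cone_metric !vappE conn_metric /=; ring. Qed.

Lemma cone_DN X u : cone_D X (- u) = - cone_D X u.
Proof. by rewrite /cone_D /= connN vappN. Qed.

(* The covariant derivative of the i-th structure, corrected so that the
   three corrected derivatives satisfy the Leibniz rule for J k = J i J j. *)
Definition deviation i j k w u v : smooth_fun M :=
  ⟪cone_D w.1 (J i u), v⟫ - ⟪J i (cone_D w.1 u), v⟫
  - β * (H k w.1 * ⟪J j u, v⟫ - H j w.1 * ⟪J k u, v⟫).

Section Deviation.
Variables (i j k : 'I_3) (C : cyc3 i j k).

Lemma deviationN w u v : deviation i j k w (- u) v = - deviation i j k w u v.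
Proof. by rewrite /deviation !(cone_JN, cone_DN, cone_metricNl); ring. Qed.

Lemma deviation_skew w u v : deviation i j k w v u = - deviation i j k w u v.
Proof.
have e1 := cone_D_metric w.1 (J i u) v; have e2 := cone_D_metric w.1 (J i v) u.
have e : ⟪cone_D w.1 (J i v), u⟫ = - ⟪cone_D w.1 (J i u), v⟫
    - ⟪J i u, cone_D w.1 v⟫ - ⟪J i v, cone_D w.1 u⟫.
  have s : ⟪J i v, u⟫ = - ⟪J i u, v⟫ by rewrite cone_J_skew cone_metricC.
  by move: e2; rewrite s vappN e1 => e2; apply: (eq_of_sub (esym e2)); ring.
rewrite /deviation e !(cone_J_skew _ (cone_D _ _)) !(cone_metricC (cone_D _ _)).
rewrite !(cone_J_skew _ v) !(cone_metricC _ v).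
ring.
Qed.

Lemma deviation_J w u v : deviation i j k w (J i u) v = deviation i j k w u (J i v).
Proof.
have C2 := cyc3_rot (cyc3_rot C).
rewrite /deviation cone_JJ cone_DN cone_metricNl (cone_J_anticomp C) (cone_J_comp C2).
rewrite !(cone_J_skew i) cone_metricNl.
have -> : ⟪J j u, J i v⟫ = - ⟪J k u, v⟫.
  by rewrite -(cone_J_comp C) (cone_J_skew i (J j u)) opprK.
have -> : ⟪J k u, J i v⟫ = ⟪J j u, v⟫.
  by rewrite -[RHS]opprK -cone_metricNl -(cone_J_anticomp C2) (cone_J_skew i (J k u)) opprK.
rewrite cone_JJ cone_metricNr; ring.
Qed.

Lemma deviation_comp w u v :
  deviation k i j w u v = deviation i j k w (J j u) v - deviation j k i w u (J i v).
Proof.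
have C1 := cyc3_rot C; have C2 := cyc3_rot C1.
rewrite /deviation (cone_J_comp C) !cone_JJ (cone_J_anticomp C1).
have s1 x : ⟪x, J i v⟫ = - ⟪J i x, v⟫ by rewrite cone_J_skew opprK.
rewrite !s1 cone_JJ (cone_J_comp C) (cone_J_anticomp C2).
rewrite !cone_metricNl; ring.
Qed.

Lemma dual_xi X Y : ⟨D X (ξ i), Y⟩ = X · H i Y - H i (D X Y).
Proof. by have := conn_metric X (ξ i) Y; rewrite !HE => ->; rewrite addrK. Qed.

Lemma bracket_conn X Y : bracket X Y = D X Y - D Y X - torsion D X Y.
Proof. by rewrite /torsion opprB addrCA subrr addr0. Qed.

(** The failure of xi_i to be a Killing-type field for D is its torsion minus d eta_i. The Phi_i
    terms cancel and the coefficients of eta_jk leave (2 delta - 6 alpha) - 2 (alpha - delta) = 2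
    beta. *)
Lemma dual_xi_alt X Y : ⟨D Y (ξ i), X⟩ = ⟨D X (ξ i), Y⟩
  + 2 * β * (H j X * H k Y - H j Y * H k X).
Proof.
rewrite !dual_xi.
have := structure_equation hS C X Y.
have := D_torsion X Y (ξ i); rewrite HE' (canonical_torsion_xi _ _ _ C) /d1 bracket_conn.
move: (torsion D X Y) => t tE; rewrite !oappE tE => e.
by apply: (eq_of_sub (esym e)); ring.
Qed.

Definition cov_F X Y Z : smooth_fun M := ⟨D X (F i Y), Z⟩ - ⟨F i (D X Y), Z⟩.

(** Rewriting brackets through the torsion turns the cyclic sum into the sum of
    [canonical_torsion_F] minus d Phi_i. The coefficients 2 alpha and 2 (delta - alpha) thus combine
    to minus beta; skewness of the phi_j and phi_k restores the sign. *)
Lemma cov_F_cyc X Y Z : cov_F X Y Z + cov_F Y Z X + cov_F Z X Y =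
  β * (H k X * ⟨F j Y, Z⟩ - H j X * ⟨F k Y, Z⟩ + H k Y * ⟨F j Z, X⟩ - H j Y * ⟨F k Z, X⟩
    + H k Z * ⟨F j X, Y⟩ - H j Z * ⟨F k X, Y⟩).
Proof.
have E U V W : cov_F U V W = ⟨D U V, F i W⟩ - U · ⟨V, F i W⟩ - ⟨D U W, F i V⟩.
  have e := conn_metric U (F i V) W; rewrite F_skew vappN (mappC _ (D U W)) in e.
  by rewrite /cov_F (F_skew _ _ (D U V)); apply: (eq_of_sub (esym e)); ring.
rewrite !E !(F_skew S j) !(F_skew S k).
have tor U V W : ⟨D U V, W⟩ - ⟨D V U, W⟩ = ⟨bracket U V, W⟩ + canonical_torsion S alpha delta U V W.
  by rewrite -D_torsion bracket_conn; move: (torsion D U V) => t; rewrite !mappE; ring.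
have e1 := tor X Y (F i Z); have e2 := tor Y Z (F i X); have e3 := tor Z X (F i Y).
have d := dPhiE hS C X Y Z; have t := canonical_torsion_F S alpha delta C X Y Z.
apply: (eq_of_sub (f_equal2 +%R (f_equal2 +%R e1 e2) (f_equal2 +%R e3 (f_equal2 +%R (esym d) t)))).
rewrite /dPhi; ring.
Qed.

(** The corrected fundamental form of the cone is closed. Its purely tangential part is [cov_F_cyc];
    the parts containing a radial component are three instances of [dual_xi_alt]. *)
Lemma deviation_cyc u v w :
  deviation i j k u v w + deviation i j k v w u + deviation i j k w u v = 0.
Proof.
case: u v w => [X s] [Y f] [Z h].
have dE X' s' Y' f' Z' h' : deviation i j k (X', s') (Y', f') (Z', h') =
   cov_F X' Y' Z' - f' * ⟨D X' (ξ i), Z'⟩ + h' * ⟨D X' (ξ i), Y'⟩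
   - β * (H k X' * (⟨F j Y', Z'⟩ - f' * H j Z' + h' * H j Y')
        - H j X' * (⟨F k Y', Z'⟩ - f' * H k Z' + h' * H k Y')).
  rewrite (dual_xi X' Y') /deviation /cone_metric /cone_D /cone_J /cov_F /=.
  rewrite conn_addr connN conn_leibniz !(mappE, HE).
  ring.
rewrite !dE (dual_xi_alt X Y) (dual_xi_alt Y Z) (dual_xi_alt Z X).
have c := cov_F_cyc X Y Z.
apply: (eq_of_sub c); ring.
Qed.

End Deviation.

Lemma deviation_eq0 i j k (C : cyc3 i j k) u v w : deviation i j k u v w = 0.
Proof.
have C1 := cyc3_rot C; have C2 := cyc3_rot C1.
apply: smooth_funP => p.
(* Hitchin's argument divides by 2 and cancels linearly, so it runs on values at [p] in the real
   field, not on functions. *)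
pose a i j k x y z : R := eval_at p (deviation i j k x y z).
have aN i' j' k' x y z : a i' j' k' x (- y) z = - a i' j' k' x y z.
  by rewrite /a deviationN rmorphN.
have a_skew i' j' k' x y z : a i' j' k' x z y = - a i' j' k' x y z.
  by rewrite /a deviation_skew rmorphN.
have a_cyc i' j' k' (C' : cyc3 i' j' k') x y z :
    a i' j' k' x y z + a i' j' k' y z x + a i' j' k' z x y = 0.
  by rewrite /a -!rmorphD (deviation_cyc C') rmorph0.
apply: (@hitchin_vanish R cone (J i) (J j) (a i j k) (a j k i) (a k i j)).
- exact: cone_JJ.
- exact: cone_JJ.
- by move=> x; rewrite (cone_J_anticomp C) (cone_J_comp C).
- exact: aN.
- exact: aN.
- exact: a_skew.
- exact: a_skew.
- exact: a_skew.
- by move=> x y z; rewrite /a (deviation_J C).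
- by move=> x y z; rewrite /a (deviation_comp C) rmorphB.
- exact: a_cyc.
- exact: a_cyc.
- exact: a_cyc.
Qed.

Lemma connection_cov_endo i j k (C : cyc3 i j k) X Y :
  cov_endo D (a3_phi S i) X Y = β *: (H k X *: F j Y - H j X *: F k Y).
Proof.
apply: mapp_inj => Z.
have := deviation_eq0 C (X, 0) (Y, 0) (Z, 0).
rewrite /deviation /cone_metric /cone_D /cone_J /cov_endo /= => e.
have v0 : X · (0 : smooth_fun M) = 0.
  by have := vappZ X 0 0; rewrite !scale0r.
rewrite !scale0r !subr0 v0 scale0r subr0 in e.
by rewrite !mappE; apply: (eq_of_sub e); ring.
Qed.

End Existence.

(** * The canonical 3-form *)

Section FormsOfLowDegree.
Context {R : realType} {n : nat} {M : smooth_manifold R n}.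

(** Adjacent transpositions carry linearity from the first slot to the others and, 2 being
    invertible, give vanishing on repeated arguments. *)
Lemma is_form3 (w : forall p : M, tangent p -> tangent p -> tangent p -> R) :
  (forall p a (x y u v : tangent p), w p (a *: x + y) u v = a * w p x u v + w p y u v) ->
  (forall p (x y z : tangent p), w p y x z = - w p x y z) ->
  (forall p (x y z : tangent p), w p x z y = - w p x y z) ->
  (forall X Y Z : vfield M, smooth (fun p => w p (X p) (Y p) (Z p))) ->
  is_form (fun p (v : 'I_3 -> tangent p) => w p (v 0) (v 1) (v 2%:R)).
Proof.
move=> wl w12 w23 ws; split; last by move=> X; exact: ws.
  have l2 p a (x y u v : tangent p) : w p u (a *: x + y) v = a * w p u x v + w p u y v.
    by rewrite w12 wl (w12 p x u) (w12 p y u); ring.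
  have l3 p a (x y u v : tangent p) : w p u v (a *: x + y) = a * w p u v x + w p u v y.
    by rewrite w23 l2 (w23 p u x v) (w23 p u y v); ring.
  move=> p v i a x y; move: i.
  by apply: ord3P; [exact: wl|exact: l2|exact: l3].
have w0 p (x y : tangent p) : w p x x y = 0.
  by have := w12 p x x y; lra.
have w0' p (x y : tangent p) : w p x y y = 0.
  by have := w23 p x y y; lra.
have w0'' p (x y : tangent p) : w p x y x = 0 by rewrite w12 w0' oppr0.
move=> p v i j; move: i j.
by apply: ord3P; apply: ord3P => // _ e; rewrite ?e ?w0 ?w0' ?w0'' //; rewrite -?e ?w0 ?w0' ?w0''.
Qed.

Lemma ord4P (P : 'I_4 -> Prop) : P 0 -> P 1 -> P 2%:R -> P 3%:R -> forall i, P i.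
Proof.
move=> P0 P1 P2 P3 [[|[|[|[|//]]]] Hi].
- by have -> : Ordinal Hi = 0 by apply: val_inj.
- by have -> : Ordinal Hi = 1 by apply: val_inj.
- by have -> : Ordinal Hi = 2%:R by apply: val_inj.
- by have -> : Ordinal Hi = 3%:R by apply: val_inj.
Qed.

Lemma is_form4 (w : forall p : M, tangent p -> tangent p -> tangent p -> tangent p -> R) :
  (forall p a (x y u v z : tangent p),
     w p (a *: x + y) u v z = a * w p x u v z + w p y u v z) ->
  (forall p (x y z u : tangent p), w p y x z u = - w p x y z u) ->
  (forall p (x y z u : tangent p), w p x z y u = - w p x y z u) ->
  (forall p (x y z u : tangent p), w p x y u z = - w p x y z u) ->
  (forall X Y Z W : vfield M, smooth (fun p => w p (X p) (Y p) (Z p) (W p))) ->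
  is_form (fun p (v : 'I_4 -> tangent p) => w p (v 0) (v 1) (v 2%:R) (v 3%:R)).
Proof.
move=> wl w12 w23 w34 ws; split; last by move=> X; exact: ws.
  have l2 p a (x y u v z : tangent p) : w p u (a *: x + y) v z = a * w p u x v z + w p u y v z.
    by rewrite w12 wl (w12 p x u) (w12 p y u); ring.
  have l3 p a (x y u v z : tangent p) : w p u v (a *: x + y) z = a * w p u v x z + w p u v y z.
    by rewrite w23 l2 (w23 p u x v) (w23 p u y v); ring.
  have l4 p a (x y u v z : tangent p) : w p u v z (a *: x + y) = a * w p u v z x + w p u v z y.
    by rewrite w34 l3 (w34 p u v x z) (w34 p u v y z); ring.
  move=> p v i a x y; move: i.
  by apply: ord4P; [exact: wl|exact: l2|exact: l3|exact: l4].
have w1 p (x y z : tangent p) : w p x x y z = 0 by have := w12 p x x y z; lra.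
have w2 p (x y z : tangent p) : w p x y y z = 0 by have := w23 p x y y z; lra.
have w3 p (x y z : tangent p) : w p x y z z = 0 by have := w34 p x y z z; lra.
have w4 p (x y z : tangent p) : w p x y x z = 0 by rewrite w12 w2 oppr0.
have w5 p (x y z : tangent p) : w p x y z y = 0 by rewrite w23 w3 oppr0.
have w6 p (x y z : tangent p) : w p x y z x = 0 by rewrite w12 w5 oppr0.
move=> p v i j; move: i j.
apply: ord4P; apply: ord4P => // _ e; rewrite ?e ?w1 ?w2 ?w3 ?w4 ?w5 ?w6 //;
  by rewrite -?e ?w1 ?w2 ?w3 ?w4 ?w5 ?w6.
Qed.

Lemma wedge_deg3E {V : lmodType R} (a : V -> R) (w : ('I_2 -> V) -> R) (v : 'I_3 -> V) :
  wedge a w v = a (v 0) * w (vec2 (v 1) (v 2%:R)) - a (v 1) * w (vec2 (v 0) (v 2%:R))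
    + a (v 2%:R) * w (vec2 (v 0) (v 1)).
Proof.
have E (i : 'I_3) x y : v (lift i 0) = x -> v (lift i 1) = y ->
    (fun l => v (lift i l)) = vec2 x y.
  move=> <- <-; apply/funext => -[[|[|//]] Hl] /=; congr (v (lift i _)); exact: val_inj.
rewrite /wedge !big_ord_recl big_ord0 /= addr0 addrA expr0 expr1 sqrrN expr1n !mul1r mulN1r.
have o1 : lift ord0 ord0 = 1 :> 'I_3 by apply: val_inj.
have o2 : lift ord0 (lift ord0 ord0) = 2%:R :> 'I_3 by apply: val_inj.
rewrite o1 o2 mulNr; congr (_ * w _ - _ * w _ + _ * w _); apply: E;
  by congr v; apply: val_inj.
Qed.

Lemma wedge3E {V : lmodType R} (a b c : V -> R) (v : 'I_3 -> V) : wedge3 a b c v =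
  a (v 0) * (b (v 1) * c (v 2%:R) - b (v 2%:R) * c (v 1))
  - a (v 1) * (b (v 0) * c (v 2%:R) - b (v 2%:R) * c (v 0))
  + a (v 2%:R) * (b (v 0) * c (v 1) - b (v 1) * c (v 0)).
Proof. by rewrite /wedge3 wedge_deg3E !wedge2E. Qed.

End FormsOfLowDegree.

Section CanonicalForm.
Context {R : realType} {n : nat} {M : smooth_manifold R n}.
Variable S : almost_3_contact_metric M.
Local Notation φ := (a3_phi S).
Local Notation η := (a3_eta S).
Local Notation g := (a3_g S).
Implicit Types (p : M) (i j k l : 'I_3).

Definition eta_Phi_at l p (u v w : tangent p) : R :=
  η l p u * g p v (φ l p w) + η l p v * g p w (φ l p u) + η l p w * g p u (φ l p v).

Definition eta_det_at i j k p (u v w : tangent p) : R :=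
  η i p u * (η j p v * η k p w - η j p w * η k p v)
  - η i p v * (η j p u * η k p w - η j p w * η k p u)
  + η i p w * (η j p u * η k p v - η j p v * η k p u).

(** The two-parameter family spanned by the sum of eta_i ^ Phi_i and eta_123. It contains both omega
    and the canonical torsion, whose smoothness and alternation are thus shown together. *)
Definition three_form (a b : R) p (u v w : tangent p) : R :=
  a * (eta_Phi_at 0 u v w + eta_Phi_at 1 u v w + eta_Phi_at 2%:R u v w)
  + b * eta_det_at 0 1 2%:R u v w.

Lemma three_form_app a b (X Y Z : vfield M) p : three_form a b (X p) (Y p) (Z p) =
  (cst_fun a * (eta_wedge_Phi S 0 X Y Z + eta_wedge_Phi S 1 X Y Z + eta_wedge_Phi S 2%:R X Y Z)
  + cst_fun b * eta_det S 0 1 2%:R X Y Z) p.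
Proof. by rewrite -[RHS]/((cst_fun a * _) p + (cst_fun b * _) p) !cst_funM. Qed.

Lemma metric_phi_skew i p (u v : tangent p) : g p v (φ i p u) = - g p u (φ i p v).
Proof. by rewrite metric_sym phi_skew. Qed.

Lemma three_form_is_form a b :
  is_form (fun p (v : 'I_3 -> tangent p) => three_form a b (v 0) (v 1) (v 2%:R)).
Proof.
apply: is_form3.
- move=> p c x y u v; rewrite /three_form /eta_Phi_at /eta_det_at.
  by rewrite !(oneformD, oneformZ, endoD, endoZ, metricE); ring.
- move=> p x y z; rewrite /three_form /eta_Phi_at /eta_det_at.
  by rewrite !(metric_phi_skew _ x y) !(metric_phi_skew _ y z) !(metric_phi_skew _ z x); ring.
- move=> p x y z; rewrite /three_form /eta_Phi_at /eta_det_at.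
  by rewrite !(metric_phi_skew _ x y) !(metric_phi_skew _ y z) !(metric_phi_skew _ z x); ring.
- move=> X Y Z; apply: smooth_divide => p.
  exists 1, (cst_fun a * (eta_wedge_Phi S 0 X Y Z + eta_wedge_Phi S 1 X Y Z
      + eta_wedge_Phi S 2%:R X Y Z) + cst_fun b * eta_det S 0 1 2%:R X Y Z).
  split; first exact: oner_neq0.
  by move=> q; rewrite -three_form_app; exact: mul1r.
Qed.

(** The coefficient 4 is 1 from eta_123 itself plus 3 from the horizontal corrections, as each eta_i
    ^ eta_jk equals eta_123. *)
Lemma canonical_3formE p (v : 'I_3 -> tangent p) :
  canonical_3form S p v = three_form 1 4 (v 0) (v 1) (v 2%:R).
Proof.
rewrite /canonical_3form -[LHS]/((\sum_(i < 3) _) v + _) fct_sumE wedge3E.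
rewrite !big_ord_recl big_ord0 !wedge_deg3E.
have o1 : lift ord0 ord0 = 1 :> 'I_3 by apply: val_inj.
have o2 : lift ord0 (lift ord0 ord0) = 2%:R :> 'I_3 by apply: val_inj.
have s0 : ordS 0 = 1 :> 'I_3 by apply: val_inj.
have s1 : ordS 1 = 2%:R :> 'I_3 by apply: val_inj.
have s2 : ordS 2%:R = 0 :> 'I_3 by apply: val_inj.
have o0 : ord0 = 0 :> 'I_3 by apply: val_inj.
rewrite o1 o2 o0 /horizontal_form !(s0, s1, s2).
have hE i j k (x y : tangent p) : (fundamental_form S i p + wedge2 (η j p) (η k p)) (vec2 x y)
    = g p x (φ i p y) + (η j p x * η k p y - η j p y * η k p x).
  by rewrite -[LHS]/(fundamental_form S i p (vec2 x y) + _) wedge2E.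
rewrite !hE /three_form /eta_Phi_at /eta_det_at.
by rewrite !(metric_phi_skew _ (v 0) (v 2%:R)); ring.
Qed.

End CanonicalForm.

(** * The structure tensors under the canonical connection *)

Section CanonicalConnection.
Context {R : realType} {n : nat} {M : smooth_manifold R n}.
Variable S : almost_3_contact_metric M.
Implicit Types (f : smooth_fun M) (X Y Z : vfield M) (i j k : 'I_3).
Local Notation "X · f" := (vfield_app X f) (at level 34, right associativity).
Local Notation "⟨ X , Y ⟩" := (metric_app (a3_g S) X Y).
Local Notation ξ := (a3_xi S).
Local Notation H i := (oneform_app (a3_eta S i)).
Local Notation F i := (endo_app (a3_phi S i)).
Variables alpha delta : R.
Local Notation β := (cst_fun (2 * (delta - 2 * alpha))).

Lemma canonical_connection_exists : three_alpha_delta_sasaki S alpha delta ->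
  exists D : connection M, canonical_connection S alpha delta D.
Proof.
move=> hS.
have [D [Dm Dt]] := metric_connection_with_torsion (a3_g S)
  (canonical_torsion_lin S alpha delta) (canonical_torsion_skew12 S alpha delta)
  (canonical_torsion_skew23 S alpha delta).
exists D; split=> //.
  exists (fun p v => three_form S (2 * alpha) (2 * (delta - alpha)) (v 0) (v 1) (v 2%:R)).
    exact: three_form_is_form.
  move=> X p; rewrite three_form_app -[LHS]/(metric_app (a3_g S) _ _ p) Dt.
  congr (smooth_val _ p); rewrite /canonical_torsion.
  have cM (a b : R) : cst_fun (a * b) = cst_fun a * cst_fun b :> smooth_fun M.
    by apply: smooth_funP => q; rewrite cst_funM !cst_funE.
  have cB (a b : R) : cst_fun (a - b) = cst_fun a - cst_fun b :> smooth_fun M.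
    by rewrite /cst_fun scalerBl.
  by rewrite !cM cB -!cst_fun_nat.
move=> i j k X Y p.
rewrite (connection_cov_endo hS Dm Dt (cyc3P i)).
rewrite -[LHS]/((2 * (cst_fun delta p - 2 * cst_fun alpha p)) *: _) !cst_funE.
by [].
Qed.

Variable D : connection M.
Hypothesis hD : canonical_connection S alpha delta D.

Let D_metric : metric_connection (a3_g S) D. Proof. by case: hD. Qed.

Lemma canonical_cov_endo i j k (C : cyc3 i j k) X Y :
  D X (F i Y) = F i (D X Y) + β *: (H k X *: F j Y - H j X *: F k Y).
Proof.
have [_ _ cov] := hD; case: C => -> -> _.
apply: vfieldP => p; have := cov i X Y p.
rewrite /cov_endo -[LHS]/(D X (F i Y) p - F i (D X Y) p) => /eqP.
rewrite subr_eq addrC => /eqP ->.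
by rewrite -[RHS]/(F i (D X Y) p + β p *: _) cst_funE.
Qed.

Let D0 X : D X 0 = 0.
Proof. by have := conn_addr D X 0 0; rewrite addr0 => /eqP; rewrite -subr_eq subrr => /eqP. Qed.

Let D_app X Y Z : X · ⟨Y, Z⟩ = ⟨D X Y, Z⟩ + ⟨Y, D X Z⟩.
Proof. by apply: smooth_funP => p; exact: D_metric. Qed.

(** Differentiating phi_i xi_i = 0 determines phi_i(D_X xi_i). Applying phi_i once more recovers D_X
    xi_i, since it is orthogonal to the unit field xi_i. *)
Lemma canonical_xi i j k (C : cyc3 i j k) X :
  D X (ξ i) = β *: (H k X *: ξ j - H j X *: ξ k).
Proof.
have C2 := cyc3_rot (cyc3_rot C).
have Hx : H i (D X (ξ i)) = 0.
  have := D_app X (ξ i) (ξ i); have v1 : X · 1 = 0 := vapp_nat X 1.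
  rewrite !HE' !HE H_xi v1 => e.
  apply: (@cst_fun_inj _ _ _ 2); first by rewrite pnatr_eq0.
  by rewrite -cst_fun_nat; apply: (eq_of_sub (esym e)); ring.
have := congr1 (F i) (canonical_cov_endo C X (ξ i)).
rewrite F_xi D0 (F_xi_r S C) (F_xi_l S C2) !(eappD, eappN, eappZ) F_sq Hx scale0r addr0.
rewrite (F_xi_r S C2) (F_xi_l S C) => /eqP.
have -> : F i 0 = 0 by apply: vfieldP => p; exact: endo0.
rewrite eq_sym addrC subr_eq0 => /eqP <-.
by rewrite opprK.
Qed.

Lemma canonical_eta i j k (C : cyc3 i j k) X Y :
  X · H i Y = H i (D X Y) + β * (H k X * H j Y - H j X * H k Y).
Proof.
by rewrite -!(HE S i) D_app (canonical_xi C) !mappE !HE; ring.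
Qed.

Lemma canonical_Phi i j k (C : cyc3 i j k) X Y Z : X · ⟨Y, F i Z⟩ =
  ⟨D X Y, F i Z⟩ + ⟨Y, F i (D X Z)⟩ + β * (H k X * ⟨Y, F j Z⟩ - H j X * ⟨Y, F k Z⟩).
Proof. by rewrite D_app (canonical_cov_endo C) !mappE; ring. Qed.

Definition canonical_3form_app X Y Z : smooth_fun M :=
  eta_wedge_Phi S 0 X Y Z + eta_wedge_Phi S 1 X Y Z + eta_wedge_Phi S 2%:R X Y Z
  + cst_fun 4 * eta_det S 0 1 2%:R X Y Z.

Local Notation W := canonical_3form_app.

(** The covariant derivative acts on the triples eta and Phi by one and the same infinitesimal
    rotation, proportional to beta. Both the sum of eta_i ^ Phi_i and eta_123 are invariant under
    simultaneous rotations, so the beta terms cancel. *)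
Lemma canonical_parallel_app X Y Z U :
  X · W Y Z U = W (D X Y) Z U + W Y (D X Z) U + W Y Z (D X U).
Proof.
have C := cyc3_012; have C1 := cyc3_rot C; have C2 := cyc3_rot C1.
rewrite /W /eta_wedge_Phi /eta_det !(vappE, vapp_cst).
rewrite !(canonical_eta C, canonical_eta C1, canonical_eta C2).
rewrite !(canonical_Phi C, canonical_Phi C1, canonical_Phi C2).
ring.
Qed.

Lemma canonical_characteristic :
  characteristic_connection (a3_g S) (canonical_3form S) D.
Proof.
have [Dm Ds _] := hD; split=> // X Y p.
rewrite /cov_form.
have wE (Z : 'I_3 -> vfield M) q : canonical_3form S q (fun l => Z l q) =
    (W (Z 0) (Z 1) (Z 2%:R)) q.
  rewrite canonical_3formE three_form_app.
  have c1 : cst_fun 1 = 1 :> smooth_fun M by rewrite /cst_fun scale1r.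
  by rewrite c1 mul1r /W.
have -> : to_smooth (fun q => canonical_3form S q (fun l => Y l q)) = W (Y 0) (Y 1) (Y 2%:R).
  by rewrite -[RHS]to_smooth_val; congr to_smooth; apply/funext => q; exact: wE.
rewrite -[X p _]/((X · W (Y 0) (Y 1) (Y 2%:R)) p) canonical_parallel_app.
rewrite !big_ord_recl big_ord0 !wE.
have o0 : ord0 = 0 :> 'I_3 by apply: val_inj.
have o1 : lift ord0 ord0 = 1 :> 'I_3 by apply: val_inj.
have o2 : lift ord0 (lift ord0 ord0) = 2%:R :> 'I_3 by apply: val_inj.
rewrite o1 o2 o0 addr0.
apply/eqP; rewrite subr_eq0; apply/eqP.
rewrite -[LHS]/(W (D X (Y 0)) (Y 1) (Y 2%:R) p + W (Y 0) (D X (Y 1)) (Y 2%:R) p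
  + W (Y 0) (Y 1) (D X (Y 2%:R)) p) -addrA.
exact: erefl.
Qed.

End CanonicalConnection.

(** * Comparison of connections with skew torsion *)

Section ConnectionDifference.
Context {R : realType} {n : nat} {M : smooth_manifold R n}.
Variable g : riemannian_metric M.
Implicit Types (X Y Z : vfield M) (D : connection M).

Lemma connection_ext D D' : (forall X Y, D X Y = D' X Y) -> D = D'.
Proof.
case: D D' => [D l a e] [D' l' a' e'] /= DD.
have E : D = D' by apply/funext => X; apply/funext => Y; exact: DD.
by rewrite {}E in l a e *; congr Connection; exact: Prop_irrelevance.
Qed.

Definition alternating3 (p : M) (t : tangent p -> tangent p -> tangent p -> R) : Prop :=
  [/\ forall a (x y u v : tangent p), t (a *: x + y) u v = a * t x u v + t y u v,
      forall x y z, t y x z = - t x y z & forall x y z, t x z y = - t x y z].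

Definition vec3 {T : Type} (x y z : T) : 'I_3 -> T :=
  fun l => match val l with 0%N => x | 1%N => y | _ => z end.

Lemma form3_alternating (p : M) (w : form_field M 3) : is_form w ->
  alternating3 (fun x y z : tangent p => w p (vec3 x y z)).
Proof.
case=> ml alt _.
have e0 (x y z u : tangent p) : ([eta (vec3 x y z) with 0 |-> u] : 'I_3 -> tangent p) = vec3 u y z.
  by apply/funext; apply: ord3P.
have e1 (x y z u : tangent p) : ([eta (vec3 x y z) with 1 |-> u] : 'I_3 -> tangent p) = vec3 x u z.
  by apply/funext; apply: ord3P.
have e2 (x y z u : tangent p) : ([eta (vec3 x y z) with 2%:R |-> u] : 'I_3 -> tangent p) =
    vec3 x y u.
  by apply/funext; apply: ord3P.
pose t (x y z : tangent p) := w p (vec3 x y z).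
have l0 a (x y u v : tangent p) : t (a *: x + y) u v = a * t x u v + t y u v.
  by have := ml p (vec3 x u v) 0 a x y; rewrite !e0.
have l1 a (x y u v : tangent p) : t u (a *: x + y) v = a * t u x v + t u y v.
  by have := ml p (vec3 u x v) 1 a x y; rewrite !e1.
have l2 a (x y u v : tangent p) : t u v (a *: x + y) = a * t u v x + t u v y.
  by have := ml p (vec3 u v x) 2%:R a x y; rewrite !e2.
have a0 (x z : tangent p) : t x x z = 0 by apply: (alt p _ 0 1).
have a1 (x z : tangent p) : t x z z = 0 by apply: (alt p _ 1 2%:R).
split=> [//|x y z|x y z].
  have := a0 (1 *: x + y) z; rewrite l0 !l1 !a0 -!/(t _ _ _); lra.
have := a1 x (1 *: y + z); rewrite l1 !l2 !a1 -!/(t _ _ _); lra.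
Qed.

(** The difference is skew in its last two arguments because both connections are metric, and its
    alternation in the first two is the difference of the torsions. The permutation trick behind
    Koszul's formula then gives half that difference. *)
Lemma connection_difference D D' :
  metric_connection g D -> skew_torsion g D -> metric_connection g D' -> skew_torsion g D' ->
  forall p, exists2 t, alternating3 (p := p) t &
    forall X Y Z, g p (D X Y p - D' X Y p) (Z p) = t (X p) (Y p) (Z p).
Proof.
move=> Dm [w wf wE] Dm' [w' wf' wE'] p.
pose t0 (x y z : tangent p) := w p (vec3 x y z).
pose t0' (x y z : tangent p) := w' p (vec3 x y z).
have [tl t12 t23] : alternating3 t0 := form3_alternating p wf.
have [tl' t12' t23'] : alternating3 t0' := form3_alternating p wf'.
exists (fun x y z => 2^-1 * (t0 x y z - t0' x y z)).
  split=> [a x y u v|x y z|x y z].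
  - by rewrite tl tl'; ring.
  - by rewrite t12 t12'; ring.
  - by rewrite t23 t23'; ring.
pose s X Y Z := g p (D X Y p - D' X Y p) (Z p).
have s23 X Y Z : s X Z Y = - s X Y Z.
  have := Dm X Y Z p; rewrite Dm' /s !metricBl !(metric_sym g (Y p)); lra.
have tw X Y Z : g p (torsion D X Y p) (Z p) = t0 (X p) (Y p) (Z p).
  have := wE (vec3 X Y Z) p; rewrite {1 2 3}/vec3 /= => ->.
  by congr (w p _); apply/funext; apply: ord3P.
have tw' X Y Z : g p (torsion D' X Y p) (Z p) = t0' (X p) (Y p) (Z p).
  have := wE' (vec3 X Y Z) p; rewrite {1 2 3}/vec3 /= => ->.
  by congr (w' p _); apply/funext; apply: ord3P.
have s12 X Y Z : s X Y Z - s Y X Z = t0 (X p) (Y p) (Z p) - t0' (X p) (Y p) (Z p).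
  rewrite -tw -tw' /s -[torsion D X Y p]/(D X Y p - D Y X p - bracket X Y p).
  rewrite -[torsion D' X Y p]/(D' X Y p - D' Y X p - bracket X Y p) !metricBl; ring.
move=> X Y Z; rewrite -/(s X Y Z).
have e1 := s12 X Y Z; have e2 := s12 Y Z X; have e3 := s12 Z X Y.
have f1 := s23 X Y Z; have f2 := s23 Y Z X; have f3 := s23 Z X Y.
have h1 := t12 (Y p) (Z p) (X p); have h2 := t23 (Y p) (X p) (Z p).
have h3 := t12 (X p) (Y p) (Z p); have h4 := t23 (Z p) (X p) (Y p).
have h5 := t12 (Z p) (Y p) (X p).
have h6 := t23 (X p) (Y p) (Z p); have h7 := t12 (X p) (Z p) (Y p).
have h1' := t12' (Y p) (Z p) (X p); have h2' := t23' (Y p) (X p) (Z p).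
have h3' := t12' (X p) (Y p) (Z p); have h4' := t23' (Z p) (X p) (Y p).
have h5' := t12' (Z p) (Y p) (X p).
have h6' := t23' (X p) (Y p) (Z p); have h7' := t12' (X p) (Z p) (Y p).
lra.
Qed.

End ConnectionDifference.

(** * Adapted frames and the G2-structure *)

Section OrthonormalFrames.
Context {R : realType} {n : nat} {M : smooth_manifold R n}.
Variable g : riemannian_metric M.

Lemma orthonormal_basis_of p (e : 'I_n -> tangent p) :
  (forall i j, g p (e i) (e j) = (i == j)%:R) -> orthonormal_basis g e.
Proof.
move=> on; split=> //; apply: (gram_spanning (g := g)).
suff -> : gram g e = 1%:M by exact: unitmx1.
by apply/matrixP => i j; rewrite !mxE on.
Qed.

Lemma frame_expansion m p (e : 'I_m -> tangent p) (v : tangent p) :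
  orthonormal_basis g e -> v = \sum_i g p (e i) v *: e i.
Proof.
move=> [on sp]; have [c vE] := sp v.
rewrite [LHS]vE; apply: eq_bigr => i _; congr (_ *: _).
rewrite vE metric_sumr (bigD1 i) //= metricZr on eqxx mulr1 big1 ?addr0 // => j ij.
by rewrite metricZr on eq_sym (negbTE ij) mulr0.
Qed.

Lemma parseval m p (e : 'I_m -> tangent p) (u v : tangent p) :
  orthonormal_basis g e -> g p u v = \sum_i g p (e i) u * g p (e i) v.
Proof.
move=> eb; rewrite {1}(frame_expansion u eb) metric_suml.
by apply: eq_bigr => i _; rewrite metricZl.
Qed.

Lemma exists_unit_orthogonal p m (x : 'I_m -> tangent p) : (m < n)%N ->
  exists u : tangent p, g p u u = 1 /\ forall l, g p u (x l) = 0.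
Proof.
move=> mn; have [E [th [Eth _]]] := tangent_frame p.
pose A : 'M[R]_(n, m) := \matrix_(i, l) g p (E i p) (x l).
have [v v0 vA] : exists2 v : 'rV[R]_n, v != 0 & v *m A = 0.
  have k0 : kermx A != 0.
    rewrite -mxrank_eq0 mxrank_ker subn_eq0 -ltnNge.
    exact: leq_ltn_trans (rank_leq_col A) mn.
  exists (nz_row (kermx A)); first by rewrite nz_row_eq0.
  by apply/sub_kermxP; exact: nz_row_sub.
pose u := \sum_i v ord0 i *: E i p.
have ux l : g p u (x l) = 0.
  rewrite metric_suml; have /rowP/(_ l) := vA; rewrite !mxE => e; rewrite -[RHS]e.
  by apply: eq_bigr => i _; rewrite metricZl mxE.
have u0 : u != 0.
  apply: contra_neq v0 => u0; apply/rowP => j; rewrite mxE.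
  have <- : u (th j) = v ord0 j.
    rewrite tangent_sum (bigD1 j) //= -[(_ *: _) (th j)]/(v ord0 j * E j p (th j)) Eth eqxx.
    rewrite mulr1 big1 ?addr0 // => i ij.
    by rewrite -[LHS]/(v ord0 i * E i p (th j)) Eth (negbTE ij) mulr0.
  by rewrite u0.
have gu : 0 < g p u u := metric_pos g u0.
have s0 : Num.sqrt (g p u u) != 0 by rewrite sqrtr_eq0 -ltNge.
exists ((Num.sqrt (g p u u))^-1 *: u); split=> [|l]; last by rewrite metricZl ux mulr0.
rewrite metricZl metricZr mulrA -{3}(sqr_sqrtr (ltW gu)).
by field.
Qed.

End OrthonormalFrames.

Lemma ord7P (P : 'I_7 -> Prop) : (forall m, (m < 7)%N -> P (inord m)) -> forall i, P i.
Proof. by move=> H i; rewrite -(inord_val i); exact: H. Qed.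

Section G2Coordinates.
Context {R : realType}.
Implicit Types x y z w : nat -> R.

Definition minor3 x y z a b c : R :=
  x a * (y b * z c - y c * z b) - y a * (x b * z c - x c * z b)
  + z a * (x b * y c - x c * y b).
Arguments minor3 x y z (a b c)%_nat_scope.

(* Coordinates are numbered from 1, as in [coframe3]. *)
Definition g2_poly x y z : R :=
  minor3 x y z 1 2 3 + minor3 x y z 1 4 5 + minor3 x y z 1 6 7 + minor3 x y z 2 4 6
  - minor3 x y z 2 5 7 - minor3 x y z 3 4 7 - minor3 x y z 3 5 6.

Context {n : nat} {M : smooth_manifold R n} (g : riemannian_metric M).

Definition coords p (e : 'I_7 -> tangent p) (v : tangent p) (a : nat) : R :=
  g p (e (inord a.-1)) v.

Lemma coframe3E p (e : 'I_7 -> tangent p) a b c (v : 'I_3 -> tangent p) :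
  coframe3 g e a b c v =
  minor3 (coords e (v 0)) (coords e (v 1)) (coords e (v 2%:R)) a b c.
Proof. by rewrite /coframe3 wedge3E /minor3 /coords; ring. Qed.

Lemma g2_modelE p (e : 'I_7 -> tangent p) (v : 'I_3 -> tangent p) :
  g2_model g e v = g2_poly (coords e (v 0)) (coords e (v 1)) (coords e (v 2%:R)).
Proof. by rewrite /g2_poly -!coframe3E. Qed.

Lemma coords_frame p (e : 'I_7 -> tangent p) a b : orthonormal_basis g e ->
  (a < 7)%N -> (b < 7)%N -> coords e (e (inord b)) a.+1 = (a == b)%:R.
Proof.
by move=> [on _] a7 b7; rewrite /coords on -(inj_eq val_inj) /= !inordK.
Qed.

End G2Coordinates.

Section AdaptedFrame.
Context {R : realType} {M : smooth_manifold R 7}.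
Variable S : almost_3_contact_metric M.
Local Notation φ := (a3_phi S).
Local Notation ξ := (a3_xi S).
Local Notation η := (a3_eta S).
Local Notation g := (a3_g S).
Variables (p : M) (u : tangent p).
Hypotheses (u1 : g p u u = 1) (uxi : forall i, g p u (ξ i p) = 0).

Let eta_u i : η i p u = 0. Proof. by rewrite etaE metric_sym. Qed.

Lemma eta_phi_orth i l : η i p (φ l p u) = 0.
Proof.
have C := cyc3_012; have C1 := cyc3_rot C; have C2 := cyc3_rot C1.
move: i l; apply: ord3P; apply: ord3P; rewrite ?eta_phi //;
  by rewrite ?(eta_phi_l S C, eta_phi_l S C1, eta_phi_l S C2, eta_phi_r S C,
    eta_phi_r S C1, eta_phi_r S C2) eta_u ?oppr0.
Qed.

Lemma eta_xiE i j : η i p (ξ j p) = (i == j)%:R.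
Proof.
have C := cyc3_012; have C1 := cyc3_rot C; have C2 := cyc3_rot C1.
by move: i j; apply: ord3P; apply: ord3P; rewrite ?eta_xi // ?(eta_xi_l S C, eta_xi_l S C1,
  eta_xi_l S C2, eta_xi_r S C, eta_xi_r S C1, eta_xi_r S C2).
Qed.

Lemma metric_u_phi i : g p u (φ i p u) = 0.
Proof. by have := metric_phi_skew S i u u; lra. Qed.

Lemma metric_phi_phi_orth i j : g p (φ i p u) (φ j p u) = (i == j)%:R.
Proof.
have C := cyc3_012; have C1 := cyc3_rot C; have C2 := cyc3_rot C1.
have d l : g p (φ l p u) (φ l p u) = 1 by rewrite metric_phi_phi u1 eta_u mulr0 subr0.
have o l m k : cyc3 l m k -> g p (φ l p u) (φ m p u) = 0.
  move=> Q; rewrite metric_sym -[LHS]opprK -metric_phi_skew (phi_comp_l S Q) eta_u scale0r.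
  by rewrite addr0 metric_u_phi oppr0.
have o' l m k : cyc3 l m k -> g p (φ m p u) (φ l p u) = 0.
  by move=> Q; rewrite metric_sym (o _ _ _ Q).
by move: i j; apply: ord3P; apply: ord3P;
  rewrite ?d ?(o _ _ _ C, o _ _ _ C1, o _ _ _ C2, o' _ _ _ C, o' _ _ _ C1, o' _ _ _ C2).
Qed.

Lemma adapted_frame_basis : orthonormal_basis g (adapted_frame S u).
Proof.
apply: orthonormal_basis_of => i j.
have gx l (v : tangent p) : g p (ξ l p) v = η l p v by rewrite -etaE.
have gx' l (v : tangent p) : g p v (ξ l p) = η l p v by rewrite metric_sym -etaE.
have gpu l : g p (φ l p u) u = 0 by rewrite metric_sym metric_u_phi.
case: i => [[|[|[|[|[|[|[|//]]]]]]] Hi]; case: j => [[|[|[|[|[|[|[|//]]]]]]] Hj];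
  by rewrite /adapted_frame /tnth /= ?gx ?gx' ?eta_xiE ?eta_u ?eta_phi_orth
     ?metric_phi_phi_orth ?metric_u_phi ?gpu ?u1.
Qed.

End AdaptedFrame.

Section AdaptedCoordinates.
Context {R : realType} {M : smooth_manifold R 7}.
Variable S : almost_3_contact_metric M.
Local Notation φ := (a3_phi S).
Local Notation ξ := (a3_xi S).
Local Notation η := (a3_eta S).
Local Notation g := (a3_g S).
Variables (p : M) (u : tangent p).
Hypotheses (u1 : g p u u = 1) (uxi : forall i, g p u (ξ i p) = 0).

Lemma coords_adapted_frame (v : tangent p) :
  let x := coords g (adapted_frame S u) v in
  [/\ x 1%N = η 0 p v, x 2%N = η 1 p v & x 3%N = η 2%:R p v] /\
  [/\ x 4%N = g p u v, x 5%N = g p (φ 0 p u) v, x 6%N = g p (φ 1 p u) v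
    & x 7%N = g p (φ 2%:R p u) v].
Proof.
rewrite /coords /adapted_frame !(tnth_nth 0) !inordK //= !etaE.
by split.
Qed.

Lemma metric_adapted_frame i j k (C : cyc3 i j k) (v w : tangent p) :
  g p v w = η i p v * η i p w + η j p v * η j p w + η k p v * η k p w
   + g p u v * g p u w + g p (φ i p u) v * g p (φ i p u) w
   + g p (φ j p u) v * g p (φ j p u) w + g p (φ k p u) v * g p (φ k p u) w.
Proof.
rewrite (parseval _ _ (adapted_frame_basis u1 uxi)) !big_ord_recl big_ord0 /adapted_frame.
rewrite !(tnth_nth 0) /= -!etaE.
by move: i j k C; apply: cyc3_ind; ring.
Qed.

Lemma metric_phi_adapted_frame i j k (C : cyc3 i j k) (v w : tangent p) :
  g p v (φ i p w) = - (η j p v * η k p w - η k p v * η j p w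
   + g p u v * g p (φ i p u) w - g p (φ i p u) v * g p u w
   + g p (φ j p u) v * g p (φ k p u) w - g p (φ k p u) v * g p (φ j p u) w).
Proof.
have C1 := cyc3_rot C; have C2 := cyc3_rot C1.
have eta_u l : η l p u = 0 by rewrite etaE metric_sym.
rewrite (metric_adapted_frame C) eta_phi (eta_phi_r S C) (eta_phi_l S C2).
rewrite !(metric_phi_skew S i w) (phi_comp_l S C) (phi_comp_r S C2) phi_sq !eta_u !scale0r !addr0.
rewrite !metricNr !(metric_sym g w); ring.
Qed.

Lemma canonical_3form_adapted_frame : let eta := coframe3 g (adapted_frame S u) in
  canonical_3form S p = - eta 1%N 4%N 5%N - eta 1%N 6%N 7%N - eta 2%N 4%N 6%N
    + eta 2%N 5%N 7%N - eta 3%N 4%N 7%N - eta 3%N 5%N 6%N + eta 1%N 2%N 3%N.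
Proof.
move=> eta; apply/funext => v.
rewrite canonical_3formE -[RHS]/(- eta 1%N 4%N 5%N v - eta 1%N 6%N 7%N v - eta 2%N 4%N 6%N v
  + eta 2%N 5%N 7%N v - eta 3%N 4%N 7%N v - eta 3%N 5%N 6%N v + eta 1%N 2%N 3%N v) /eta !coframe3E.
have [[x1 x2 x3] [x4 x5 x6 x7]] := coords_adapted_frame (v 0).
have [[y1 y2 y3] [y4 y5 y6 y7]] := coords_adapted_frame (v 1).
have [[z1 z2 z3] [z4 z5 z6 z7]] := coords_adapted_frame (v 2%:R).
rewrite /minor3 x1 x2 x3 x4 x5 x6 x7 y1 y2 y3 y4 y5 y6 y7 z1 z2 z3 z4 z5 z6 z7.
have C := cyc3_012; have C1 := cyc3_rot C; have C2 := cyc3_rot C1.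
rewrite /three_form /eta_Phi_at /eta_det_at.
rewrite !(metric_phi_adapted_frame C, metric_phi_adapted_frame C1, metric_phi_adapted_frame C2).
ring.
Qed.

(* The adapted frame with [xi_1] and [xi_2] reversed, which brings the form to
   the normal form of [g2_model]. *)
Definition normal_frame : 'I_7 -> tangent p := fun i =>
  (if (i < 2)%N then - 1 else 1) *: adapted_frame S u i.

Lemma coords_normal_frame (v : tangent p) a : coords g normal_frame v a =
  (if ((inord a.-1 : 'I_7) < 2)%N then - 1 else 1) * coords g (adapted_frame S u) v a.
Proof. by rewrite /coords /normal_frame metricZl. Qed.

Lemma g2_frame_normal_frame : g2_frame g (canonical_3form S) normal_frame.
Proof.
split.
  have [on _] := adapted_frame_basis u1 uxi.
  apply: orthonormal_basis_of => i j; rewrite /normal_frame metricZl metricZr on.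
  have [<-|ij] := eqVneq i j; last by rewrite !mulr0.
  by case: ifP => _; ring.
rewrite canonical_3form_adapted_frame; apply/funext => v.
rewrite g2_modelE /g2_poly /minor3 !coords_normal_frame !inordK //=.
set eta := coframe3 g _.
rewrite -[LHS]/(- eta 1%N 4%N 5%N v - eta 1%N 6%N 7%N v - eta 2%N 4%N 6%N v
  + eta 2%N 5%N 7%N v - eta 3%N 4%N 7%N v - eta 3%N 5%N 6%N v + eta 1%N 2%N 3%N v).
rewrite /eta !coframe3E /minor3.
ring.
Qed.

End AdaptedCoordinates.

Section G2Structure.
Context {R : realType} {M : smooth_manifold R 7}.
Variable S : almost_3_contact_metric M.

Lemma exists_unit_horizontal (p : M) : exists u : tangent p,
  a3_g S p u u = 1 /\ forall i, a3_g S p u (a3_xi S i p) = 0.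
Proof. exact: (exists_unit_orthogonal (a3_g S) (fun i => a3_xi S i p)). Qed.

Lemma canonical_3form_is_form : is_form (canonical_3form S).
Proof.
have -> : canonical_3form S =
    fun p (v : 'I_3 -> tangent p) => three_form S 1 4 (v 0) (v 1) (v 2%:R).
  by apply: functional_extensionality_dep => p; apply/funext => v; exact: canonical_3formE.
exact: three_form_is_form.
Qed.

Lemma canonical_g2_structure : g2_structure (a3_g S) (canonical_3form S).
Proof.
split=> [|p]; first exact: canonical_3form_is_form.
have [u [u1 ux]] := exists_unit_horizontal p; exists (normal_frame S u).
exact: g2_frame_normal_frame.
Qed.

End G2Structure.

(** * Uniqueness of the characteristic connection *)

Section G2Prolongation.
Context {R : realType}.
Variable t : nat -> nat -> nat -> R.
Arguments t (_ _ _)%_nat_scope.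
Hypotheses (t12 : forall a b c, t b a c = - t a b c) (t23 : forall a b c, t a c b = - t a b c).

Definition delta_coords (b : nat) : nat -> R := fun a => (a == b)%:R.
Arguments delta_coords b%_nat_scope.

(* Each [t n] annihilates the model form, i.e. lies in the Lie algebra g2. *)
Hypothesis t_g2 : forall n b c d,
  (0 < n < 8)%N -> (0 < b < 8)%N -> (0 < c < 8)%N -> (0 < d < 8)%N ->
  g2_poly (t n b) (delta_coords c) (delta_coords d)
  + g2_poly (delta_coords b) (t n c) (delta_coords d)
  + g2_poly (delta_coords b) (delta_coords c) (t n d) = 0.

Arguments t_g2 {n} (b c d)%_nat_scope.
Arguments t12 (a b c)%_nat_scope.
Arguments t23 a (b c)%_nat_scope.

Let rot a b c : t c a b = t a b c. Proof. by rewrite t12 t23 opprK. Qed.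
Let z12 a c : t a a c = 0. Proof. by have := t12 a a c; lra. Qed.
Let z13 a b : t a b a = 0. Proof. by rewrite t23 z12 oppr0. Qed.

(** As so(7) is g2 plus a copy of R^7, seven linear equations cut out g2. The m-th one is the
    contraction of the model form, with e_m in one slot, against the 2-form [t n]; a single
    component of [t_g2] suffices for each. *)
Let t_g2_contracted n : (0 < n < 8)%N ->
  [/\ t n 2 3 + t n 4 5 + t n 6 7 = 0, - t n 1 3 + t n 4 6 - t n 5 7 = 0,
      t n 1 2 - t n 4 7 - t n 5 6 = 0
    & - t n 1 5 - t n 2 6 + t n 3 7 = 0] /\
  [/\ t n 1 4 + t n 2 7 + t n 3 6 = 0, - t n 1 7 + t n 2 4 - t n 3 5 = 0
    & t n 1 6 - t n 2 5 - t n 3 4 = 0].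
Proof.
move=> n8.
have z b : t n b b = 0 by have := t23 n b b; lra.
have s := (t23 n 1 2, t23 n 1 3, t23 n 1 4, t23 n 1 5, t23 n 1 6, t23 n 1 7, t23 n 2 3,
  t23 n 2 4, t23 n 2 5, t23 n 2 6, t23 n 2 7, t23 n 3 4, t23 n 3 5, t23 n 3 6, t23 n 3 7,
  t23 n 4 5, t23 n 4 6, t23 n 4 7, t23 n 5 6, t23 n 5 7, t23 n 6 7).
by split; split;
  [have := t_g2 2 4 7 n8 isT isT isT; rewrite /g2_poly /minor3 /delta_coords /= !s; lra
  |have := t_g2 1 4 7 n8 isT isT isT; rewrite /g2_poly /minor3 /delta_coords /= !s; lra
  |have := t_g2 1 4 6 n8 isT isT isT; rewrite /g2_poly /minor3 /delta_coords /= !s; lra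
  |have := t_g2 1 2 7 n8 isT isT isT; rewrite /g2_poly /minor3 /delta_coords /= !s; lra
  |have := t_g2 1 2 6 n8 isT isT isT; rewrite /g2_poly /minor3 /delta_coords /= !s; lra
  |have := t_g2 1 2 5 n8 isT isT isT; rewrite /g2_poly /minor3 /delta_coords /= !s; lra
  |have := t_g2 1 2 4 n8 isT isT isT; rewrite /g2_poly /minor3 /delta_coords /= !s; lra].
Qed.

(* Written out, the equations couple the 35 components in one group of seven,
   those of the monomials of [g2_poly], and seven groups of four. *)
Lemma g2_prolongation_zero a b c :
  (0 < a < 8)%N -> (0 < b < 8)%N -> (0 < c < 8)%N -> t a b c = 0.
Proof.
(* The n-th equation for [t n] involves only the three monomials containing n. Up to signs of the
   unknowns this is the incidence matrix of the Fano plane, which is invertible over the reals. *)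
have [[c123 c145 c167 c246] [c257 c347 c356]] : [/\ t 1 2 3 = 0, t 1 4 5 = 0,
  t 1 6 7 = 0 & t 2 4 6 = 0] /\
    [/\ t 2 5 7 = 0, t 3 4 7 = 0 & t 3 5 6 = 0].
  have [[k1 _ _ _] [_ _ _]] := t_g2_contracted (n := 1%N) isT; move: k1.
  have [[_ k2 _ _] [_ _ _]] := t_g2_contracted (n := 2%N) isT; move: k2.
  have [[_ _ k3 _] [_ _ _]] := t_g2_contracted (n := 3%N) isT; move: k3.
  have [[_ _ _ k4] [_ _ _]] := t_g2_contracted (n := 4%N) isT; move: k4.
  have [[_ _ _ _] [k5 _ _]] := t_g2_contracted (n := 5%N) isT; move: k5.
  have [[_ _ _ _] [_ k6 _]] := t_g2_contracted (n := 6%N) isT; move: k6.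
  have [[_ _ _ _] [_ _ k7]] := t_g2_contracted (n := 7%N) isT; move: k7.
  rewrite !(t12 1 2 3, rot 1 2 3, t12 1 4 5, t12 2 4 6, t12 3 4 7, rot 1 4 5, t12 2 5 7,
    t12 3 5 6, t12 1 6 7, rot 2 4 6, rot 3 5 6, rot 1 6 7, rot 2 5 7, rot 3 4 7).
  by clear; split; split; lra.
(* Each group of four belongs to a point q of the Fano plane, here q = 7 and then 6, 5, ..., 1. Its
   equations are the m-th ones for [t n] with m, n, q the three points of a line. *)
have [c124 c135 c236 c456] : [/\ t 1 2 4 = 0, t 1 3 5 = 0, t 2 3 6 = 0
    & t 4 5 6 = 0].
  have [[k1 _ _ _] [_ _ _]] := t_g2_contracted (n := 6%N) isT; move: k1.
  have [[_ k2 _ _] [_ _ _]] := t_g2_contracted (n := 5%N) isT; move: k2.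
  have [[_ _ k3 _] [_ _ _]] := t_g2_contracted (n := 4%N) isT; move: k3.
  have [[_ _ _ k4] [_ _ _]] := t_g2_contracted (n := 3%N) isT; move: k4.
  have [[_ _ _ _] [k5 _ _]] := t_g2_contracted (n := 2%N) isT; move: k5.
  have [[_ _ _ _] [_ k6 _]] := t_g2_contracted (n := 1%N) isT; move: k6.
  rewrite !(rot 2 3 6, rot 4 5 6, z12 6 7, rot 1 3 5, t12 4 5 6, z12 5 7, rot 1 2 4, z12 4 7,
    t12 1 3 5, t12 2 3 6, z12 3 7, t12 1 2 4, z12 2 7, z12 1 7).
  by clear; split; lra.
have [c125 c134 c237 c457] : [/\ t 1 2 5 = 0, t 1 3 4 = 0, t 2 3 7 = 0
    & t 4 5 7 = 0].
  have [[k1 _ _ _] [_ _ _]] := t_g2_contracted (n := 7%N) isT; move: k1.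
  have [[_ k2 _ _] [_ _ _]] := t_g2_contracted (n := 4%N) isT; move: k2.
  have [[_ _ k3 _] [_ _ _]] := t_g2_contracted (n := 5%N) isT; move: k3.
  have [[_ _ _ k4] [_ _ _]] := t_g2_contracted (n := 2%N) isT; move: k4.
  have [[_ _ _ _] [k5 _ _]] := t_g2_contracted (n := 3%N) isT; move: k5.
  have [[_ _ _ _] [_ _ k7]] := t_g2_contracted (n := 1%N) isT; move: k7.
  rewrite !(rot 2 3 7, rot 4 5 7, z13 7 6, rot 1 3 4, z12 4 6, rot 1 2 5, t12 4 5 7, z12 5 6,
    t12 1 2 5, z12 2 6, t12 1 3 4, t12 2 3 7, z12 3 6, z12 1 6).
  by clear; split; lra.
have [c126 c137 c234 c467] : [/\ t 1 2 6 = 0, t 1 3 7 = 0, t 2 3 4 = 0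
    & t 4 6 7 = 0].
  have [[k1 _ _ _] [_ _ _]] := t_g2_contracted (n := 4%N) isT; move: k1.
  have [[_ k2 _ _] [_ _ _]] := t_g2_contracted (n := 7%N) isT; move: k2.
  have [[_ _ k3 _] [_ _ _]] := t_g2_contracted (n := 6%N) isT; move: k3.
  have [[_ _ _ k4] [_ _ _]] := t_g2_contracted (n := 1%N) isT; move: k4.
  have [[_ _ _ _] [_ k6 _]] := t_g2_contracted (n := 3%N) isT; move: k6.
  have [[_ _ _ _] [_ _ k7]] := t_g2_contracted (n := 2%N) isT; move: k7.
  rewrite !(rot 2 3 4, z12 4 5, rot 1 3 7, rot 4 6 7, z13 7 5, rot 1 2 6, t12 4 6 7, z13 6 5,
    z12 1 5, t12 1 3 7, t12 2 3 4, z12 3 5, t12 1 2 6, z12 2 5).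
  by clear; split; lra.
have [c127 c136 c235 c567] : [/\ t 1 2 7 = 0, t 1 3 6 = 0, t 2 3 5 = 0
    & t 5 6 7 = 0].
  have [[k1 _ _ _] [_ _ _]] := t_g2_contracted (n := 5%N) isT; move: k1.
  have [[_ k2 _ _] [_ _ _]] := t_g2_contracted (n := 6%N) isT; move: k2.
  have [[_ _ k3 _] [_ _ _]] := t_g2_contracted (n := 7%N) isT; move: k3.
  have [[_ _ _ _] [k5 _ _]] := t_g2_contracted (n := 1%N) isT; move: k5.
  have [[_ _ _ _] [_ k6 _]] := t_g2_contracted (n := 2%N) isT; move: k6.
  have [[_ _ _ _] [_ _ k7]] := t_g2_contracted (n := 3%N) isT; move: k7.
  rewrite !(rot 2 3 5, z13 5 4, rot 1 3 6, z13 6 4, t12 5 6 7, rot 1 2 7, z13 7 4, rot 5 6 7,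
    z12 1 4, t12 1 2 7, z12 2 4, t12 1 3 6, t12 2 3 5, z12 3 4).
  by clear; split; lra.
have [c146 c157 c245 c267] : [/\ t 1 4 6 = 0, t 1 5 7 = 0, t 2 4 5 = 0
    & t 2 6 7 = 0].
  have [[k1 _ _ _] [_ _ _]] := t_g2_contracted (n := 2%N) isT; move: k1.
  have [[_ k2 _ _] [_ _ _]] := t_g2_contracted (n := 1%N) isT; move: k2.
  have [[_ _ _ k4] [_ _ _]] := t_g2_contracted (n := 7%N) isT; move: k4.
  have [[_ _ _ _] [k5 _ _]] := t_g2_contracted (n := 6%N) isT; move: k5.
  have [[_ _ _ _] [_ k6 _]] := t_g2_contracted (n := 5%N) isT; move: k6.
  have [[_ _ _ _] [_ _ k7]] := t_g2_contracted (n := 4%N) isT; move: k7.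
  rewrite !(z12 2 3, z12 1 3, rot 1 5 7, rot 2 6 7, z13 7 3, rot 1 4 6, t12 2 6 7, z13 6 3,
    t12 1 5 7, rot 2 4 5, z13 5 3, t12 1 4 6, t12 2 4 5, z13 4 3).
  by clear; split; lra.
have [c147 c156 c345 c367] : [/\ t 1 4 7 = 0, t 1 5 6 = 0, t 3 4 5 = 0
    & t 3 6 7 = 0].
  have [[k1 _ _ _] [_ _ _]] := t_g2_contracted (n := 3%N) isT; move: k1.
  have [[_ _ k3 _] [_ _ _]] := t_g2_contracted (n := 1%N) isT; move: k3.
  have [[_ _ _ k4] [_ _ _]] := t_g2_contracted (n := 6%N) isT; move: k4.
  have [[_ _ _ _] [k5 _ _]] := t_g2_contracted (n := 7%N) isT; move: k5.
  have [[_ _ _ _] [_ k6 _]] := t_g2_contracted (n := 4%N) isT; move: k6.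
  have [[_ _ _ _] [_ _ k7]] := t_g2_contracted (n := 5%N) isT; move: k7.
  rewrite !(z13 3 2, z12 1 2, rot 1 5 6, z13 6 2, t12 3 6 7, rot 1 4 7, z13 7 2, rot 3 6 7,
    t12 1 4 7, z13 4 2, t12 3 4 5, t12 1 5 6, z13 5 2, rot 3 4 5).
  by clear; split; lra.
have [c247 c256 c346 c357] : [/\ t 2 4 7 = 0, t 2 5 6 = 0, t 3 4 6 = 0
    & t 3 5 7 = 0].
  have [[_ k2 _ _] [_ _ _]] := t_g2_contracted (n := 3%N) isT; move: k2.
  have [[_ _ k3 _] [_ _ _]] := t_g2_contracted (n := 2%N) isT; move: k3.
  have [[_ _ _ k4] [_ _ _]] := t_g2_contracted (n := 5%N) isT; move: k4.
  have [[_ _ _ _] [k5 _ _]] := t_g2_contracted (n := 4%N) isT; move: k5.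
  have [[_ _ _ _] [_ k6 _]] := t_g2_contracted (n := 7%N) isT; move: k6.
  have [[_ _ _ _] [_ _ k7]] := t_g2_contracted (n := 6%N) isT; move: k7.
  rewrite !(z13 3 1, z13 2 1, z13 5 1, t12 2 5 6, t12 3 5 7, z13 4 1, t12 2 4 7, t12 3 4 6,
    z13 7 1, rot 2 4 7, rot 3 5 7, z13 6 1, rot 2 5 6, rot 3 4 6).
  by clear; split; lra.
have lt a' b' c' : (0 < a')%N -> (a' < b')%N -> (b' < c')%N -> (c' < 8)%N -> t a' b' c' = 0.
  by case: c' => [|[|[|[|[|[|[|[|//]]]]]]]]; case: b' => [|[|[|[|[|[|[|//]]]]]]];
    case: a' => [|[|[|[|[|[|//]]]]]].
have lt' a' b' c' : (0 < a')%N -> (0 < b')%N -> (a' < c')%N -> (b' < c')%N -> (c' < 8)%N ->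
    t a' b' c' = 0.
  move=> a0 b0 ac bc c8; case: (ltngtP a' b') => [ab|ba|->]; last exact: z12.
    exact: lt.
  by rewrite t12 lt ?oppr0.
move=> /andP[a0 a8] /andP[b0 b8] /andP[c0 c8].
case: (ltngtP a c) => [ac|ca|->]; last exact: z13; case: (ltngtP b c) => [bc|cb|->].
- exact: lt'.
- by rewrite t23 lt' ?oppr0 // (ltn_trans ac).
- by have := t23 a c c; lra.
- by rewrite rot lt' // (ltn_trans bc).
- case: (ltngtP a b) => [ab|ba|->]; last exact: z12; first by rewrite t23 lt' ?oppr0.
  by rewrite rot lt'.
- by have := t23 a c c; lra.
Qed.

End G2Prolongation.

Section CharacteristicUniqueness.
Context {R : realType} {M : smooth_manifold R 7}.
Variable g : riemannian_metric M.
Implicit Types (w : form_field M 3) (D : connection M).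

Lemma parallel_form_difference w D D' p (X : vfield M) (Y : 'I_3 -> vfield M) :
  is_form w -> parallel_form D w -> parallel_form D' w ->
  let a (Z : vfield M) := D X Z p - D' X Z p in
  w p (vec3 (a (Y 0)) (Y 1 p) (Y 2%:R p)) + w p (vec3 (Y 0 p) (a (Y 1)) (Y 2%:R p))
  + w p (vec3 (Y 0 p) (Y 1 p) (a (Y 2%:R))) = 0.
Proof.
move=> wf Dw Dw' a; have [l1 s12 s23] := form3_alternating p wf.
pose W (x y z : tangent p) := w p (vec3 x y z).
rewrite -!/(W _ _ _).
have lin (x x' y z : tangent p) : W (x - x') y z = W x y z - W x' y z.
  by have := l1 (- 1) x' x y z; rewrite scaleN1r addrC => e; rewrite /W e; ring.
have e (E : connection M) : (forall Y, cov_form E w X Y p = 0) ->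
    X p (to_smooth (fun q => w q (fun l => Y l q))) = W (E X (Y 0) p) (Y 1 p) (Y 2%:R p)
    + W (Y 0 p) (E X (Y 1) p) (Y 2%:R p) + W (Y 0 p) (Y 1 p) (E X (Y 2%:R) p).
  move=> /(_ Y)/eqP; rewrite /cov_form subr_eq0 => /eqP ->.
  rewrite !big_ord_recl big_ord0 addr0 addrA.
  have o0 : ord0 = 0 :> 'I_3 by apply: val_inj.
  have o1 : lift ord0 ord0 = 1 :> 'I_3 by apply: val_inj.
  have o2 : lift ord0 (lift ord0 ord0) = 2%:R :> 'I_3 by apply: val_inj.
  by rewrite o1 o2 o0; congr (w p _ + w p _ + w p _); apply/funext; apply: ord3P.
have := e _ (fun Z => Dw X Z p); rewrite (e _ (fun Z => Dw' X Z p)) => E.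
have s x y z : W y x z = - W x y z := s12 x y z.
have s' x y z : W x z y = - W x y z := s23 x y z.
have lin2 (x x' y z : tangent p) : W y (x - x') z = W y x z - W y x' z.
  by rewrite !(s _ y) lin; ring.
have lin3 (x x' y z : tangent p) : W y z (x - x') = W y z x - W y z x'.
  by rewrite !(s' y _ z) lin2; ring.
by rewrite lin lin2 lin3; lra.
Qed.

Lemma g2_poly_ext (x x' y y' z z' : nat -> R) :
  (forall a, (0 < a < 8)%N -> x a = x' a) -> (forall a, (0 < a < 8)%N -> y a = y' a) ->
  (forall a, (0 < a < 8)%N -> z a = z' a) -> g2_poly x y z = g2_poly x' y' z'.
Proof. by move=> ex ey ez; rewrite /g2_poly /minor3 !(ex, ey, ez). Qed.

Lemma characteristic_unique w D D' : g2_structure g w ->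
  characteristic_connection g w D -> characteristic_connection g w D' -> D = D'.
Proof.
move=> [wf wfr] [Dm Ds Dw] [Dm' Ds' Dw']; apply: connection_ext => X0 Y0.
apply: vfieldP => p; have [t [tl t12 t23] tE] := connection_difference Dm Ds Dm' Ds' p.
have [e [eb wE]] := wfr p.
pose E (a : nat) : tangent p := e (inord a.-1).
have tE0 n b c (n8 : (0 < n < 8)%N) (b8 : (0 < b < 8)%N) (c8 : (0 < c < 8)%N) :
    t (E n) (E b) (E c) = 0.
  apply: (@g2_prolongation_zero R (fun a b c => t (E a) (E b) (E c))) => //.
  move=> {}n {}b {}c d {}n8 {}b8 {}c8 d8.
  have [X Xn] := vector_extension (E n).
  have [Yb Yb_b] := vector_extension (E b).
  have [Yc Yc_c] := vector_extension (E c).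
  have [Yd Yd_d] := vector_extension (E d).
  have := parallel_form_difference p X (vec3 Yb Yc Yd) wf Dw Dw'.
  rewrite /= wE !g2_modelE /vec3 /= Yb_b Yc_c Yd_d => e0; rewrite -[RHS]e0.
  have dE a b' : (0 < a < 8)%N -> (0 < b' < 8)%N -> delta_coords b' a = coords g e (E b') a.
    by move: a b' => [|a] [|b'] // a8 b8'; rewrite coords_frame.
  have tcE a b' (Y : vfield M) : (0 < a < 8)%N -> Y p = E b' ->
      t (E n) (E b') (E a) = coords g e (D X Y p - D' X Y p) a.
    move=> a8 Yb'; have [Z Zp] := vector_extension (E a).
    by rewrite -Xn -Yb' -Zp -tE Zp metric_sym.
  congr (_ + _ + _); apply: g2_poly_ext => a a8; rewrite ?dE //; exact: tcE.
have lin0 (f : tangent p -> R) : (forall a (x y : tangent p), f (a *: x + y) = a * f x + f y) ->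
    (forall a, (0 < a < 8)%N -> f (E a) = 0) -> forall x, f x = 0.
  move=> fl fE x; have f0 : f 0 = 0 by have := fl (- 1) 0 0; rewrite scaler0 addr0; lra.
  have [_ /(_ x)[c ->]] := eb.
  elim/big_rec: _ => [//|i y _ y0]; rewrite fl y0 addr0.
  have := fE i.+1; rewrite /E /= inord_val => ->; first exact: mulr0.
  exact: (ltn_ord i).
have t0 (x y z : tangent p) : t x y z = 0.
  apply: (lin0 (fun x => t x y z)) => [a u v|a a8]; first exact: tl.
  rewrite -[LHS]opprK -t12; apply/eqP; rewrite oppr_eq0; apply/eqP.
  apply: (lin0 (fun y => t y (E a) z)) => [c u v|b b8]; first exact: tl.
  rewrite -[LHS]opprK -t23 -t12; apply: (lin0 (fun z => t z (E b) (E a))) => [c' u v|c c8].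
    exact: tl.
  exact: tE0.
apply: (metric_inj (g := g)) => z; have [Z <-] := vector_extension z.
by apply/eqP; rewrite -subr_eq0 -metricBl tE t0.
Qed.

End CharacteristicUniqueness.

(** * The coassociative 4-form *)

Definition wedge22 {V : Type} {K : pzRingType} (a b : V -> V -> K) (x y z w : V) : K :=
  a x y * b z w - a x z * b y w + a x w * b y z
  + a y z * b x w - a y w * b x z + a z w * b x y.

Section ExteriorDerivativeOfFourForms.
Context {R : realType} {n : nat} {M : smooth_manifold R n}.
Implicit Types (X Y Z U W : vfield M).
Local Notation "X · f" := (vfield_app X f) (at level 34, right associativity).

Definition d2 (f : vfield M -> vfield M -> smooth_fun M) X Y Z :=
  X · f Y Z + Y · f Z X + Z · f X Y
  - f (bracket X Y) Z - f (bracket Y Z) X - f (bracket Z X) Y.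

Definition d4 (f : vfield M -> vfield M -> vfield M -> vfield M -> smooth_fun M)
    X Y Z U W :=
  X · f Y Z U W - Y · f X Z U W + Z · f X Y U W
  - U · f X Y Z W + W · f X Y Z U - f (bracket X Y) Z U W
  + f (bracket X Z) Y U W + f X (bracket Y Z) U W - f (bracket X U) Y Z W
  - f X (bracket Y U) Z W - f X Y (bracket Z U) W + f (bracket X W) Y Z U
  + f X (bracket Y W) Z U + f X Y (bracket Z W) U + f X Y Z (bracket U W).

Definition wedge32 {V : Type} {K : pzRingType} (a : V -> V -> V -> K) (b : V -> V -> K)
    (x y z u w : V) : K :=
  a z u w * b x y - a y u w * b x z + a y z w * b x u
  - a y z u * b x w + a x u w * b y z - a x z w * b y u
  + a x z u * b y w + a x y w * b z u - a x y u * b z w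
  + a x y z * b u w.

(** The Leibniz rule for 2-forms. Both terms carry a plus sign, since the degree is even and a
    3-form commutes with a 2-form. *)
Lemma d4_wedge22 (a b : vfield M -> vfield M -> smooth_fun M) X Y Z U W :
  (forall V V', a V' V = - a V V') -> (forall V V', b V' V = - b V V') ->
  (forall V V', a (- V) V' = - a V V') -> (forall V V', b (- V) V' = - b V V') ->
  d4 (wedge22 a b) X Y Z U W = wedge32 (d2 a) b X Y Z U W + wedge32 (d2 b) a X Y Z U W.
Proof.
move=> sa sb na nb; rewrite /d4 /wedge22 /wedge32 /d2.
rewrite !(bracketC X Z, bracketC X U, bracketC X W, bracketC Y U, bracketC Y W, bracketC Z W).
rewrite !(na, nb).
rewrite !(sa _ (bracket _ _)) !(sb _ (bracket _ _)).
rewrite !(sa X Y, sa X Z, sa X U, sa X W, sa Y Z, sa Y U, sa Y W, sa Z U, sa Z W, sa U W).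
rewrite !(sb X Y, sb X Z, sb X U, sb X W, sb Y Z, sb Y U, sb Y W, sb Z U, sb Z W, sb U W).
rewrite !vappE.
ring.
Qed.

Definition vec5 {T : Type} (x y z u w : T) : 'I_5 -> T :=
  fun l => match val l with 0%N => x | 1%N => y | 2 => z | 3 => u | _ => w end.

Lemma ext_d_four_form (w : form_field M 4)
    (f : vfield M -> vfield M -> vfield M -> vfield M -> smooth_fun M) X Y Z U W p :
  (forall (V : 'I_4 -> vfield M) q, w q (fun l => V l q) = f (V 0) (V 1) (V 2%:R) (V 3%:R) q) ->
  ext_d w (vec5 X Y Z U W) p = d4 f X Y Z U W p.
Proof.
move=> wf; rewrite /ext_d.
have wE (V : 'I_4 -> vfield M) : to_smooth (fun q => w q (fun l => V l q)) =
    f (V 0) (V 1) (V 2%:R) (V 3%:R).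
  by rewrite -[RHS]to_smooth_val; congr to_smooth; apply/funext => q; exact: wf.
under eq_bigr => i _ do rewrite (wE (fun l => vec5 X Y Z U W (lift i l))).
under [X in _ + X]eq_bigr => j _ do under eq_bigr => i _ do rewrite
  (wf (fun l => [eta vec5 X Y Z U W with i |-> bracket (vec5 X Y Z U W i) (vec5 X Y Z U W j)]
    (lift j l))).
rewrite !big_ord_recl !big_ord0.
do 5! rewrite big_mkcond !big_ord_recl !big_ord0 /=.
rewrite !(addr0, add0r) -[LHS]/((-1) ^+ 0%N * X p (f Y Z U W) + ((-1) ^+ 1%N * Y p (f X Z U W)
  + ((-1) ^+ 2 * Z p (f X Y U W) + ((-1) ^+ 3 * U p (f X Y Z W)
  + ((-1) ^+ 4 * W p (f X Y Z U))))) + (((-1) ^+ 1%N * f (bracket X Y) Z U W p)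
  + (((-1) ^+ 2 * f (bracket X Z) Y U W p + ((-1) ^+ 2 * f X (bracket Y Z) U W p))
  + (((-1) ^+ 3 * f (bracket X U) Y Z W p + ((-1) ^+ 3 * f X (bracket Y U) Z W p
  + ((-1) ^+ 3 * f X Y (bracket Z U) W p))) + (((-1) ^+ 4 * f (bracket X W) Y Z U p
  + ((-1) ^+ 4 * f X (bracket Y W) Z U p + ((-1) ^+ 4 * f X Y (bracket Z W) U p
  + ((-1) ^+ 4 * f X Y Z (bracket U W) p))))))))).
rewrite -[RHS]/(X p (f Y Z U W) - Y p (f X Z U W) + Z p (f X Y U W) - U p (f X Y Z W)
  + W p (f X Y Z U) - f (bracket X Y) Z U W p + f (bracket X Z) Y U W p
  + f X (bracket Y Z) U W p - f (bracket X U) Y Z W p - f X (bracket Y U) Z W p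
  - f X Y (bracket Z U) W p + f (bracket X W) Y Z U p + f X (bracket Y W) Z U p
  + f X Y (bracket Z W) U p + f X Y Z (bracket U W) p).
ring.
Qed.

End ExteriorDerivativeOfFourForms.

Section FundamentalFourForm.
Context {R : realType} {n : nat} {M : smooth_manifold R n}.
Variable S : almost_3_contact_metric M.
Implicit Types (f : smooth_fun M) (X Y Z U W : vfield M) (i j k : 'I_3).
Local Notation "X · f" := (vfield_app X f) (at level 34, right associativity).
Local Notation "⟨ X , Y ⟩" := (metric_app (a3_g S) X Y).
Local Notation H i := (oneform_app (a3_eta S i)).
Local Notation F i := (endo_app (a3_phi S i)).

Definition eta2 j k X Y : smooth_fun M := H j X * H k Y - H j Y * H k X.

Definition horizontal i j k X Y : smooth_fun M := ⟨X, F i Y⟩ + eta2 j k X Y.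

Lemma eta2_skew j k X Y : eta2 j k Y X = - eta2 j k X Y.
Proof. by rewrite /eta2; ring. Qed.

Lemma horizontal_skew i j k X Y : horizontal i j k Y X = - horizontal i j k X Y.
Proof. by rewrite /horizontal eta2_skew Phi_skew; ring. Qed.

Lemma eta2Nl j k X Y : eta2 j k (- X) Y = - eta2 j k X Y.
Proof. by rewrite /eta2 !oappE; ring. Qed.

Lemma horizontalNl i j k X Y : horizontal i j k (- X) Y = - horizontal i j k X Y.
Proof. by rewrite /horizontal eta2Nl !mappE; ring. Qed.

Definition four_form {V : Type} {K : pzRingType} (c : K) (e h : 'I_3 -> V -> V -> K)
    (x y z w : V) : K :=
  c * (wedge22 (h 0) (h 0) x y z w + wedge22 (h 1) (h 1) x y z w
       + wedge22 (h 2%:R) (h 2%:R) x y z w)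
  + (wedge22 (e 0) (h 0) x y z w + wedge22 (e 1) (h 1) x y z w
     + wedge22 (e 2%:R) (h 2%:R) x y z w).

Lemma d4_linear c (a1 a2 a3 b1 b2 b3 : vfield M -> vfield M -> vfield M -> vfield M -> smooth_fun M)
    X Y Z U W :
  let d a := d4 a X Y Z U W in
  d (fun x y z w => cst_fun c * (a1 x y z w + a2 x y z w + a3 x y z w)
      + (b1 x y z w + b2 x y z w + b3 x y z w))
  = cst_fun c * (d a1 + d a2 + d a3) + (d b1 + d b2 + d b3).
Proof. by move=> d; rewrite /d /d4 !(vappD, vappM, vapp_cst); ring. Qed.

Lemma d4_four_form (c : R) (e h : 'I_3 -> vfield M -> vfield M -> smooth_fun M) X Y Z U W :
  let d (a b : vfield M -> vfield M -> smooth_fun M) := d4 (wedge22 a b) X Y Z U W in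
  d4 (four_form (cst_fun c) e h) X Y Z U W =
  cst_fun c * (d (h 0) (h 0) + d (h 1) (h 1) + d (h 2%:R) (h 2%:R))
  + (d (e 0) (h 0) + d (e 1) (h 1) + d (e 2%:R) (h 2%:R)).
Proof. exact: d4_linear. Qed.

Definition wedge21 (a : vfield M -> vfield M -> smooth_fun M) l X Y Z : smooth_fun M :=
  a X Y * H l Z + a Y Z * H l X + a Z X * H l Y.

(** F_j ^ eta_k - eta_j ^ F_k, the 3-form to which both d F_i and d(eta_jk) are proportional. *)
Definition wedge_diff i j k X Y Z : smooth_fun M :=
  wedge21 (horizontal j k i) k X Y Z - wedge21 (horizontal k i j) j X Y Z.

Lemma wedge32_scale (a a' : vfield M -> vfield M -> vfield M -> smooth_fun M)
    (b : vfield M -> vfield M -> smooth_fun M) f X Y Z U W :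
  (forall V1 V2 V3, a V1 V2 V3 = f * a' V1 V2 V3) ->
  wedge32 a b X Y Z U W = f * wedge32 a' b X Y Z U W.
Proof. by move=> E; rewrite /wedge32 !E; ring. Qed.

Lemma wedge_diff_eta2 i j k X Y Z U W :
  wedge32 (wedge_diff i j k) (eta2 j k) X Y Z U W = 0.
Proof.
rewrite /wedge32 /wedge_diff /wedge21.
have sk l l' l'' := horizontal_skew l l' l''.
rewrite !(sk _ _ _ X Y, sk _ _ _ X Z, sk _ _ _ X U, sk _ _ _ X W, sk _ _ _ Y Z, sk _ _ _ Y U,
  sk _ _ _ Y W, sk _ _ _ Z U, sk _ _ _ Z W, sk _ _ _ U W) /eta2.
ring.
Qed.

(** The sum of F_i ^ F_j ^ eta_k - F_i ^ F_k ^ eta_j over rotations telescopes: every product of two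
    F's and one eta occurs twice with opposite signs. *)
Lemma wedge_diff_horizontal i j k X Y Z U W :
  wedge32 (wedge_diff i j k) (horizontal i j k) X Y Z U W
  + wedge32 (wedge_diff j k i) (horizontal j k i) X Y Z U W
  + wedge32 (wedge_diff k i j) (horizontal k i j) X Y Z U W = 0.
Proof.
rewrite /wedge32 /wedge_diff /wedge21.
have sk l l' l'' := horizontal_skew l l' l''.
rewrite !(sk _ _ _ X Y, sk _ _ _ X Z, sk _ _ _ X U, sk _ _ _ X W, sk _ _ _ Y Z, sk _ _ _ Y U,
  sk _ _ _ Y W, sk _ _ _ Z U, sk _ _ _ Z W, sk _ _ _ U W).
ring.
Qed.

Variables alpha delta : R.
Hypothesis hS : three_alpha_delta_sasaki S alpha delta.
Local Notation α := (cst_fun alpha).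
Local Notation δ := (cst_fun delta).

Lemma d2_eta2 i j k (C : cyc3 i j k) X Y Z : d2 (eta2 j k) X Y Z =
  2 * α * wedge_diff i j k X Y Z.
Proof.
have C1 := cyc3_rot C; have C2 := cyc3_rot C1.
have hj U V : H j (bracket U V) = U · H j V - V · H j U
    - (2 * α * ⟨U, F j V⟩ + 2 * (α - δ) * (H k U * H i V - H k V * H i U)).
  by rewrite -(structure_equation hS C1) /d1; ring.
have hk U V : H k (bracket U V) = U · H k V - V · H k U
    - (2 * α * ⟨U, F k V⟩ + 2 * (α - δ) * (H i U * H j V - H i V * H j U)).
  by rewrite -(structure_equation hS C2) /d1; ring.
rewrite /d2 /wedge_diff /wedge21 /horizontal /eta2 !vappE !hj !hk; ring.
Qed.

Lemma d2_horizontal i j k (C : cyc3 i j k) X Y Z : d2 (horizontal i j k) X Y Z =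
  2 * δ * wedge_diff i j k X Y Z.
Proof.
have -> : d2 (horizontal i j k) X Y Z = dPhi S i X Y Z + d2 (eta2 j k) X Y Z.
  by rewrite /d2 /dPhi /horizontal !vappE; ring.
rewrite (dPhiE hS C) (d2_eta2 C) /wedge_diff /wedge21 /horizontal /eta2; ring.
Qed.

Lemma d4_horizontal_horizontal i j k (C : cyc3 i j k) X Y Z U W :
  d4 (wedge22 (horizontal i j k) (horizontal i j k)) X Y Z U W =
  4 * δ * wedge32 (wedge_diff i j k) (horizontal i j k) X Y Z U W.
Proof.
have h := horizontal_skew i j k; have hN := horizontalNl i j k.
rewrite (d4_wedge22 _ _ _ _ _ h h hN hN) (wedge32_scale _ _ _ _ _ _ (d2_horizontal C)).
ring.
Qed.

Lemma d4_eta2_horizontal i j k (C : cyc3 i j k) X Y Z U W :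
  d4 (wedge22 (eta2 j k) (horizontal i j k)) X Y Z U W =
  2 * α * wedge32 (wedge_diff i j k) (horizontal i j k) X Y Z U W.
Proof.
have h := horizontal_skew i j k; have hN := horizontalNl i j k.
rewrite (d4_wedge22 _ _ _ _ _ (eta2_skew j k) h (eta2Nl j k) hN).
rewrite (wedge32_scale _ _ _ _ _ _ (d2_horizontal C)) (wedge32_scale _ _ _ _ _ _ (d2_eta2 C)).
rewrite wedge_diff_eta2; ring.
Qed.

(* [*omega = 1/6 sum_i h_i ^ h_i + sum_i eta_jk ^ h_i], where [h_i] is the
   horizontal part of [Phi_i]. *)
Definition coassociative_form X Y Z U : smooth_fun M :=
  four_form (cst_fun 6^-1) (fun i => eta2 (ordS i) (ordS (ordS i)))
    (fun i => horizontal i (ordS i) (ordS (ordS i))) X Y Z U.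

(** The two parts of the form have exterior derivatives proportional to the same cyclic sum, with
    factors 4 delta / 6 and 2 alpha, and that sum is zero. *)
Lemma coassociative_form_closed X Y Z U W : d4 coassociative_form X Y Z U W = 0.
Proof.
have C := cyc3_012; have C1 := cyc3_rot C; have C2 := cyc3_rot C1.
rewrite [LHS]d4_four_form.
have s0 : ordS 0 = 1 :> 'I_3 by apply: val_inj.
have s1 : ordS 1 = 2%:R :> 'I_3 by apply: val_inj.
have s2 : ordS 2%:R = 0 :> 'I_3 by apply: val_inj.
rewrite !(s0, s1, s2) (d4_horizontal_horizontal C) (d4_horizontal_horizontal C1).
rewrite (d4_horizontal_horizontal C2) (d4_eta2_horizontal C) (d4_eta2_horizontal C1).
rewrite (d4_eta2_horizontal C2) -!mulrDr wedge_diff_horizontal; ring.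
Qed.

End FundamentalFourForm.

Section CoassociativeFormAt.
Context {R : realType} {n : nat} {M : smooth_manifold R n}.
Variable S : almost_3_contact_metric M.
Local Notation φ := (a3_phi S).
Local Notation η := (a3_eta S).
Local Notation g := (a3_g S).
Implicit Types (p : M) (i j k : 'I_3).

Definition eta2_at j k p (u v : tangent p) : R := η j p u * η k p v - η j p v * η k p u.

Definition horizontal_at i j k p (u v : tangent p) : R := g p u (φ i p v) + eta2_at j k u v.

Definition coassociative_at p (u v w z : tangent p) : R :=
  four_form 6^-1 (fun i => @eta2_at (ordS i) (ordS (ordS i)) p)
    (fun i => @horizontal_at i (ordS i) (ordS (ordS i)) p) u v w z.

Lemma coassociative_at_app (X Y Z W : vfield M) p :
  coassociative_at (X p) (Y p) (Z p) (W p) = coassociative_form S X Y Z W p.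
Proof.
have wE (a b : vfield M -> vfield M -> smooth_fun M) (a' b' : tangent p -> tangent p -> R) :
    (forall V V' : vfield M, a' (V p) (V' p) = a V V' p) ->
    (forall V V' : vfield M, b' (V p) (V' p) = b V V' p) ->
    wedge22 a' b' (X p) (Y p) (Z p) (W p) = eval_at p (wedge22 a b X Y Z W).
  by move=> ea eb; rewrite /wedge22 !(rmorphB, rmorphD, rmorphM) /eval_at !ea !eb.
have hE i j k (V V' : vfield M) :
    horizontal_at i j k (V p) (V' p) = horizontal S i j k V V' p by [].
have eE i j (V V' : vfield M) : eta2_at i j (V p) (V' p) = eta2 S i j V V' p by [].
have lin c (a1 a2 a3 b1 b2 b3 : smooth_fun M) :
    (cst_fun c * (a1 + a2 + a3) + (b1 + b2 + b3)) p =
    c * (a1 p + a2 p + a3 p) + (b1 p + b2 p + b3 p).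
  by rewrite -[LHS]/((cst_fun c * _) p + _) cst_funM.
rewrite [RHS]lin; congr (_ * (_ + _ + _) + (_ + _ + _));
  by apply: wE => V V'; first [exact: hE | exact: eE].
Qed.

Lemma coassociative_is_form :
  is_form (fun p (v : 'I_4 -> tangent p) => coassociative_at (v 0) (v 1) (v 2%:R) (v 3%:R)).
Proof.
have eS i j p (x y : tangent p) : eta2_at i j y x = - eta2_at i j x y.
  by rewrite /eta2_at; ring.
have hS i j k p (x y : tangent p) : horizontal_at i j k y x = - horizontal_at i j k x y.
  by rewrite /horizontal_at eS metric_phi_skew; ring.
have eL i j p c (x y z : tangent p) :
    eta2_at i j (c *: x + y) z = c * eta2_at i j x z + eta2_at i j y z.
  by rewrite /eta2_at !(oneformD, oneformZ); ring.
have hL i j k p c (x y z : tangent p) :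
    horizontal_at i j k (c *: x + y) z = c * horizontal_at i j k x z + horizontal_at i j k y z.
  by rewrite /horizontal_at eL !metricE; ring.
apply: is_form4.
- by move=> p c x y u v z; rewrite /coassociative_at /four_form /wedge22 !(eL, hL); ring.
- move=> p x y z u; rewrite /coassociative_at /four_form /wedge22.
  by rewrite !(eS _ _ _ x y) !(hS _ _ _ _ x y); ring.
- move=> p x y z u; rewrite /coassociative_at /four_form /wedge22.
  by rewrite !(eS _ _ _ y z) !(hS _ _ _ _ y z); ring.
- move=> p x y z u; rewrite /coassociative_at /four_form /wedge22.
  by rewrite !(eS _ _ _ z u) !(hS _ _ _ _ z u); ring.
- move=> X Y Z W; apply: smooth_divide => p.
  exists 1, (coassociative_form S X Y Z W); split; first exact: oner_neq0.
  by move=> q; rewrite -coassociative_at_app; exact: mul1r.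
Qed.

End CoassociativeFormAt.

(** * The model 4-form and its independence of the frame *)

Section CoassociativePolynomial.
Context {R : realType}.
Implicit Types x y z w : nat -> R.

Definition minor4 x y z w a b c d : R :=
  x a * minor3 y z w b c d - y a * minor3 x z w b c d
  + z a * minor3 x y w b c d - w a * minor3 x y z b c d.
Arguments minor4 x y z w (a b c d)%_nat_scope.

Definition coassociative_poly x y z w : R :=
  minor4 x y z w 4 5 6 7 + minor4 x y z w 2 3 6 7 + minor4 x y z w 2 3 4 5
  + minor4 x y z w 1 3 5 7 - minor4 x y z w 1 3 4 6 - minor4 x y z w 1 2 5 6
  - minor4 x y z w 1 2 4 7.

Definition dot7 x y : R := \sum_(a < 7) x a.+1 * y a.+1.

(** The classical contraction identity of G2 geometry. It writes the dual 4-form in terms of the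
    3-form and the inner product, which is how its invariance is obtained below. *)
Lemma g2_poly_contraction x y z w :
  \sum_(a < 7) g2_poly (delta_coords a.+1) x y * g2_poly (delta_coords a.+1) z w
  = dot7 x z * dot7 y w - dot7 x w * dot7 y z + coassociative_poly x y z w.
Proof.
rewrite /dot7 !big_ord_recl !big_ord0 /coassociative_poly /minor4 /g2_poly /minor3.
rewrite /delta_coords /=.
ring.
Qed.

End CoassociativePolynomial.

Section CoassociativeFrames.
Context {R : realType} {M : smooth_manifold R 7}.

Lemma orthonormal_trace (g : riemannian_metric M) p (e e' : 'I_7 -> tangent p)
    (f h : tangent p -> R) :
  orthonormal_basis g e -> orthonormal_basis g e' ->
  (forall a x y, f (a *: x + y) = a * f x + f y) ->
  (forall a x y, h (a *: x + y) = a * h x + h y) ->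
  \sum_a f (e a) * h (e a) = \sum_a f (e' a) * h (e' a).
Proof.
move=> eb eb' fl hl.
have rep (k : tangent p -> R) : (forall a x y, k (a *: x + y) = a * k x + k y) ->
    forall v, k v = g p v (\sum_a k (e a) *: e a).
  move=> kl v; have k0 : k 0 = 0 by have := kl (- 1) 0 0; rewrite scaler0 addr0; lra.
  rewrite metric_sumr {1}(frame_expansion v eb).
  elim/big_rec2: _ => [//|i y1 y2 _ e2]; rewrite kl e2 metricZr metric_sym; ring.
under [RHS]eq_bigr => a _ do rewrite (rep f fl) (rep h hl).
rewrite -(parseval _ _ eb') (parseval _ _ eb).
by apply: eq_bigr => a _; rewrite -!rep.
Qed.

Lemma g2_frame_contraction g (w : form_field M 3) p (e : 'I_7 -> tangent p)
    (x y z u : tangent p) : g2_frame g w e ->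
  \sum_a w p (vec3 (e a) x y) * w p (vec3 (e a) z u)
  = g p x z * g p y u - g p x u * g p y z
    + coassociative_poly (coords g e x) (coords g e y) (coords g e z) (coords g e u).
Proof.
move=> [eb wE].
have dE v v' : g p v v' = dot7 (coords g e v) (coords g e v').
  by rewrite (parseval _ _ eb); apply: eq_bigr => a _; rewrite /coords /= inord_val.
rewrite !dE -g2_poly_contraction; apply: eq_bigr => a _; rewrite wE !g2_modelE /vec3 /=.
have E v v' : g2_poly (coords g e (e a)) (coords g e v) (coords g e v') =
    g2_poly (delta_coords a.+1) (coords g e v) (coords g e v').
  apply: g2_poly_ext => // -[//|b] b7; rewrite -[e a](f_equal e (inord_val a)).
  by rewrite coords_frame.
by rewrite !E.
Qed.

(** The sum over the frame in [g2_frame_contraction] is a trace, the same for all orthonormal bases.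
    The metric terms agree as well, so the remaining 4-form does too. *)
Lemma coassociative_poly_g2_frame g (w : form_field M 3) p (e e' : 'I_7 -> tangent p)
    (x y z u : tangent p) : is_form w -> g2_frame g w e -> g2_frame g w e' ->
  coassociative_poly (coords g e x) (coords g e y) (coords g e z) (coords g e u)
  = coassociative_poly (coords g e' x) (coords g e' y) (coords g e' z) (coords g e' u).
Proof.
move=> wf ef ef'; have [wl _ _] := form3_alternating p wf.
have := g2_frame_contraction x y z u ef.
rewrite (orthonormal_trace ef.1 ef'.1 (f := fun v => w p (vec3 v x y))
  (h := fun v => w p (vec3 v z u))) //.
by rewrite (g2_frame_contraction x y z u ef') => /addrI.
Qed.

Variable S : almost_3_contact_metric M.
Local Notation g := (a3_g S).

Lemma coassociative_normal_frame p (u : tangent p) (x y z w : tangent p) :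
  g p u u = 1 -> (forall i, g p u (a3_xi S i p) = 0) ->
  let c := coords g (normal_frame S u) in
  coassociative_at S x y z w = coassociative_poly (c x) (c y) (c z) (c w).
Proof.
move=> u1 uxi c.
have cE (v : tangent p) : [/\ c v 1%N = - a3_eta S 0 p v, c v 2%N = - a3_eta S 1 p v
   & c v 3%N = a3_eta S 2%:R p v] /\ [/\ c v 4%N = g p u v, c v 5%N = g p (a3_phi S 0 p u) v,
   c v 6%N = g p (a3_phi S 1 p u) v & c v 7%N = g p (a3_phi S 2%:R p u) v].
  have [[a1 a2 a3] [a4 a5 a6 a7]] := coords_adapted_frame S u v.
  by rewrite /c !coords_normal_frame !inordK //= a1 a2 a3 a4 a5 a6 a7 !mul1r !mulN1r.
have [[x1 x2 x3] [x4 x5 x6 x7]] := cE x; have [[y1 y2 y3] [y4 y5 y6 y7]] := cE y.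
have [[z1 z2 z3] [z4 z5 z6 z7]] := cE z; have [[w1 w2 w3] [w4 w5 w6 w7]] := cE w.
rewrite /coassociative_poly /minor4 /minor3.
rewrite x1 x2 x3 x4 x5 x6 x7 y1 y2 y3 y4 y5 y6 y7 z1 z2 z3 z4 z5 z6 z7 w1 w2 w3 w4 w5 w6 w7.
have s0 : ordS 0 = 1 :> 'I_3 by apply: val_inj.
have s1 : ordS 1 = 2%:R :> 'I_3 by apply: val_inj.
have s2 : ordS 2%:R = 0 :> 'I_3 by apply: val_inj.
rewrite /coassociative_at /four_form /wedge22 !(s0, s1, s2) /horizontal_at /eta2_at.
have C := cyc3_012; have C1 := cyc3_rot C; have C2 := cyc3_rot C1.
rewrite !(metric_phi_adapted_frame u1 uxi C, metric_phi_adapted_frame u1 uxi C1,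
  metric_phi_adapted_frame u1 uxi C2).
by field.
Qed.

End CoassociativeFrames.

(** * Hodge duality *)

Section ComplementaryMinors.
Context {R : realType}.

(** Entries indexed by natural numbers let Laplace expansion be iterated by rewriting and match
    [minor3] and [minor4], whose coordinates are functions on [nat]. *)
Lemma det_nat_rec n (F : nat -> nat -> R) :
  \det (\matrix_(i < n.+1, j < n.+1) F i j) =
  \sum_(j < n.+1) (-1) ^+ j * F 0%N j * \det (\matrix_(i < n, k < n) F i.+1 (bump j k)).
Proof.
rewrite (expand_det_row _ ord0); apply: eq_bigr => j _; rewrite mxE /cofactor add0n mulrA.
rewrite (mulrC (F _ _)); congr (_ * \det _); apply/matrixP => i k.
by rewrite !mxE /= /bump leq0n.
Qed.

Lemma det2_nat (F : nat -> nat -> R) : \det (\matrix_(i < 2, j < 2) F i j) =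
  F 0%N 0%N * F 1%N 1%N - F 0%N 1%N * F 1%N 0%N.
Proof.
rewrite det_nat_rec !big_ord_recl big_ord0 !det_mx11 !mxE /= /bump /=.
by ring.
Qed.

Lemma minor3_det (c : nat -> nat -> R) (r : nat -> nat) :
  minor3 (c 0%N) (c 1%N) (c 2%N) (r 0%N) (r 1%N) (r 2%N) =
  \det (\matrix_(i < 3, j < 3) c j (r i)).
Proof.
rewrite (det_nat_rec 2 (fun i j => c j (r i))) !big_ord_recl big_ord0.
rewrite !(det2_nat (fun i k => c (bump _ k) (r i.+1))) /= /bump /= /minor3.
by ring.
Qed.

Lemma minor4_det (c : nat -> nat -> R) (r : nat -> nat) :
  minor4 (c 0%N) (c 1%N) (c 2%N) (c 3%N) (r 0%N) (r 1%N) (r 2%N) (r 3%N) =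
  \det (\matrix_(i < 4, j < 4) c j (r i)).
Proof.
rewrite (det_nat_rec 3 (fun i j => c j (r i))) !big_ord_recl big_ord0.
rewrite -!(minor3_det (fun k => c (bump _ k)) (fun i => r i.+1)) /= /bump /= /minor4.
by ring.
Qed.

(** Jacobi's identity for complementary minors, in the case where the inverse matrix is the
    transpose. *)
Lemma complementary_minor m n (A : 'M[R]_(m + n)) : A *m A^T = 1%:M ->
  \det (drsubmx A) = \det A * \det (ulsubmx A).
Proof.
rewrite -(submxK A); set a := ulsubmx A; set b := ursubmx A; set c := dlsubmx A.
set d := drsubmx A; rewrite block_mxKdr block_mxKul => A1.
have dA : \det (block_mx a b c d) ^+ 2 = 1.
  by rewrite expr2 -{2}det_tr -det_mulmx A1 det1.
(* The second block column of the right factor consists of the lower rows of A transposed, so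
   orthonormality of rows makes the product block triangular. Taking determinants gives det A det d
   = det a, and det A squares to 1. *)
have : block_mx a b c d *m block_mx 1%:M c^T 0 d^T = block_mx a 0 c 1%:M.
  move: A1; rewrite tr_block_mx !mulmx_block scalar_mx_block => /eq_block_mx[_ e1 _ e2].
  by rewrite !mulmx1 !mulmx0 !addr0 e1 e2.
move/(congr1 (fun M => \det M)); rewrite det_mulmx det_ublock det_lblock det_tr !det1 mul1r mulr1.
by move=> <-; rewrite mulrA -expr2 dA mul1r.
Qed.

Lemma complementary_minor_rows (B : 'M[R]_7) (s : 'S_7) (r : nat -> nat) :
  B *m B^T = 1%:M -> ~~ odd_perm s -> (forall i : 'I_7, r i = (s i).+1) ->
  let c j a := B (inord a.-1) (inord j) in
  minor4 (c 3%N) (c 4%N) (c 5%N) (c 6%N) (r 3%N) (r 4%N) (r 5%N) (r 6%N) =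
  \det B * minor3 (c 0%N) (c 1%N) (c 2%N) (r 0%N) (r 1%N) (r 2%N).
Proof.
move=> B1 s0 rE c; pose A : 'M_(3 + 4) := row_perm s B.
have dA : \det A = \det B.
  by rewrite /A row_permE det_mulmx det_perm (negbTE s0) expr0 mul1r.
have A1 : A *m A^T = 1%:M.
  rewrite /A row_permE trmx_mul mulmxA -(mulmxA _ B) B1 mulmx1 tr_perm_mx -perm_mxM mulgV.
  exact: perm_mx1.
have := complementary_minor A1; rewrite dA.
rewrite (minor4_det (fun j => c (3 + j)%N) (fun i => r (3 + i)%N)) minor3_det.
have cE (i j : 'I_7) : c j (r i) = A i j by rewrite /c rE /= !inord_val mxE.
have -> : ulsubmx A = \matrix_(i < 3, j < 3) c j (r i).
  by apply/matrixP => i j; rewrite !mxE -[RHS]/(c (lshift 4 j) (r (lshift 4 i))) cE mxE.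
have -> // : drsubmx A = \matrix_(i < 4, j < 4) c (3 + j)%N (r (3 + i)%N).
by apply/matrixP => i j; rewrite !mxE -[RHS]/(c (rshift 3 j) (r (rshift 3 i))) cE mxE.
Qed.

Lemma tperm_inord (a b c : nat) : (a < 7)%N -> (b < 7)%N -> (c < 7)%N ->
  tperm (inord a) (inord b) (inord c) =
  inord (if c == a then b else if c == b then a else c) :> 'I_7.
Proof.
move=> a7 b7 c7; have E u v : (u < 7)%N -> (v < 7)%N ->
    (inord u == inord v :> 'I_7) = (u == v) by move=> u7 v7; rewrite -val_eqE /= !inordK.
rewrite permE /= !E //; by case: eqP => // _; case: eqP.
Qed.

Lemma coassociative_poly_dual (B : 'M[R]_7) : B *m B^T = 1%:M ->
  let c j a := B (inord a.-1) (inord j) in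
  coassociative_poly (c 3%N) (c 4%N) (c 5%N) (c 6%N) =
  \det B * g2_poly (c 0%N) (c 1%N) (c 2%N).
Proof.
move=> B1 c; pose t a b : 'S_7 := tperm (inord a) (inord b).
(* Each remaining pair of complementary monomials is reached from (123, 4567) by two disjoint
   transpositions, hence by an even permutation without sign. The transposed positions count from 0,
   the entries of [r] from 1. *)
have H a b a' b' (r : seq nat) : (a < b < 7)%N -> (a' < b' < 7)%N ->
    let f i a b := if i == a then b else if i == b then a else i in
    r = [seq (f (f i a b) a' b').+1 | i <- iota 0 7] ->
    minor4 (c 3%N) (c 4%N) (c 5%N) (c 6%N) (nth 0 r 3) (nth 0 r 4) (nth 0 r 5) (nth 0 r 6) =
    \det B * minor3 (c 0%N) (c 1%N) (c 2%N) (nth 0 r 0) (nth 0 r 1) (nth 0 r 2).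
  move=> /andP[ab b7] /andP[ab' b7'] f ->.
  have a7 := ltn_trans ab b7; have a7' := ltn_trans ab' b7'.
  have neq u v : (u < v)%N -> (v < 7)%N -> inord u != inord v :> 'I_7.
    by move=> uv v7; rewrite -val_eqE /= !inordK ?(ltn_trans uv) // neq_ltn uv.
  apply: (complementary_minor_rows (s := (t a b * t a' b')%g)) => //.
    by rewrite odd_permM !odd_tperm !neq.
  have f7 i u v : (i < 7)%N -> (u < 7)%N -> (v < 7)%N -> (f i u v < 7)%N.
    by move=> i7 u7 v7; rewrite /f; case: ifP => // _; case: ifP.
  apply: ord7P => m m7; rewrite permM !tperm_inord -/(f _ _ _) ?f7 //.
  by rewrite !inordK ?f7 // (nth_map 0%N) ?size_iota // nth_iota.
pose C x1 x2 x3 x4 := minor4 (c 3%N) (c 4%N) (c 5%N) (c 6%N) x1 x2 x3 x4.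
have e1 : C 4%N 5%N 6%N 7%N = \det B * minor3 (c 0%N) (c 1%N) (c 2%N) 1 2 3.
  by apply: (complementary_minor_rows (s := 1%g) (r := S));
    rewrite ?odd_perm1 // => i; rewrite perm1.
have e2 := H 1%N 3%N 2%N 4%N [:: 1; 4; 5; 2; 3; 6; 7]%N isT isT erefl.
have e3 := H 1%N 5%N 2%N 6%N [:: 1; 6; 7; 4; 5; 2; 3]%N isT isT erefl.
have e4 := H 0%N 3%N 2%N 5%N [:: 4; 2; 6; 1; 5; 3; 7]%N isT isT erefl.
have e5 := H 0%N 4%N 2%N 6%N [:: 5; 2; 7; 4; 1; 6; 3]%N isT isT erefl.
have e6 := H 0%N 3%N 1%N 6%N [:: 4; 7; 3; 1; 5; 6; 2]%N isT isT erefl.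
have e7 := H 0%N 4%N 1%N 5%N [:: 5; 6; 3; 4; 1; 2; 7]%N isT isT erefl.
move: e2 e3 e4 e5 e6 e7; rewrite /= -!/(C _ _ _ _) => e2 e3 e4 e5 e6 e7.
(* The permuted index lists are not increasing; rewriting the 4-form with these orders accounts for
   its signs. *)
transitivity (C 4%N 5%N 6%N 7%N + C 2%N 3%N 6%N 7%N + C 4%N 5%N 2%N 3%N
  - C 1%N 5%N 3%N 7%N + C 4%N 1%N 6%N 3%N - C 1%N 5%N 6%N 2%N - C 4%N 1%N 2%N 7%N).
  by rewrite /coassociative_poly /C /minor4 /minor3; ring.
rewrite e1 e2 e3 e4 e5 e6 e7 /g2_poly /minor3; ring.
Qed.

End ComplementaryMinors.

(** * The dual of the canonical form and cocalibration *)

Section Cocalibrated.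
Context {R : realType} {M : smooth_manifold R 7}.

Lemma orthonormal_matrix (g : riemannian_metric M) p (e f : 'I_7 -> tangent p) :
  orthonormal_basis g e -> orthonormal_basis g f ->
  let A := \matrix_(i, j) g p (e i) (f j) in A *m A^T = 1%:M.
Proof.
move=> eb fb A; apply: mulmx1C; apply/matrixP => i j; rewrite !mxE -fb.1 (parseval _ _ eb).
by apply: eq_bigr => k _; rewrite !mxE.
Qed.

Variable S : almost_3_contact_metric M.
Local Notation g := (a3_g S).
Local Notation ω := (canonical_3form S).

(** The orientation hypothesis supplies an arbitrary frame in which omega is standard, while the
    4-form was computed in one built from an adapted frame; this links the two. *)
Lemma coassociative_g2_frame p (e : 'I_7 -> tangent p) (x y z w : tangent p) :
  g2_frame g ω e ->
  coassociative_at S x y z w =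
  coassociative_poly (coords g e x) (coords g e y) (coords g e z) (coords g e w).
Proof.
move=> ef; have [u [u1 ux]] := exists_unit_horizontal S p.
rewrite (coassociative_normal_frame _ _ _ _ u1 ux).
exact: coassociative_poly_g2_frame (canonical_3form_is_form S) (g2_frame_normal_frame u1 ux) ef.
Qed.

Lemma coassociative_hodge_dual : @hodge_dual R 7 M g 3 4 (g2_oriented g ω) ω
  (fun p v => coassociative_at S (v 0) (v 1) (v 2%:R) (v 3%:R)).
Proof.
move=> p f fb [e ef det0] s; have [eb wE] := ef.
pose A : 'M[R]_7 := \matrix_(i, j) g p (e i) (f j).
have A1 : A *m A^T = 1%:M by exact: orthonormal_matrix.
(* Orthogonality leaves the values 1 and -1; positivity of the basis excludes the second. *)
have detA : \det A = 1.
  have : \det A ^+ 2 = 1 by rewrite expr2 -{2}det_tr -det_mulmx A1 det1.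
  by move/eqP; rewrite sqrf_eq1 => /orP[/eqP //|/eqP A0]; move: det0; rewrite -/A A0; lra.
(* Permuting columns turns the duality statement for [s] into the one for the identity permutation,
   with the sign of [s] as determinant of [B]. *)
pose B := col_perm s A.
have B1 : B *m B^T = 1%:M.
  rewrite /B col_permE trmx_mul mulmxA -(mulmxA A) tr_perm_mx -perm_mxM mulgV perm_mx1 mulmx1.
  exact: A1.
have detB : \det B = (-1) ^+ s by rewrite /B col_permE det_mulmx detA mul1r det_perm odd_permV.
rewrite (coassociative_g2_frame _ _ _ _ ef) wE g2_modelE.
have cE (i : 'I_(3 + 4)) m : val i = m ->
    coords g e (f (s i)) = fun a => B (inord a.-1) (inord m).
  by move=> <-; apply/funext => a; rewrite inord_val !mxE.
rewrite (cE (rshift 3 0) 3%N) // (cE (rshift 3 1) 4%N) // (cE (rshift 3 2%:R) 5%N) //.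
rewrite (cE (rshift 3 3%:R) 6%N) // (cE (lshift 4 0) 0%N) // (cE (lshift 4 1) 1%N) //.
by rewrite (cE (lshift 4 2%:R) 2%N) // -detB; exact: coassociative_poly_dual.
Qed.

Lemma coassociative_closed alpha delta (hS : three_alpha_delta_sasaki S alpha delta)
    (X : 'I_5 -> vfield M) p :
  ext_d (fun p v => coassociative_at S (v 0) (v 1) (v 2%:R) (v 3%:R)) X p = 0.
Proof.
have -> : X = vec5 (X 0) (X 1) (X 2%:R) (X 3%:R) (X 4%:R).
  by apply/funext => -[[|[|[|[|[|//]]]]] i5]; congr X; exact: val_inj.
rewrite (ext_d_four_form (f := coassociative_form S)) => [|Y q].
  by rewrite (coassociative_form_closed hS).
exact: coassociative_at_app.
Qed.

Lemma canonical_cocalibrated alpha delta :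
  three_alpha_delta_sasaki S alpha delta -> cocalibrated_g2 g ω.
Proof.
move=> hS; split; first exact: canonical_g2_structure.
exists (fun p v => coassociative_at S (v 0) (v 1) (v 2%:R) (v 3%:R)); split.
- exact: coassociative_is_form.
- exact: coassociative_hodge_dual.
- exact: coassociative_closed hS.
Qed.

End Cocalibrated.

Theorem theorem4p5p1 (R : realType) (M : smooth_manifold R 7)
    (S : almost_3_contact_metric M) (alpha delta : R)
    (hS : three_alpha_delta_sasaki S alpha delta) :
  let g := a3_g S in
  let omega := canonical_3form S in
  [/\ forall (p : M) (e4 : tangent p),
        g p e4 e4 = 1 -> (forall i : 'I_3, g p e4 (a3_xi S i p) = 0) ->
        let eta := coframe3 g (adapted_frame S e4) in
        omega p = - eta 1%N 4%N 5%N - eta 1%N 6%N 7%N - eta 2%N 4%N 6%N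
                  + eta 2%N 5%N 7%N - eta 3%N 4%N 7%N - eta 3%N 5%N 6%N
                  + eta 1%N 2%N 3%N,
      cocalibrated_g2 g omega &
      exists D : connection M,
        unique (canonical_connection S alpha delta) D /\
        unique (characteristic_connection g omega) D].
Proof.
split.
- by move=> p e4 u1 ux; exact: canonical_3form_adapted_frame.
- exact: canonical_cocalibrated hS.
have [D hD] := canonical_connection_exists hS.
have charD := canonical_characteristic hD.
have uniqD D' : characteristic_connection (a3_g S) (canonical_3form S) D' -> D = D'.
  exact: characteristic_unique (canonical_g2_structure S) charD.
exists D; split; split => // D' hD'; apply: uniqD.
exact: canonical_characteristic hD'.
Qed.
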